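(* Let $0<a_j\le1$ and $0\le\alpha_i<\min_ja_j$. For every $\underline\lambda_N\in\mathbb G_N$ and $t>0$, $$\frac{d}{dt}P_t(\underline\lambda_N)=\sum_{\underline\mu_N\in\mathbb G_N}P_t(\underline\mu_N)L(\underline\mu_N,\underline\lambda_N),\qquad L(\underline\mu_N,\underline\lambda_N)=\sum_{1\le j\le k\le N}r_{jk}(\underline\mu_N)\big(\delta_{\underline\lambda_N,\underline\mu_N^{jk+}}-\delta_{\underline\lambda_N,\underline\mu_N}\big),$$ with $$r_{jk}(\underline\mu_N)=a_k\frac{(1-q^{\mu^{(k-1)}_{j-1}-\mu^{(k)}_j})(1-q^{\mu^{(k)}_j-\mu^{(k)}_{j+1}+1})}{1-q^{\mu^{(k)}_j-\mu^{(k-1)}_j+1}},$$ using the conventions $\mu^{(i)}_0=+\infty$ and $\mu^{(i)}_{i+1}=-\infty$. Moreover $L$ is the generator of a continuous-time Markov chain on $\mathbb G_N$ (off-diagonal entries nonnegative, rows summing to zero).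
   Context: Fix $0<q<1$; $(x;q)_\infty=\prod_{k\ge0}(1-xq^k)$, $(x;q)_n=(x;q)_\infty/(xq^n;q)_\infty$ ($1/(q;q)_n=0$ for $n<0$). $\mathcal S_n=\{\lambda\in\mathbb Z^n:\lambda_1\ge\dots\ge\lambda_n\}$, $\mathcal S_0=\{\varnothing\}$. $\mathbb G_N$: tuples $(\lambda^{(1)},\dots,\lambda^{(N)})$, $\lambda^{(n)}\in\mathcal S_n$, with $\lambda^{(m+1)}_{\ell+1}\le\lambda^{(m)}_\ell\le\lambda^{(m+1)}_\ell$. $P_{\lambda/\mu}(a)=a^{\sum_i\lambda_i-\sum_i\mu_i}\prod_{i=1}^{n-1}\frac{(q;q)_{\lambda_i-\lambda_{i+1}}}{(q;q)_{\lambda_i-\mu_i}(q;q)_{\mu_i-\lambda_{i+1}}}$, $P_{\lambda/\varnothing}(a)=a^{\lambda_1}$; $P_\lambda(x)=\sum\prod_jP_{\lambda^{(j)}/\lambda^{(j-1)}}(x_j)$ over $\mathbb G_N$ with $\lambda^{(N)}=\lambda$. $m_N^q(z)=\frac{1}{(2\pi i)^NN!}\prod_{i<j}(z_i/z_j;q)_\infty(z_j/z_i;q)_\infty$, $\Pi(z;\alpha,t)=\prod_{i,j}(\alpha_i/z_j;q)_\infty^{-1}\prod_je^{z_jt}$, $Q_\lambda(\alpha,t)=\prod_{i=1}^{N-1}(q^{\lambda_i-\lambda_{i+1}+1};q)_\infty\int_{\mathbb T^N}\prod_i\frac{dz_i}{z_i}P_\lambda(1/z)\Pi(z;\alpha,t)m_N^q(z)$,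 $\mathbb T$ the unit circle. Two-sided $q$-Whittaker process: $P_t(\underline\lambda_N)=\prod_{j=1}^NP_{\lambda^{(j)}/\lambda^{(j-1)}}(a_j)Q_{\lambda^{(N)}}(\alpha,t)/\Pi(a;\alpha,t)$. For $\underline\mu_N\in\mathbb G_N$ and $1\le j\le k\le N$, let $m_{jk}\ge0$ be the largest integer with $k+m_{jk}\le N$ and $\mu^{(k)}_j=\mu^{(k+1)}_j=\dots=\mu^{(k+m_{jk})}_j$; $\underline\mu^{jk+}_N$ is obtained from $\underline\mu_N$ by adding $1$ to $\mu^{(a)}_j$ for all $a\in\{k,\dots,k+m_{jk}\}$ (all other entries unchanged). *)

(* Defs.v *)
From Stdlib Require Import Reals ZArith List ClassicalEpsilon.
Import ListNotations.
Open Scope R_scope.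

Definition C : Type := (R * R)%type.
Definition RtoC (x : R) : C := (x, 0).
Definition C0 : C := (0, 0).
Definition C1 : C := (1, 0).
Definition Cadd (z w : C) : C := (fst z + fst w, snd z + snd w).
Definition Csub (z w : C) : C := (fst z - fst w, snd z - snd w).
Definition Cmul (z w : C) : C :=
  (fst z * fst w - snd z * snd w, fst z * snd w + snd z * fst w).
Definition Cinv (z : C) : C :=
  let d := fst z ^ 2 + snd z ^ 2 in (fst z / d, - snd z / d).
Definition Cdiv (z w : C) : C := Cmul z (Cinv w).
Definition Cexp (z : C) : C := (exp (fst z) * cos (snd z), exp (fst z) * sin (snd z)).
Fixpoint Cpow (z : C) (n : nat) : C :=
  match n with O => C1 | S m => Cmul z (Cpow z m) end.
(* integer powers z^k, k in Z (z <> 0 where used) *)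
Definition Cpowz (z : C) (k : Z) : C :=
  match k with
  | Z0 => C1
  | Zpos p => Cpow z (Pos.to_nat p)
  | Zneg p => Cinv (Cpow z (Pos.to_nat p))
  end.
Definition eith (th : R) : C := (cos th, sin th).

Definition range (a b : nat) : list nat := seq a (S b - a)%nat.
Definition Rprod (l : list nat) (f : nat -> R) : R := fold_right (fun k acc => f k * acc) 1 l.
Definition Cprod (l : list nat) (f : nat -> C) : C := fold_right (fun k acc => Cmul (f k) acc) C1 l.
Definition Rsum_list {A : Type} (l : list A) (f : A -> R) : R :=
  fold_right (fun x acc => f x + acc) 0 l.
Definition Csum_list {A : Type} (l : list A) (f : A -> C) : C :=
  fold_right (fun x acc => Cadd (f x) acc) C0 l.
Definition sumZ (l : list Z) : Z := fold_right Z.add 0%Z l.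

Definition Rlim (u : nat -> R) : R := epsilon (inhabits 0) (fun l => Un_cv u l).
Definition Clim (u : nat -> C) : C := (Rlim (fun n => fst (u n)), Rlim (fun n => snd (u n))).

Definition qpoch_inf (q : R) (x : C) : C :=
  Clim (fun n => Cprod (seq 0 n) (fun k => Csub C1 (Cmul x (RtoC (q ^ k))))).
Definition qpoch_inf_R (q x : R) : R :=
  Rlim (fun n => Rprod (seq 0 n) (fun k => 1 - x * q ^ k)).
Definition qpoch_fin (q x : R) (n : Z) : R :=
  qpoch_inf_R q x / qpoch_inf_R q (x * powerRZ q n).
Definition inv_qq (q : R) (n : Z) : R :=
  if (n <? 0)%Z then 0 else / qpoch_fin q q n.

(* A pattern is a list of rows [lambda^(1); ...; lambda^(N)], row n having n entries. *)
Definition pattern := list (list Z).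
(* row p n = lambda^(n) (1-indexed); row p 0 = empty signature *)
Definition row (p : pattern) (n : nat) : list Z :=
  match n with O => [] | S m => nth m p [] end.
(* entry p n i = lambda^(n)_i (1-indexed) *)
Definition entry (p : pattern) (n i : nat) : Z := nth (i - 1)%nat (row p n) 0%Z.
Definition lnth (l : list Z) (i : nat) : Z := nth (i - 1)%nat l 0%Z.

Definition inG (N : nat) (p : pattern) : Prop :=
  length p = N /\
  (forall n, (1 <= n <= N)%nat -> length (row p n) = n) /\
  (forall n i, (1 <= n <= N)%nat -> (1 <= i < n)%nat -> (entry p n (S i) <= entry p n i)%Z) /\
  (forall m l, (1 <= m < N)%nat -> (1 <= l <= m)%nat ->
     (entry p (S m) (S l) <= entry p m l <= entry p (S m) l)%Z).

Definition Pskew (q : R) (lam mu : list Z) (x : C) : C :=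
  let n := length lam in
  Cmul (Cpowz x (sumZ lam - sumZ mu)%Z)
       (RtoC (Rprod (range 1 (n - 1))
          (fun i => qpoch_fin q q (lnth lam i - lnth lam (S i))%Z
                    * inv_qq q (lnth lam i - lnth mu i)%Z
                    * inv_qq q (lnth mu i - lnth lam (S i))%Z))).

Definition zrange (lo hi : Z) : list Z :=
  map (fun k => (lo + Z.of_nat k)%Z) (seq 0 (Z.to_nat (hi - lo + 1))).
Fixpoint interl_below (lam : list Z) : list (list Z) :=
  match lam with
  | [] => []
  | [_] => [[]]
  | l1 :: ((l2 :: _) as rest) =>
      flat_map (fun m => map (cons m) (interl_below rest)) (zrange l2 l1)
  end.
Fixpoint pats (n : nat) (lam : list Z) : list pattern :=
  match n with
  | O => [[]]
  | S m => flat_map (fun mu => map (fun p => p ++ [lam]) (pats m mu)) (interl_below lam)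
  end.

Definition Psym (q : R) (lam : list Z) (x : list C) : C :=
  let N := length lam in
  Csum_list (pats N lam)
    (fun p => Cprod (range 1 N) (fun j => Pskew q (row p j) (row p (j - 1)) (nth (j - 1) x C0))).

Definition RInt (f : R -> R) (a b : R) : R :=
  epsilon (inhabits 0) (fun v => exists pr : Riemann_integrable f a b, RiemannInt pr = v).
Definition CInt (f : R -> C) (a b : R) : C :=
  (RInt (fun s => fst (f s)) a b, RInt (fun s => snd (f s)) a b).
Fixpoint torus_int (n : nat) (F : list R -> C) : C :=
  match n with
  | O => F []
  | S m => CInt (fun th => torus_int m (fun ths => F (th :: ths))) 0 (2 * PI)
  end.
(* (2 pi i)^{-N} \int_{T^N} prod_i dz_i/z_i F(z)  =  (2 pi)^{-N} \int_{[0,2pi]^N} F(e^{i theta}) dtheta *)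
Definition torus_contour (N : nat) (F : list C -> C) : C :=
  Cmul (RtoC (/ (2 * PI) ^ N)) (torus_int N (fun ths => F (map eith ths))).

Definition mq_core (q : R) (N : nat) (z : list C) : C :=
  Cmul (RtoC (/ INR (fact N)))
    (Cprod (range 1 N) (fun i => Cprod (range (S i) N) (fun j =>
       Cmul (qpoch_inf q (Cdiv (nth (i - 1) z C0) (nth (j - 1) z C0)))
            (qpoch_inf q (Cdiv (nth (j - 1) z C0) (nth (i - 1) z C0)))))).

Definition PiC (q : R) (z : list C) (alpha : list R) (t : R) : C :=
  let N := length z in
  Cmul (fold_right (fun ai acc =>
          Cmul (Cprod (range 1 N) (fun j => Cinv (qpoch_inf q (Cdiv (RtoC ai) (nth (j - 1) z C0))))) acc)
        C1 alpha)
       (Cprod (range 1 N) (fun j => Cexp (Cmul (nth (j - 1) z C0) (RtoC t)))).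

Definition Qfun (q : R) (lam : list Z) (alpha : list R) (t : R) : C :=
  let N := length lam in
  Cmul (RtoC (Rprod (range 1 (N - 1))
                 (fun i => qpoch_inf_R q (powerRZ q (lnth lam i - lnth lam (S i) + 1)%Z))))
       (torus_contour N (fun z =>
          Cmul (Psym q lam (map Cinv z)) (Cmul (PiC q z alpha t) (mq_core q N z)))).

Definition Pt (q : R) (N : nat) (a alpha : list R) (t : R) (p : pattern) : C :=
  Cdiv (Cmul (Cprod (range 1 N) (fun j => Pskew q (row p j) (row p (j - 1)) (RtoC (nth (j - 1) a 0))))
             (Qfun q (row p N) alpha t))
       (PiC q (map RtoC a) alpha t).

Fixpoint blk_ext (N j k : nat) (mu : pattern) (fuel cur : nat) : nat :=
  match fuel with
  | O => cur
  | S f => if (Nat.leb (S cur) N && Z.eqb (entry mu (S cur) j) (entry mu k j))%bool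
           then blk_ext N j k mu f (S cur) else cur
  end.
Definition blk_end (N : nat) (mu : pattern) (j k : nat) : nat := blk_ext N j k mu N k.

Fixpoint upd_nth (i : nat) (f : Z -> Z) (l : list Z) : list Z :=
  match l, i with
  | [], _ => []
  | x :: r, O => f x :: r
  | x :: r, S i' => x :: upd_nth i' f r
  end.
Definition plus_jk (N : nat) (mu : pattern) (j k : nat) : pattern :=
  let e := blk_end N mu j k in
  map (fun ar => if (Nat.leb k (fst ar) && Nat.leb (fst ar) e)%bool
                 then upd_nth (j - 1) Z.succ (snd ar) else snd ar)
      (combine (range 1 (length mu)) mu).

(* r_jk(mu), with mu^(i)_0 = +oo and mu^(i)_{i+1} = -oo (so q^{+oo} = 0) *)
Definition rate (q : R) (a : list R) (mu : pattern) (j k : nat) : R :=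
  nth (k - 1) a 0
  * (if Nat.eqb j 1 then 1 else 1 - powerRZ q (entry mu (k - 1) (j - 1) - entry mu k j)%Z)
  * (if Nat.eqb j k then 1 else 1 - powerRZ q (entry mu k j - entry mu k (S j) + 1)%Z)
  / (if Nat.eqb j k then 1 else 1 - powerRZ q (entry mu k j - entry mu (k - 1) j + 1)%Z).

Definition Kdelta (p1 p2 : pattern) : R :=
  if list_eq_dec (list_eq_dec Z.eq_dec) p1 p2 then 1 else 0.

Definition Lgen (q : R) (N : nat) (a : list R) (mu lam : pattern) : R :=
  Rsum_list (range 1 N) (fun k => Rsum_list (range 1 k) (fun j =>
    rate q a mu j k * (Kdelta lam (plus_jk N mu j k) - Kdelta lam mu))).

(* Main.v *)
(** The coefficient identity behind everything is a telescoping sum over two consecutive rows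
    [x = mu^(k-1)], [y = mu^(k)]: with [E_j = q^(x_j - y_{j+1})], the rate [r_jk / a_k] exceeds by
    [E_j - E_{j-1}] the weight ratio of lowering [x_j] under a fixed row [y].

    A transition into [lam] is determined by the column [j] and the last level [e] of the moved
    string, whose first level [k] is then the start of the maximal constant string of column [j] ending
    at [e].  In the product of the branching weights along the string everything cancels except one
    factor at level [e]; summing over [j] and [e < N] and telescoping compensates the total outgoing
    rate up to [a_1 + ... + a_N], and the strings reaching level [N] are left over.

    On the other side the Pieri rule
    [(sum_j 1/x_j) P_lam = sum_i (1 - q^(lam_i - lam_{i+1})) P_{lam - e_i}], proved by induction on the
    number of variables from a similar two-row identity, computes the time derivative of [Q_lam] under
    the torus integral; it produces the left-over terms.  The derivative of [1 / Pi(a; alpha, t)]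
    produces [- (a_1 + ... + a_N)]. *)

(* Limits and integrals are [epsilon] choices, so they mean something only after convergence or
   integrability has been proved. This is the reason for the class [BL] of bounded Lipschitz
   functions of the angles: it contains the whole integrand, because 0 <= alpha_i < 1 keeps the
   denominators of Pi away from zero on the torus, and it yields existence, linearity and a size
   bound for iterated integrals. A quadratic remainder estimate for the exponential then gives the
   derivative in t.

   Sums over the infinite set G_N appear as sums over any finite list that contains the support, and
   [Rsum_support] makes all such lists interchangeable.

   The balance of flows is proved for the pattern weight times an arbitrary real function [V] of the
   top row. It can therefore be applied separately to the real and the imaginary part of the
   normalized Q.

   Lowering a part may leave the set of signatures. The terms that arise are still defined as
   expressions, but their coefficients vanish exactly in that case. *)
From Coquelicot Require Import Rbar Lim_seq Series Hierarchy RInt Rcomplements Derive.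
From Coquelicot Require Complex.
From Stdlib Require Import Reals ZArith List Psatz Permutation.
From Stdlib Require Import FunctionalExtensionality ClassicalEpsilon.
Require Import Defs.
Import ListNotations.
Open Scope R_scope.

(** * Finite sums and products *)

Lemma range1 (n : nat) : range 1 n = seq 1 n.
Proof. unfold range. f_equal. lia. Qed.

Section Sums.
Context {A : Type}.
Implicit Types (l : list A) (f g : A -> R).

Lemma Rsum_ext l f g : (forall x, In x l -> f x = g x) -> Rsum_list l f = Rsum_list l g.
Proof.
  induction l as [|x l IH]; simpl; intros H; [reflexivity|].
  rewrite H by auto. rewrite IH; auto.
Qed.

Lemma Rsum_cons (x : A) l f : Rsum_list (x :: l) f = f x + Rsum_list l f.
Proof. reflexivity. Qed.

Lemma Rsum_zero l f : (forall x, In x l -> f x = 0) -> Rsum_list l f = 0.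
Proof.
  induction l as [|x l IH]; simpl; intros H; [reflexivity|].
  rewrite H, IH by auto. lra.
Qed.

Lemma Rsum_plus l f g : Rsum_list l (fun x => f x + g x) = Rsum_list l f + Rsum_list l g.
Proof. induction l as [|x l IH]; simpl; [lra | rewrite IH; lra]. Qed.

Lemma Rsum_minus l f g : Rsum_list l (fun x => f x - g x) = Rsum_list l f - Rsum_list l g.
Proof. induction l as [|x l IH]; simpl; [lra | rewrite IH; lra]. Qed.

Lemma Rsum_scal l f (c : R) : Rsum_list l (fun x => c * f x) = c * Rsum_list l f.
Proof. induction l as [|x l IH]; simpl; [lra | rewrite IH; lra]. Qed.

Lemma Rsum_app l l' f : Rsum_list (l ++ l') f = Rsum_list l f + Rsum_list l' f.
Proof. induction l as [|x l IH]; simpl; [lra | rewrite IH; lra]. Qed.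

Lemma Rsum_perm l l' f : Permutation l l' -> Rsum_list l f = Rsum_list l' f.
Proof. induction 1; simpl; lra. Qed.

Lemma Rsum_nonzero l f : Rsum_list l f <> 0 -> exists x, In x l /\ f x <> 0.
Proof.
  intros H. apply NNPP; intros Hn. apply H, Rsum_zero. intros x Hx.
  apply NNPP; intros Hf. apply Hn. exists x; auto.
Qed.

Lemma Rsum_nonneg l f : (forall x, In x l -> 0 <= f x) -> 0 <= Rsum_list l f.
Proof.
  induction l as [|x l IH]; simpl; intros H; [lra|].
  assert (0 <= f x) by auto. assert (0 <= Rsum_list l f) by auto. lra.
Qed.

Definition nonzerob f (x : A) : bool := if Req_EM_T (f x) 0 then false else true.

Lemma Rsum_filter_nonzero l f : Rsum_list (filter (nonzerob f) l) f = Rsum_list l f.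
Proof.
  induction l as [|x l IH]; simpl; [reflexivity|].
  unfold nonzerob at 1. destruct (Req_EM_T (f x) 0) as [E|E]; simpl; rewrite IH; lra.
Qed.

(** Makes any two duplicate-free enumerations of a support interchangeable; all reindexings of sums
    over patterns and rows go through it. *)
Lemma Rsum_support l l' f : NoDup l -> NoDup l' ->
  (forall x, In x l -> f x <> 0 -> In x l') ->
  (forall x, In x l' -> f x <> 0 -> In x l) -> Rsum_list l f = Rsum_list l' f.
Proof.
  intros N1 N2 H1 H2. rewrite <- (Rsum_filter_nonzero l), <- (Rsum_filter_nonzero l').
  apply Rsum_perm, NoDup_Permutation; try (apply NoDup_filter; assumption).
  intros x. rewrite !filter_In. unfold nonzerob.
  destruct (Req_EM_T (f x) 0) as [E|E].
  - split; intros [_ Hb]; discriminate Hb.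
  - split; intros [Hx _]; auto.
Qed.

Lemma Rsum_single l f (x0 : A) : NoDup l -> In x0 l ->
  (forall x, In x l -> x <> x0 -> f x = 0) -> Rsum_list l f = f x0.
Proof.
  intros N1 I H. rewrite (Rsum_support l [x0]); simpl; try lra; auto.
  - constructor; [simpl; tauto | constructor].
  - intros x Hx Hf. left. apply NNPP; intros D. apply Hf, H; auto.
  - intros x [->|[]] _; auto.
Qed.

End Sums.

Lemma Rsum_map {A B : Type} (h : A -> B) (l : list A) (f : B -> R) :
  Rsum_list (map h l) f = Rsum_list l (fun x => f (h x)).
Proof. induction l as [|x l IH]; simpl; [reflexivity | rewrite IH; reflexivity]. Qed.

Lemma Rsum_swap {A B : Type} (l : list A) (l' : list B) (f : A -> B -> R) :
  Rsum_list l (fun x => Rsum_list l' (f x)) = Rsum_list l' (fun y => Rsum_list l (fun x => f x y)).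
Proof.
  induction l as [|x l IH]; simpl.
  - symmetry; apply Rsum_zero; reflexivity.
  - rewrite IH, <- Rsum_plus. reflexivity.
Qed.

Lemma Rsum_list_prod {A B : Type} (l : list A) (l' : list B) (f : A * B -> R) :
  Rsum_list (list_prod l l') f = Rsum_list l (fun x => Rsum_list l' (fun y => f (x, y))).
Proof.
  induction l as [|x l IH]; simpl; [reflexivity|].
  rewrite Rsum_app, Rsum_map, IH. reflexivity.
Qed.

Lemma NoDup_list_prod {A B : Type} (l : list A) (l' : list B) :
  NoDup l -> NoDup l' -> NoDup (list_prod l l').
Proof.
  intros H H'. induction H as [|x l Hx H IH]; simpl; [constructor|].
  apply NoDup_app; auto.
  - apply FinFun.Injective_map_NoDup; auto. intros y y' E; congruence.
  - intros [u v] Hin. apply in_map_iff in Hin. destruct Hin as [y [E _]].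
    injection E; intros; subst. rewrite in_prod_iff. tauto.
Qed.

Lemma NoDup_map_inj {A B : Type} (h : A -> B) (l : list A) :
  (forall x y, In x l -> In y l -> h x = h y -> x = y) -> NoDup l -> NoDup (map h l).
Proof.
  intros Hi H. induction H as [|x l Hx H IH]; simpl; constructor.
  - intros Hin. apply in_map_iff in Hin. destruct Hin as [y [E Hy]].
    apply Hx. rewrite <- (Hi y x); simpl; auto.
  - apply IH. intros; apply Hi; simpl; auto.
Qed.

(** Turns a triangular double sum into a square one, so that the pairs (k, j) can range over a
    product list. *)
Lemma Rsum_seq_extend (n N : nat) (f : nat -> R) : (n <= N)%nat ->
  Rsum_list (seq 1 n) f = Rsum_list (seq 1 N) (fun j => if (j <=? n)%nat then f j else 0).
Proof.
  intros H.
  rewrite (Rsum_ext (seq 1 n) f (fun j => if (j <=? n)%nat then f j else 0)).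
  - apply Rsum_support; try apply seq_NoDup.
    + intros x Hx _. apply in_seq in Hx. apply in_seq. lia.
    + intros x Hx Hf. apply in_seq in Hx. apply in_seq.
      destruct (Nat.leb_spec x n); [lia | lra].
  - intros x Hx. apply in_seq in Hx. destruct (Nat.leb_spec x n); [reflexivity | lia].
Qed.

Lemma Rsum_seq_S (s n : nat) (f : nat -> R) :
  Rsum_list (seq s (S n)) f = Rsum_list (seq s n) f + f (s + n)%nat.
Proof. rewrite seq_S, Rsum_app. simpl. lra. Qed.

Lemma Rsum_telescope (f : nat -> R) (n : nat) :
  Rsum_list (seq 1 n) (fun j => f j - f (j - 1)%nat) = f n - f O.
Proof.
  induction n as [|n IH]; [simpl; lra|].
  rewrite Rsum_seq_S, IH. replace (1 + n - 1)%nat with n by lia.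
  change (1 + n)%nat with (S n). lra.
Qed.

Lemma Rprod_ext (l : list nat) (f g : nat -> R) :
  (forall x, In x l -> f x = g x) -> Rprod l f = Rprod l g.
Proof.
  unfold Rprod. induction l as [|x l IH]; simpl; intros H; [reflexivity|].
  rewrite H by auto. rewrite IH; auto.
Qed.

Lemma Rprod_mult (l : list nat) (f g : nat -> R) :
  Rprod l (fun x => f x * g x) = Rprod l f * Rprod l g.
Proof. unfold Rprod. induction l as [|x l IH]; simpl; [lra | rewrite IH; lra]. Qed.

Lemma Rprod_seq_S (s n : nat) (f : nat -> R) :
  Rprod (seq s (S n)) f = Rprod (seq s n) f * f (s + n)%nat.
Proof.
  rewrite seq_S. unfold Rprod. generalize (seq s n). intros l.
  induction l as [|x l IH]; simpl; [lra | rewrite IH; lra].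
Qed.

Lemma Rprod_indicator (n j : nat) (c : R) :
  Rprod (seq 1 n) (fun i => if (i =? j)%nat then c else 1)
  = if (Nat.leb 1 j && Nat.leb j n)%bool then c else 1.
Proof.
  induction n as [|n IH].
  - simpl. destruct j; reflexivity.
  - rewrite Rprod_seq_S, IH. change (1 + n)%nat with (S n).
    destruct (Nat.leb_spec 1 j), (Nat.leb_spec j n), (Nat.leb_spec j (S n)),
      (Nat.eqb_spec (S n) j); simpl; try lra; lia.
Qed.

(* Raising or lowering the [j]-th part of the upper row changes the factors [j] and [j - 1] only. *)
Lemma Rprod_perturb (n j : nat) (f g : nat -> R) (c d : R) :
  (forall i, (1 <= i <= n)%nat ->
     g i = f i * ((if (i =? j)%nat then c else 1) * (if (i =? j - 1)%nat then d else 1))) ->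
  Rprod (seq 1 n) g = Rprod (seq 1 n) f *
    ((if (Nat.leb 1 j && Nat.leb j n)%bool then c else 1) *
     (if (Nat.leb 1 (j - 1) && Nat.leb (j - 1) n)%bool then d else 1)).
Proof.
  intros H. rewrite <- !Rprod_indicator, <- !Rprod_mult.
  apply Rprod_ext. intros i Hi. apply in_seq in Hi. apply H. lia.
Qed.

(** * Complex numbers and q-Pochhammer symbols *)

Definition Copp (z : C) : C := Csub C0 z.

Lemma C_ext (z w : C) : fst z = fst w -> snd z = snd w -> z = w.
Proof. destruct z, w; simpl; intros; subst; reflexivity. Qed.

Lemma C_ring_theory : ring_theory C0 C1 Cadd Cmul Csub Copp (@eq C).
Proof.
  constructor; intros; apply C_ext; unfold Copp, Cadd, Cmul, Csub, C0, C1; simpl; ring.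
Qed.

Add Ring C_ring : C_ring_theory.

Definition Cmod (z : C) : R := Complex.Cmod z.

Lemma Cmod_add (z w : C) : Cmod (Cadd z w) <= Cmod z + Cmod w.
Proof. exact (Complex.Cmod_triangle z w). Qed.

Lemma Cmod_mul (z w : C) : Cmod (Cmul z w) = Cmod z * Cmod w.
Proof. exact (Complex.Cmod_mult z w). Qed.

Lemma Cmod_ge0 (z : C) : 0 <= Cmod z.
Proof. exact (Complex.Cmod_ge_0 z). Qed.

Lemma Cmod_RtoC (x : R) : Cmod (RtoC x) = Rabs x.
Proof. exact (Complex.Cmod_R x). Qed.

Lemma Cmod_sqr (z : C) : Cmod z * Cmod z = fst z * fst z + snd z * snd z.
Proof.
  unfold Cmod, Complex.Cmod. rewrite sqrt_sqrt; [simpl; ring|].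
  assert (H1 := pow2_ge_0 (fst z)). assert (H2 := pow2_ge_0 (snd z)). lra.
Qed.

Lemma Cmod_C0 : Cmod C0 = 0.
Proof. exact Complex.Cmod_0. Qed.

Lemma Cmod_C1 : Cmod C1 = 1.
Proof. exact Complex.Cmod_1. Qed.

Lemma Cmod_sub_sym (z w : C) : Cmod (Csub z w) = Cmod (Csub w z).
Proof.
  assert (Hs : Cmod (Csub z w) * Cmod (Csub z w) = Cmod (Csub w z) * Cmod (Csub w z)).
  { rewrite !Cmod_sqr. unfold Csub; simpl. ring. }
  assert (H1 := Cmod_ge0 (Csub z w)). assert (H2 := Cmod_ge0 (Csub w z)). nra.
Qed.

Lemma Cmod_sub (z w : C) : Cmod (Csub z w) <= Cmod z + Cmod w.
Proof.
  replace (Csub z w) with (Cadd z (Csub C0 w)) by ring.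
  eapply Rle_trans; [apply Cmod_add|]. rewrite Cmod_sub_sym.
  replace (Csub w C0) with w by ring. lra.
Qed.

Lemma Cmod_sub_ge (z w : C) : Cmod z - Cmod w <= Cmod (Csub z w).
Proof.
  assert (H := Cmod_add (Csub z w) w). replace (Cadd (Csub z w) w) with z in H by ring. lra.
Qed.

Lemma fst_le_Cmod (z : C) : Rabs (fst z) <= Cmod z.
Proof.
  apply Rabs_le. assert (H := Cmod_sqr z). assert (H' := Cmod_ge0 z).
  split; nra.
Qed.

Lemma snd_le_Cmod (z : C) : Rabs (snd z) <= Cmod z.
Proof.
  apply Rabs_le. assert (H := Cmod_sqr z). assert (H' := Cmod_ge0 z).
  split; nra.
Qed.

Lemma Cmod_le_abs (z : C) : Cmod z <= Rabs (fst z) + Rabs (snd z).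
Proof.
  assert (H := Cmod_sqr z). assert (H' := Cmod_ge0 z).
  assert (H1 : fst z * fst z = Rabs (fst z) * Rabs (fst z)).
  { rewrite <- Rabs_mult. symmetry. apply Rabs_pos_eq. nra. }
  assert (H2 : snd z * snd z = Rabs (snd z) * Rabs (snd z)).
  { rewrite <- Rabs_mult. symmetry. apply Rabs_pos_eq. nra. }
  assert (H3 := Rabs_pos (fst z)). assert (H4 := Rabs_pos (snd z)). nra.
Qed.

Lemma Cinv_l (z : C) : z <> C0 -> Cmul (Cinv z) z = C1.
Proof.
  intros Hz. destruct z as [x y].
  assert (x * x + y * y <> 0).
  { intros E. apply Hz. unfold C0. assert (x = 0) by nra. assert (y = 0) by nra.
    subst; reflexivity. }
  apply C_ext; unfold Cinv, Cmul, C1; simpl; field; auto.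
Qed.

(** The totalised inverse fixes [C0]; this frees [Cinv_involutive], [Cinv_mul] and [nth_map_Cinv]
    from side conditions. *)
Lemma Cinv_C0 : Cinv C0 = C0.
Proof. apply C_ext; unfold Cinv, C0; simpl; unfold Rdiv; ring. Qed.

Lemma Cinv_unique (z w : C) : Cmul z w = C1 -> w = Cinv z.
Proof.
  intros E. assert (z <> C0).
  { intros ->. apply (f_equal fst) in E. unfold Cmul, C0, C1 in E; simpl in E. lra. }
  replace (Cinv z) with (Cmul (Cinv z) (Cmul z w)) by (rewrite E; ring).
  replace (Cmul (Cinv z) (Cmul z w)) with (Cmul (Cmul (Cinv z) z) w) by ring.
  rewrite Cinv_l by auto. ring.
Qed.

Lemma C1_neq_C0 : C1 <> C0.
Proof. intros E. apply (f_equal fst) in E. unfold C0, C1 in E; simpl in E. lra. Qed.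

Lemma Cinv_neq_C0 (z : C) : z <> C0 -> Cinv z <> C0.
Proof.
  intros Hz E. apply C1_neq_C0. rewrite <- (Cinv_l z Hz), E. ring.
Qed.

Lemma Cinv_involutive (z : C) : Cinv (Cinv z) = z.
Proof.
  destruct (classic (z = C0)) as [->|Hz]; [rewrite !Cinv_C0; reflexivity|].
  symmetry. apply Cinv_unique. apply Cinv_l; auto.
Qed.

Lemma Cinv_mul (z w : C) : Cinv (Cmul z w) = Cmul (Cinv z) (Cinv w).
Proof.
  destruct (classic (z = C0)) as [->|Hz].
  { replace (Cmul C0 w) with C0 by ring. rewrite !Cinv_C0. ring. }
  destruct (classic (w = C0)) as [->|Hw].
  { replace (Cmul z C0) with C0 by ring. rewrite !Cinv_C0. ring. }
  symmetry. apply Cinv_unique.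
  transitivity (Cmul (Cmul (Cinv z) z) (Cmul (Cinv w) w)); [ring|].
  rewrite !Cinv_l by auto. ring.
Qed.

Lemma Cinv_RtoC (x : R) : Cinv (RtoC x) = RtoC (/ x).
Proof.
  destruct (Req_dec x 0) as [->|Hx].
  - rewrite Rinv_0. change (RtoC 0) with C0. apply Cinv_C0.
  - symmetry; apply Cinv_unique. apply C_ext; unfold Cmul, RtoC, C1; simpl; [field; auto | ring].
Qed.

Lemma Cmod_eq0 (z : C) : Cmod z = 0 -> z = C0.
Proof.
  intros H. assert (H1 := fst_le_Cmod z). assert (H2 := snd_le_Cmod z). rewrite H in *.
  apply C_ext; simpl; apply Rabs_eq_0; apply Rle_antisym; auto using Rabs_pos.
Qed.

Lemma Cmod_inv (z : C) : z <> C0 -> Cmod (Cinv z) = / Cmod z.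
Proof.
  intros Hz. assert (H := Cmod_mul (Cinv z) z). rewrite Cinv_l, Cmod_C1 in H by auto.
  assert (Cmod z <> 0) by (intros E; apply Hz, Cmod_eq0; auto).
  field_simplify_eq; lra.
Qed.

Lemma RtoC_mul (x y : R) : RtoC (x * y) = Cmul (RtoC x) (RtoC y).
Proof. apply C_ext; unfold RtoC, Cmul; simpl; ring. Qed.

Lemma RtoC_add (x y : R) : RtoC (x + y) = Cadd (RtoC x) (RtoC y).
Proof. apply C_ext; unfold RtoC, Cadd; simpl; ring. Qed.

Lemma RtoC_sub (x y : R) : RtoC (x - y) = Csub (RtoC x) (RtoC y).
Proof. apply C_ext; unfold RtoC, Csub; simpl; ring. Qed.

Lemma Cprod_ext (l : list nat) (f g : nat -> C) :
  (forall x, In x l -> f x = g x) -> Cprod l f = Cprod l g.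
Proof.
  unfold Cprod. induction l as [|x l IH]; simpl; intros H; [reflexivity|].
  rewrite H by auto. rewrite IH; auto.
Qed.

Lemma Cprod_seq_S (s n : nat) (f : nat -> C) :
  Cprod (seq s (S n)) f = Cmul (Cprod (seq s n) f) (f (s + n)%nat).
Proof.
  rewrite seq_S. unfold Cprod. generalize (seq s n). intros l.
  induction l as [|x l IH]; simpl; [ring | rewrite IH; ring].
Qed.

Lemma Cprod_RtoC (l : list nat) (f : nat -> R) :
  Cprod l (fun k => RtoC (f k)) = RtoC (Rprod l f).
Proof.
  unfold Cprod, Rprod. induction l as [|x l IH]; simpl; [reflexivity|].
  rewrite IH, RtoC_mul. reflexivity.
Qed.

(** [Rlim] is an [epsilon] choice; uniqueness of limits pins it down as soon as one limit is
    known. *)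
Lemma Rlim_eq (u : nat -> R) (l : R) : Un_cv u l -> Rlim u = l.
Proof.
  intros H. unfold Rlim. apply (UL_sequence u); auto.
  apply epsilon_spec. exists l; auto.
Qed.

Definition Cseq_cv (u : nat -> C) (l : C) : Prop :=
  is_lim_seq (fun n => fst (u n)) (fst l) /\ is_lim_seq (fun n => snd (u n)) (snd l).

Lemma Clim_eq (u : nat -> C) (l : C) : Cseq_cv u l -> Clim u = l.
Proof.
  intros [H1 H2]. unfold Clim. apply C_ext; simpl; apply Rlim_eq, is_lim_seq_Reals; assumption.
Qed.

Lemma Cseq_cv_sqr (u : nat -> C) (l : C) : Cseq_cv u l ->
  is_lim_seq (fun n => Cmod (u n) * Cmod (u n)) (Cmod l * Cmod l).
Proof.
  intros [H1 H2]. rewrite Cmod_sqr.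
  apply is_lim_seq_ext with (fun n => fst (u n) * fst (u n) + snd (u n) * snd (u n)).
  { intros n. rewrite Cmod_sqr. reflexivity. }
  apply (is_lim_seq_plus' _ _ (fst l * fst l) (snd l * snd l)).
  - exact (is_lim_seq_mult' _ _ _ _ H1 H1).
  - exact (is_lim_seq_mult' _ _ _ _ H2 H2).
Qed.

Lemma Cseq_cv_le (u : nat -> C) (l : C) (M : R) : 0 <= M -> Cseq_cv u l ->
  (forall n, Cmod (u n) <= M) -> Cmod l <= M.
Proof.
  intros HM Hcv Hb. apply Cseq_cv_sqr in Hcv.
  assert (H : Rbar_le (Cmod l * Cmod l) (M * M)).
  { apply (is_lim_seq_le (fun n => Cmod (u n) * Cmod (u n)) (fun _ => M * M)); auto.
    - intros n. assert (H := Hb n). assert (H' := Cmod_ge0 (u n)). nra.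
    - apply is_lim_seq_const. }
  simpl in H. assert (H' := Cmod_ge0 l). nra.
Qed.

Lemma Cseq_cv_ge (u : nat -> C) (l : C) (M : R) : 0 <= M -> Cseq_cv u l ->
  (forall n, M <= Cmod (u n)) -> M <= Cmod l.
Proof.
  intros HM Hcv Hb. apply Cseq_cv_sqr in Hcv.
  assert (H : Rbar_le (M * M) (Cmod l * Cmod l)).
  { apply (is_lim_seq_le (fun _ => M * M) (fun n => Cmod (u n) * Cmod (u n))); auto.
    - intros n. assert (H := Hb n). assert (H' := Cmod_ge0 (u n)). nra.
    - apply is_lim_seq_const. }
  simpl in H. assert (H' := Cmod_ge0 l). nra.
Qed.

Lemma Cseq_cv_sub (u v : nat -> C) (l m : C) : Cseq_cv u l -> Cseq_cv v m ->
  Cseq_cv (fun n => Csub (u n) (v n)) (Csub l m).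
Proof.
  intros [H1 H2] [H3 H4]. split; simpl; apply is_lim_seq_minus'; assumption.
Qed.

(** The sequence is a constant plus the partial sums of its increments, a series dominated by a
    geometric one. *)
Lemma geometric_steps_cv (q M : R) (u : nat -> R) : 0 < q < 1 ->
  (forall n, Rabs (u (S n) - u n) <= M * q ^ n) -> exists l : R, is_lim_seq u l.
Proof.
  intros Hq H.
  assert (Hs : ex_series (fun n => u (S n) - u n)).
  { apply (@ex_series_le R_AbsRing R_CompleteNormedModule _ (fun n => M * q ^ n)).
    - exact H.
    - apply (ex_series_scal (V := R_NormedModule) M). apply ex_series_geom. rewrite Rabs_pos_eq; lra. }
  destruct Hs as [l Hl]. exists (l + u O).
  apply is_lim_seq_incr_1.
  apply is_lim_seq_ext with (fun n => sum_n (fun n => u (S n) - u n) n + u O).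
  { intros n. induction n as [|n IH].
    - rewrite sum_O. lra.
    - rewrite sum_Sn. unfold plus; simpl. simpl in IH. lra. }
  apply is_lim_seq_plus'; [exact Hl | apply is_lim_seq_const].
Qed.

(** * Convergence, Lipschitz bounds and lower bounds of the infinite product (x;q)_inf *)

Section QPochhammer.
Variable q : R.
Hypothesis Hq : 0 < q < 1.

Definition qpoch_part (n : nat) (x : C) : C :=
  Cprod (seq 0 n) (fun k => Csub C1 (Cmul x (RtoC (q ^ k)))).

Lemma qpoch_part_S (n : nat) (x : C) :
  qpoch_part (S n) x = Cmul (qpoch_part n x) (Csub C1 (Cmul x (RtoC (q ^ n)))).
Proof. unfold qpoch_part. rewrite Cprod_seq_S. reflexivity. Qed.

Lemma qpow_pos (n : nat) : 0 < q ^ n.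
Proof. apply pow_lt; lra. Qed.

Lemma qpow_le1 (n : nat) : q ^ n <= 1.
Proof. rewrite <- (pow1 n). apply pow_incr; lra. Qed.

(** The sum 1 + q + ... + q^(n-1). It is the natural exponent here, since the product of the 1 + B
    q^k with k < n is at most exp (B * qgeom n). *)
Definition qgeom (n : nat) : R := (1 - q ^ n) / (1 - q).

Lemma qgeom_S (n : nat) : qgeom (S n) = qgeom n + q ^ n.
Proof. unfold qgeom; simpl. field. lra. Qed.

Lemma qgeom_le (n : nat) : qgeom n <= / (1 - q).
Proof.
  unfold qgeom, Rdiv. rewrite <- (Rmult_1_l (/ (1 - q))) at 2.
  apply Rmult_le_compat_r; [left; apply Rinv_0_lt_compat; lra|].
  assert (H := qpow_pos n). lra.
Qed.

Lemma qgeom_0 : qgeom 0 = 0.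
Proof. unfold qgeom; simpl. field. lra. Qed.

Lemma exp_ge_1 (x : R) : 1 + x <= exp x.
Proof.
  destruct (Req_dec x 0) as [->|Hx]; [rewrite exp_0; lra|].
  left. apply exp_ineq1; auto.
Qed.

Lemma Cmod_qfactor_le (B : R) (x : C) (n : nat) : Cmod x <= B ->
  Cmod (Csub C1 (Cmul x (RtoC (q ^ n)))) <= 1 + B * q ^ n.
Proof.
  intros Hx. eapply Rle_trans; [apply Cmod_sub|].
  rewrite Cmod_C1, Cmod_mul, Cmod_RtoC, Rabs_pos_eq by (left; apply qpow_pos).
  assert (H := qpow_pos n). nra.
Qed.

Lemma Cmod_qpoch_part_le (B : R) (x : C) (n : nat) : Cmod x <= B ->
  Cmod (qpoch_part n x) <= exp (B * qgeom n).
Proof.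
  intros Hx. induction n as [|n IH].
  - unfold qpoch_part; simpl. rewrite Cmod_C1, qgeom_0, Rmult_0_r, exp_0. lra.
  - rewrite qpoch_part_S, Cmod_mul, qgeom_S, Rmult_plus_distr_l, exp_plus.
    apply Rmult_le_compat; auto using Cmod_ge0.
    eapply Rle_trans; [apply (Cmod_qfactor_le B); auto | apply exp_ge_1].
Qed.

Lemma Cmod_qpoch_part_bound (B : R) (x : C) (n : nat) : Cmod x <= B ->
  Cmod (qpoch_part n x) <= exp (B / (1 - q)).
Proof.
  intros Hx. eapply Rle_trans; [apply (Cmod_qpoch_part_le B); auto|].
  assert (H := qgeom_le n). assert (H' := Cmod_ge0 x).
  assert (H0 : B * qgeom n <= B / (1 - q)) by (apply Rmult_le_compat_l; lra).
  destruct H0 as [H0|H0]; [left; apply exp_increasing; auto | rewrite H0; lra].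
Qed.

Lemma qpoch_part_cv (x : C) : exists l, Cseq_cv (fun n => qpoch_part n x) l.
Proof.
  set (M := exp (Cmod x / (1 - q)) * Cmod x).
  assert (Hd : forall n, Cmod (Csub (qpoch_part (S n) x) (qpoch_part n x)) <= M * q ^ n).
  { intros n. rewrite qpoch_part_S.
    replace (Csub (Cmul (qpoch_part n x) (Csub C1 (Cmul x (RtoC (q ^ n))))) (qpoch_part n x))
      with (Csub C0 (Cmul (qpoch_part n x) (Cmul x (RtoC (q ^ n))))) by ring.
    rewrite Cmod_sub_sym.
    replace (Csub (Cmul (qpoch_part n x) (Cmul x (RtoC (q ^ n)))) C0)
      with (Cmul (qpoch_part n x) (Cmul x (RtoC (q ^ n)))) by ring.
    rewrite !Cmod_mul, Cmod_RtoC, Rabs_pos_eq by (left; apply qpow_pos).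
    unfold M. rewrite Rmult_assoc. apply Rmult_le_compat_r.
    - apply Rmult_le_pos; [apply Cmod_ge0 | left; apply qpow_pos].
    - apply Cmod_qpoch_part_bound; lra. }
  destruct (geometric_steps_cv q M (fun n => fst (qpoch_part n x)) Hq) as [l1 H1].
  { intros n. eapply Rle_trans; [|apply (Hd n)]. apply (fst_le_Cmod (Csub _ _)). }
  destruct (geometric_steps_cv q M (fun n => snd (qpoch_part n x)) Hq) as [l2 H2].
  { intros n. eapply Rle_trans; [|apply (Hd n)]. apply (snd_le_Cmod (Csub _ _)). }
  exists (l1, l2). split; assumption.
Qed.

Lemma qpoch_inf_cv (x : C) : Cseq_cv (fun n => qpoch_part n x) (qpoch_inf q x).
Proof.
  destruct (qpoch_part_cv x) as [l Hl].
  replace (qpoch_inf q x) with l; auto. symmetry. apply Clim_eq, Hl.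
Qed.

Lemma Cmod_qpoch_inf_le (B : R) (x : C) : Cmod x <= B -> Cmod (qpoch_inf q x) <= exp (B / (1 - q)).
Proof.
  intros Hx. apply (Cseq_cv_le (fun n => qpoch_part n x)); auto using qpoch_inf_cv.
  - left; apply exp_pos.
  - intros n. apply Cmod_qpoch_part_bound; auto.
Qed.

(* If [s] bounds the Lipschitz constant of a partial product and [M] its modulus, then [s + M] is at
   most multiplied by [1 + q^n] when a factor is added. *)
Lemma qpoch_part_lipschitz (x y : C) (n : nat) : Cmod x <= 1 -> Cmod y <= 1 ->
  Cmod (Csub (qpoch_part n x) (qpoch_part n y))
  <= exp (/ (1 - q)) * (exp (qgeom n) - 1) * Cmod (Csub x y).
Proof.
  intros Hx Hy. set (M := exp (/ (1 - q))). assert (HM : 0 < M) by apply exp_pos.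
  assert (Hxy := Cmod_ge0 (Csub x y)).
  induction n as [|n IH].
  - unfold qpoch_part; simpl. replace (Csub C1 C1) with C0 by ring.
    rewrite Cmod_C0, qgeom_0, exp_0. lra.
  - rewrite !qpoch_part_S.
    replace (Csub (Cmul (qpoch_part n x) (Csub C1 (Cmul x (RtoC (q ^ n)))))
                  (Cmul (qpoch_part n y) (Csub C1 (Cmul y (RtoC (q ^ n))))))
      with (Csub (Cmul (Csub (qpoch_part n x) (qpoch_part n y)) (Csub C1 (Cmul x (RtoC (q ^ n)))))
                 (Cmul (qpoch_part n y) (Cmul (Csub x y) (RtoC (q ^ n))))) by ring.
    eapply Rle_trans; [apply Cmod_sub|]. rewrite !Cmod_mul, Cmod_RtoC.
    rewrite (Rabs_pos_eq (q ^ n)) by (left; apply qpow_pos).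
    assert (H1 := Cmod_qfactor_le 1 x n Hx).
    assert (H2 := Cmod_qpoch_part_bound 1 y n Hy).
    replace (1 / (1 - q)) with (/ (1 - q)) in H2 by (field; lra). fold M in H2.
    assert (H3 := qpow_pos n).
    rewrite qgeom_S, exp_plus. assert (H4 := exp_ge_1 (q ^ n)). assert (H5 := exp_pos (qgeom n)).
    set (d := Cmod (Csub x y)) in *. set (E := exp (qgeom n)) in *.
    set (p := q ^ n) in *.
    apply Rle_trans with (M * (E - 1) * d * (1 + 1 * p) + M * (d * p)).
    + apply Rplus_le_compat.
      * apply Rmult_le_compat; auto using Cmod_ge0.
      * apply Rmult_le_compat_r; auto. apply Rmult_le_pos; lra.
    + replace (M * (E - 1) * d * (1 + 1 * p) + M * (d * p)) with ((M * d) * (E * (1 + p) - 1)) by ring.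
      replace (M * (E * exp p - 1) * d) with ((M * d) * (E * exp p - 1)) by ring.
      apply Rmult_le_compat_l; [apply Rmult_le_pos; lra|]. nra.
Qed.

Lemma qpoch_inf_lipschitz (x y : C) : Cmod x <= 1 -> Cmod y <= 1 ->
  Cmod (Csub (qpoch_inf q x) (qpoch_inf q y)) <= exp (/ (1 - q)) * exp (/ (1 - q)) * Cmod (Csub x y).
Proof.
  intros Hx Hy.
  apply (Cseq_cv_le (fun n => Csub (qpoch_part n x) (qpoch_part n y))).
  - apply Rmult_le_pos; [|apply Cmod_ge0]. left; apply Rmult_lt_0_compat; apply exp_pos.
  - apply Cseq_cv_sub; apply qpoch_inf_cv.
  - intros n. eapply Rle_trans; [apply qpoch_part_lipschitz; auto|].
    apply Rmult_le_compat_r; [apply Cmod_ge0|].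
    apply Rmult_le_compat_l; [left; apply exp_pos|].
    assert (H := qgeom_le n). destruct H as [H|H]; [apply exp_increasing in H; lra | rewrite H; lra].
Qed.

(** Since 1/(1 - y) = 1 + y/(1 - y) <= 1 + y/(1 - r) <= exp (y/(1 - r)), take reciprocals. This
    bounds each factor of the product from below by an exponential whose exponent is linear in y, so
    that the exponents can be summed. *)
Lemma exp_neg_le (r y : R) : 0 <= y <= r -> r < 1 -> exp (- (y / (1 - r))) <= 1 - y.
Proof.
  intros Hy Hr. rewrite exp_Ropp.
  assert (H := exp_ge_1 (y / (1 - r))).
  assert (H1 : 0 <= y / (1 - r)) by (apply Rdiv_le_0_compat; lra).
  assert (H2 : / (1 - y) <= 1 + y / (1 - r)).
  { apply (Rmult_le_reg_r ((1 - y) * (1 - r))); [nra|]. field_simplify; nra. }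
  rewrite <- (Rinv_inv (1 - y)). apply Rinv_le_contravar; [apply Rinv_0_lt_compat; lra | lra].
Qed.

(** Lower bound for the modulus of (x;q)_inf on the disc of radius r < 1: each factor is at least
    exp (- r q^k / (1 - r)), and the q^k sum to 1/(1 - q). *)
Definition qpoch_lower (r : R) : R := exp (- (r / (1 - r) / (1 - q))).

Lemma qpoch_lower_pos (r : R) : 0 < qpoch_lower r.
Proof. apply exp_pos. Qed.

Lemma Cmod_qpoch_part_ge (r : R) (x : C) (n : nat) : Cmod x <= r -> r < 1 ->
  exp (- (r / (1 - r) * qgeom n)) <= Cmod (qpoch_part n x).
Proof.
  intros Hx Hr. assert (H0 := Cmod_ge0 x). induction n as [|n IH].
  - unfold qpoch_part; simpl. rewrite qgeom_0, Rmult_0_r, Ropp_0, exp_0, Cmod_C1. lra.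
  - rewrite qpoch_part_S, Cmod_mul, qgeom_S, Rmult_plus_distr_l, Ropp_plus_distr, exp_plus.
    apply Rmult_le_compat; auto; try (left; apply exp_pos).
    assert (H1 := qpow_pos n). assert (H2 := qpow_le1 n).
    eapply Rle_trans; [|apply Cmod_sub_ge]. rewrite Cmod_C1, Cmod_mul, Cmod_RtoC, Rabs_pos_eq by lra.
    replace (r / (1 - r) * q ^ n) with (r * q ^ n / (1 - r)) by (field; lra).
    eapply Rle_trans; [apply (exp_neg_le r (r * q ^ n)); auto; nra|]. nra.
Qed.

Lemma Cmod_qpoch_inf_ge (r : R) (x : C) : Cmod x <= r -> r < 1 ->
  qpoch_lower r <= Cmod (qpoch_inf q x).
Proof.
  intros Hx Hr. assert (H0 := Cmod_ge0 x).
  apply (Cseq_cv_ge (fun n => qpoch_part n x)); auto using qpoch_inf_cv.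
  - left; apply qpoch_lower_pos.
  - intros n. eapply Rle_trans; [|apply (Cmod_qpoch_part_ge r); auto].
    unfold qpoch_lower. assert (H := qgeom_le n).
    assert (H1 : 0 <= r / (1 - r)) by (apply Rdiv_le_0_compat; lra).
    assert (H2 : - (r / (1 - r) / (1 - q)) <= - (r / (1 - r) * qgeom n)).
    { apply Ropp_le_contravar. apply Rmult_le_compat_l; auto. }
    destruct H2 as [H2|H2]; [left; apply exp_increasing; auto | rewrite H2; lra].
Qed.

Lemma qpoch_part_RtoC (x : R) (n : nat) :
  qpoch_part n (RtoC x) = RtoC (Rprod (seq 0 n) (fun k => 1 - x * q ^ k)).
Proof.
  unfold qpoch_part. rewrite <- Cprod_RtoC. apply Cprod_ext. intros k _.
  rewrite RtoC_sub, RtoC_mul. reflexivity.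
Qed.

(** The real and the complex symbol are two independent [epsilon] choices; the real one inherits its
    convergence from the real part of the complex one. *)
Lemma qpoch_inf_R_cv (x : R) :
  is_lim_seq (fun n => Rprod (seq 0 n) (fun k => 1 - x * q ^ k)) (qpoch_inf_R q x).
Proof.
  destruct (qpoch_inf_cv (RtoC x)) as [H _].
  assert (H' : is_lim_seq (fun n => Rprod (seq 0 n) (fun k => 1 - x * q ^ k))
                 (fst (qpoch_inf q (RtoC x)))).
  { revert H. apply is_lim_seq_ext. intros n. rewrite qpoch_part_RtoC. reflexivity. }
  replace (qpoch_inf_R q x) with (fst (qpoch_inf q (RtoC x))); auto.
  symmetry. apply Rlim_eq, is_lim_seq_Reals, H'.
Qed.

(** Removing the first factor from the partial products at x leaves the partial products at x q;
    uniqueness of limits carries this over. *)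
Lemma qpoch_inf_R_rec (x : R) : qpoch_inf_R q x = (1 - x) * qpoch_inf_R q (x * q).
Proof.
  assert (H1 := qpoch_inf_R_cv x). apply is_lim_seq_incr_1 in H1.
  assert (H2 := is_lim_seq_scal_l _ (1 - x) _ (qpoch_inf_R_cv (x * q))).
  assert (E : Finite (qpoch_inf_R q x) = Finite ((1 - x) * qpoch_inf_R q (x * q))).
  { rewrite <- (is_lim_seq_unique _ _ H1).
    change (Finite ((1 - x) * qpoch_inf_R q (x * q)))
      with (Rbar_mult (1 - x) (qpoch_inf_R q (x * q))).
    rewrite <- (is_lim_seq_unique _ _ H2). apply Lim_seq_ext. intros n.
    change (seq 0 (S n)) with (0%nat :: seq 1 n). unfold Rprod. rewrite <- seq_shift. simpl.
    f_equal; [ring|]. generalize (seq 0 n). intros l.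
    induction l as [|k l IH]; simpl; [reflexivity | rewrite IH; ring]. }
  injection E; auto.
Qed.

Lemma qpoch_inf_R_pos (x : R) : 0 <= x < 1 -> 0 < qpoch_inf_R q x.
Proof.
  intros Hx. apply Rlt_le_trans with (qpoch_lower x); [apply qpoch_lower_pos|].
  assert (H : Rbar_le (qpoch_lower x) (qpoch_inf_R q x)).
  { apply (is_lim_seq_le (fun _ => qpoch_lower x) (fun n => Rprod (seq 0 n) (fun k => 1 - x * q ^ k))).
    - intros n.
      assert (Hp : 0 <= Rprod (seq 0 n) (fun k => 1 - x * q ^ k)).
      { induction n as [|n IH]; [simpl; lra|]. rewrite Rprod_seq_S.
        apply Rmult_le_pos; auto. assert (H1 := qpow_pos (0 + n)). assert (H2 := qpow_le1 (0 + n)). nra. }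
      rewrite <- (Rabs_pos_eq _ Hp), <- Cmod_RtoC, <- qpoch_part_RtoC.
      eapply Rle_trans; [|apply (Cmod_qpoch_part_ge x); [rewrite Cmod_RtoC, Rabs_pos_eq; lra | lra]].
      unfold qpoch_lower. assert (H := qgeom_le n).
      assert (H1 : 0 <= x / (1 - x)) by (apply Rdiv_le_0_compat; lra).
      assert (H2 : - (x / (1 - x) / (1 - q)) <= - (x / (1 - x) * qgeom n)).
      { apply Ropp_le_contravar. apply Rmult_le_compat_l; auto. }
      destruct H2 as [H2|H2]; [left; apply exp_increasing; auto | rewrite H2; lra].
    - apply is_lim_seq_const.
    - apply qpoch_inf_R_cv. }
  exact H.
Qed.

(** * Integer powers of q and recursions for (q;q)_n *)

Lemma qZ_pos (n : Z) : 0 < powerRZ q n.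
Proof. apply powerRZ_lt; lra. Qed.

Lemma qZ_add (m n : Z) : powerRZ q (m + n) = powerRZ q m * powerRZ q n.
Proof. apply powerRZ_add; lra. Qed.

Lemma qZ_lt1 (n : Z) : (0 < n)%Z -> powerRZ q n < 1.
Proof.
  intros Hn. replace n with (Z.of_nat (Z.to_nat n)) by lia. rewrite <- pow_powerRZ.
  apply pow_lt_1_compat; lra || lia.
Qed.

Lemma qZ_le1 (n : Z) : (0 <= n)%Z -> powerRZ q n <= 1.
Proof.
  intros Hn. destruct (Z.eq_dec n 0) as [->|]; [simpl; lra|]. left; apply qZ_lt1; lia.
Qed.

Lemma qpoch_inf_qZ_pos (n : Z) : (0 < n)%Z -> 0 < qpoch_inf_R q (powerRZ q n).
Proof. intros Hn. apply qpoch_inf_R_pos. split; [left; apply qZ_pos | apply qZ_lt1; auto]. Qed.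

Lemma qpoch_inf_qZ_rec (n : Z) :
  qpoch_inf_R q (powerRZ q n) = (1 - powerRZ q n) * qpoch_inf_R q (powerRZ q (n + 1)).
Proof. rewrite qpoch_inf_R_rec, qZ_add. simpl. rewrite Rmult_1_r. reflexivity. Qed.

Lemma qpoch_fin_eq (n : Z) :
  qpoch_fin q q n = qpoch_inf_R q q / qpoch_inf_R q (powerRZ q (n + 1)).
Proof.
  unfold qpoch_fin. f_equal. f_equal. rewrite Z.add_comm, qZ_add. simpl. ring.
Qed.

Lemma qpoch_fin_pos (n : Z) : (0 <= n)%Z -> 0 < qpoch_fin q q n.
Proof.
  intros Hn. rewrite qpoch_fin_eq. apply Rdiv_lt_0_compat.
  - apply qpoch_inf_R_pos; lra.
  - apply qpoch_inf_qZ_pos; lia.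
Qed.

Lemma qpoch_fin_rec (n : Z) : (0 < n)%Z ->
  qpoch_fin q q n = (1 - powerRZ q n) * qpoch_fin q q (n - 1).
Proof.
  intros Hn. rewrite !qpoch_fin_eq. replace (n - 1 + 1)%Z with n by lia.
  rewrite (qpoch_inf_qZ_rec n).
  assert (H1 := qZ_lt1 n Hn). assert (H2 := qpoch_inf_qZ_pos (n + 1) ltac:(lia)).
  field. lra.
Qed.

Lemma inv_qq_inv (n : Z) : (0 <= n)%Z -> inv_qq q n = / qpoch_fin q q n.
Proof. intros Hn. unfold inv_qq. destruct (Z.ltb_spec n 0); [lia | reflexivity]. Qed.

Lemma inv_qq_neg (n : Z) : (n < 0)%Z -> inv_qq q n = 0.
Proof. intros Hn. unfold inv_qq. destruct (Z.ltb_spec n 0); [reflexivity | lia]. Qed.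

(** Valid for every integer n: the convention 1/(q;q)_n = 0 for n < 0 matches the recursion at n =
    0, where the factor 1 - q^0 vanishes. Boundary cases of interlacing thus need no separate
    treatment. *)
Lemma inv_qq_rec (n : Z) : inv_qq q (n - 1) = (1 - powerRZ q n) * inv_qq q n.
Proof.
  destruct (Z.lt_trichotomy n 0) as [H|[->|H]].
  - rewrite !inv_qq_neg by lia. ring.
  - rewrite inv_qq_neg by lia. simpl. ring.
  - rewrite !inv_qq_inv, (qpoch_fin_rec n) by lia.
    assert (H1 := qpoch_fin_pos (n - 1) ltac:(lia)). assert (H2 := qZ_lt1 n H).
    field. lra.
Qed.

Lemma q_factor_pos (n : Z) : (0 < n)%Z -> 0 < 1 - powerRZ q n.
Proof. intros H. assert (H' := qZ_lt1 n H). lra. Qed.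

Lemma qpoch_fin_down (n : Z) : (0 < n)%Z ->
  qpoch_fin q q (n - 1) = qpoch_fin q q n * / (1 - powerRZ q n).
Proof.
  intros H. rewrite (qpoch_fin_rec n) by auto. assert (H' := q_factor_pos n H). field. lra.
Qed.

Lemma qpoch_fin_up (n : Z) : (0 <= n)%Z ->
  qpoch_fin q q (n + 1) = qpoch_fin q q n * (1 - powerRZ q (n + 1)).
Proof.
  intros H. rewrite (qpoch_fin_rec (n + 1)) by lia.
  replace (n + 1 - 1)%Z with n by lia. ring.
Qed.

Lemma inv_qq_up (n : Z) : (0 <= n)%Z ->
  inv_qq q (n + 1) = inv_qq q n * / (1 - powerRZ q (n + 1)).
Proof.
  intros H. assert (HH1 := inv_qq_rec (n + 1)). replace (n + 1 - 1)%Z with n in HH1 by lia.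
  rewrite HH1. assert (H' := q_factor_pos (n + 1) ltac:(lia)). field. lra.
Qed.

End QPochhammer.

(** * Lowering a string of entries in a pattern *)

(** With [Z.succ] and [e] the end of the block this is convertible to [plus_jk], and with [Z.pred]
    it is the inverse move [low]; one set of lemmas on rows and entries serves both. *)
Definition chg (f : Z -> Z) (j k e : nat) (p : pattern) : pattern :=
  map (fun ar => if (Nat.leb k (fst ar) && Nat.leb (fst ar) e)%bool
                 then upd_nth (j - 1) f (snd ar) else snd ar)
      (combine (range 1 (length p)) p).

Definition low : nat -> nat -> nat -> pattern -> pattern := chg Z.pred.

Lemma length_upd_nth (i : nat) (f : Z -> Z) (l : list Z) : length (upd_nth i f l) = length l.
Proof. revert i; induction l as [|x l IH]; intros [|i]; simpl; auto. Qed.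

Lemma nth_upd_nth (i i' : nat) (f : Z -> Z) (l : list Z) : (i < length l)%nat ->
  nth i' (upd_nth i f l) 0%Z = if (i' =? i)%nat then f (nth i l 0%Z) else nth i' l 0%Z.
Proof.
  revert i i'; induction l as [|x l IH]; intros [|i] [|i'] H; simpl in *; try lia; auto.
  apply IH; lia.
Qed.

Lemma lnth_upd_nth (j i : nat) (f : Z -> Z) (l : list Z) : (1 <= j <= length l)%nat -> (1 <= i)%nat ->
  lnth (upd_nth (j - 1) f l) i = if (i =? j)%nat then f (lnth l j) else lnth l i.
Proof.
  intros H Hi. unfold lnth. rewrite nth_upd_nth by lia.
  destruct (Nat.eqb_spec (i - 1) (j - 1)), (Nat.eqb_spec i j); auto; lia.
Qed.

Lemma sumZ_pred_nth (i : nat) (l : list Z) : (i < length l)%nat ->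
  sumZ (upd_nth i Z.pred l) = (sumZ l - 1)%Z.
Proof.
  revert i; induction l as [|x l IH]; intros [|i] H; simpl in *; try lia.
  rewrite IH; lia.
Qed.

Lemma upd_nth_inv (f g : Z -> Z) (i : nat) (l : list Z) : (forall x, f (g x) = x) ->
  upd_nth i f (upd_nth i g l) = l.
Proof.
  intros H. revert i; induction l as [|x l IH]; intros [|i]; simpl; auto; rewrite ?H, ?IH; auto.
Qed.

Lemma length_chg f j k e p : length (chg f j k e p) = length p.
Proof.
  unfold chg. rewrite length_map, length_combine, range1, length_seq. lia.
Qed.

Lemma row_chg f j k e p m : row (chg f j k e p) m =
  if (Nat.leb k m && Nat.leb m e)%bool then upd_nth (j - 1) f (row p m) else row p m.
Proof.
  destruct m as [|m]; simpl row.
  - destruct (_ && _)%bool; destruct (j - 1)%nat; reflexivity.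
  - destruct (Nat.lt_ge_cases m (length p)) as [H|H].
    + unfold chg. rewrite (nth_indep _ [] (snd (0%nat, ([] : list Z)))).
      2:{ rewrite length_map, length_combine, range1, length_seq. lia. }
      set (g := fun ar : nat * list Z => _).
      replace (snd (0%nat, ([] : list Z))) with (g (0%nat, ([] : list Z))).
      2:{ unfold g; simpl. destruct (_ && _)%bool; destruct (j - 1)%nat; reflexivity. }
      rewrite map_nth, combine_nth by (rewrite range1, length_seq; reflexivity).
      rewrite range1, seq_nth by auto. reflexivity.
    + rewrite !nth_overflow; auto; [|rewrite length_chg; auto].
      destruct (_ && _)%bool; destruct (j - 1)%nat; reflexivity.
Qed.

Lemma length_row_chg f j k e p m : length (row (chg f j k e p) m) = length (row p m).
Proof. rewrite row_chg. destruct (_ && _)%bool; auto using length_upd_nth. Qed.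

Lemma entry_chg f j k e p m i : (1 <= j)%nat -> (1 <= i)%nat ->
  ((k <= m <= e)%nat -> (j <= length (row p m))%nat) ->
  entry (chg f j k e p) m i =
  if (Nat.leb k m && Nat.leb m e && Nat.eqb i j)%bool then f (entry p m j) else entry p m i.
Proof.
  intros Hj Hi Hl. unfold entry. rewrite row_chg.
  destruct (Nat.leb_spec k m), (Nat.leb_spec m e); simpl; auto.
  apply (lnth_upd_nth j i f (row p m)); auto.
Qed.

Lemma pattern_ext (p p' : pattern) : length p = length p' ->
  (forall m, row p (S m) = row p' (S m)) -> p = p'.
Proof. intros H H'. apply (nth_ext p p' [] []); auto. intros m _. apply H'. Qed.

Lemma chg_inv f g j k e p : (forall x, f (g x) = x) -> chg f j k e (chg g j k e p) = p.
Proof.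
  intros H. apply pattern_ext; [rewrite !length_chg; auto|].
  intros m. rewrite !row_chg. destruct (_ && _)%bool; auto using upd_nth_inv.
Qed.

(** Characterises e = k + m_jk by maximality. This determines e, so [blk_end] can be computed
    without unfolding its recursion. *)
Definition block (p : pattern) (N j k e : nat) : Prop :=
  (k <= e <= N)%nat /\ (forall m, (k <= m <= e)%nat -> entry p m j = entry p k j) /\
  ((e < N)%nat -> entry p (S e) j <> entry p k j).

Lemma blk_end_spec (p : pattern) (N j k : nat) : (k <= N)%nat -> block p N j k (blk_end N p j k).
Proof.
  intros Hk. unfold blk_end.
  assert (H : forall fuel cur, (N - cur <= fuel)%nat -> (k <= cur <= N)%nat ->
    (forall m, (k <= m <= cur)%nat -> entry p m j = entry p k j) ->
    block p N j k (blk_ext N j k p fuel cur)).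
  { induction fuel as [|fuel IH]; intros cur Hf Hc He; cbn [blk_ext].
    - repeat split; auto; try lia.
    - destruct (Nat.leb_spec (S cur) N) as [HN|HN]; cbn [andb].
      2:{ repeat split; auto; try lia. }
      destruct (Z.eqb_spec (entry p (S cur) j) (entry p k j)) as [E|E].
      + apply IH; try lia. intros m Hm. destruct (Nat.eq_dec m (S cur)) as [->|]; auto.
        apply He; lia.
      + repeat split; auto; try lia. }
  apply H; try lia. intros m Hm. replace m with k by lia. reflexivity.
Qed.

Lemma block_unique (p : pattern) (N j k e e' : nat) : block p N j k e -> block p N j k e' -> e = e'.
Proof.
  intros [H1 [H2 H3]] [H1' [H2' H3']].
  destruct (Nat.lt_trichotomy e e') as [H|[H|H]]; auto.
  - exfalso. apply H3; [lia|]. apply H2'; lia.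
  - exfalso. apply H3'; [lia|]. apply H2; lia.
Qed.

Section InG.
Variables (N : nat) (p : pattern).
Hypothesis HG : inG N p.

Lemma G_length : length p = N.
Proof. apply HG. Qed.

Lemma G_row_length (n : nat) : (n <= N)%nat -> length (row p n) = n.
Proof. intros H. destruct n; [reflexivity | apply HG; lia]. Qed.

Lemma G_row (n i : nat) : (1 <= n <= N)%nat -> (1 <= i < n)%nat -> (entry p n (S i) <= entry p n i)%Z.
Proof. apply HG. Qed.

Lemma G_below (m l : nat) : (1 <= m < N)%nat -> (1 <= l <= m)%nat ->
  (entry p (S m) (S l) <= entry p m l)%Z.
Proof. intros H1 H2. apply HG; auto. Qed.

Lemma G_above (m l : nat) : (1 <= m < N)%nat -> (1 <= l <= m)%nat ->
  (entry p m l <= entry p (S m) l)%Z.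
Proof. intros H1 H2. apply HG; auto. Qed.

Lemma G_mono (i m m' : nat) : (1 <= i <= m)%nat -> (m <= m')%nat -> (m' <= N)%nat ->
  (entry p m i <= entry p m' i)%Z.
Proof.
  intros H1 H2. induction H2 as [|m' H2 IH]; intros H3; [lia|].
  assert (H4 := G_above m' i). lia.
Qed.

Lemma entry_chg_G f j k e m i : (1 <= j <= k)%nat -> (e <= N)%nat -> (1 <= i)%nat ->
  entry (chg f j k e p) m i =
  if (Nat.leb k m && Nat.leb m e && Nat.eqb i j)%bool then f (entry p m j) else entry p m i.
Proof.
  intros Hj He Hi. apply entry_chg; try lia.
  intros Hm. rewrite G_row_length by lia. lia.
Qed.

End InG.

(* [k] is the lowest level of the constant string [p^(k)_j = ... = p^(e)_j] ending at level [e]. *)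
Definition is_start (p : pattern) (j k e : nat) : Prop :=
  (1 <= j <= k)%nat /\ (k <= e)%nat /\
  (forall m, (k <= m <= e)%nat -> entry p m j = entry p e j) /\
  ((j < k)%nat -> (entry p (k - 1) j < entry p k j)%Z).

Fixpoint kst (p : pattern) (j e : nat) : nat :=
  match e with
  | O => O
  | S m => if (Nat.leb j m && Z.eqb (entry p m j) (entry p (S m) j))%bool
           then kst p j m else S m
  end.

Lemma kst_spec (N : nat) (p : pattern) (j e : nat) : inG N p -> (1 <= j <= e)%nat -> (e <= N)%nat ->
  is_start p j (kst p j e) e.
Proof.
  intros HG Hj He. induction e as [|m IH]; [lia|]. cbn [kst].
  destruct (Nat.leb_spec j m) as [H|H]; cbn [andb].
  - destruct (Z.eqb_spec (entry p m j) (entry p (S m) j)) as [E|E].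
    + destruct IH as [H1 [H2 [H3 H4]]]; try lia. repeat split; try lia; auto.
      intros i Hi. destruct (Nat.eq_dec i (S m)) as [->|]; auto. rewrite H3; auto; lia.
    + repeat split; try lia.
      * intros i Hi. replace i with (S m) by lia. reflexivity.
      * intros _. assert (H1 := G_above N p HG m j). simpl. rewrite Nat.sub_0_r. lia.
  - repeat split; try lia. intros i Hi. replace i with (S m) by lia. reflexivity.
Qed.

Lemma is_start_unique (p : pattern) (j k k' e : nat) :
  is_start p j k e -> is_start p j k' e -> k = k'.
Proof.
  intros [H1 [H2 [H3 H4]]] [H1' [H2' [H3' H4']]].
  destruct (Nat.lt_trichotomy k k') as [H|[H|H]]; auto; exfalso.
  - assert (H5 := H4' ltac:(lia)). rewrite (H3 (k' - 1)%nat), (H3 k') in H5 by lia. lia.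
  - assert (H5 := H4 ltac:(lia)). rewrite (H3' (k - 1)%nat), (H3' k) in H5 by lia. lia.
Qed.

(** Tests whether a string of column j ending at level e has room to move down: the entry bounding
    its last element from below, in row e + 1 or, for e = N, in row N itself, must be strictly
    smaller. For j = e = N there is no such entry. *)
Definition openb (N : nat) (p : pattern) (j e : nat) : bool :=
  if Nat.eqb e N then (Nat.eqb j N || Z.ltb (entry p N (S j)) (entry p N j))%bool
  else Z.ltb (entry p (S e) (S j)) (entry p e j).

(** Only an obstruction by column j - 1 at level k - 1 has to be excluded: the levels above that
    would be violated are exactly those carried along with the string. *)
Lemma plus_jk_inG (N : nat) (p : pattern) (j k : nat) : inG N p -> (1 <= j <= k)%nat -> (k <= N)%nat ->
  ((1 < j)%nat -> (entry p k j < entry p (k - 1) (j - 1))%Z) ->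
  inG N (plus_jk N p j k).
Proof.
  intros HG Hj Hk Hlt. change (plus_jk N p j k) with (chg Z.succ j k (blk_end N p j k) p).
  destruct (blk_end_spec p N j k Hk) as [H1 [H2 H3]].
  set (e := blk_end N p j k) in *.
  (* Along the string column j is constant, while column j - 1 does not decrease with the level, so
     the strict inequality at level k persists. *)
  assert (Hlt' : forall m, (k <= m <= e)%nat -> (1 < j)%nat ->
    (m = k \/ entry p m j < entry p (m - 1) (j - 1))%Z /\ (entry p m j < entry p m (j - 1))%Z).
  { intros m Hm Hj1. rewrite (H2 m) by lia. specialize (Hlt Hj1).
    assert (Ha : (entry p (k - 1) (j - 1) <= entry p m (j - 1))%Z) by (apply (G_mono N p HG); lia).
    split; [|lia]. destruct (Nat.eq_dec m k) as [|Hne]; [left; auto | right].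
    assert (Hb : (entry p (k - 1) (j - 1) <= entry p (m - 1) (j - 1))%Z)
      by (apply (G_mono N p HG); lia). lia. }
  assert (He : (e < N)%nat -> (entry p e j < entry p (S e) j)%Z).
  { intros Hl. assert (Ha := G_above N p HG e j). specialize (H3 Hl). rewrite <- (H2 e) in H3 by lia.
    lia. }
  split; [rewrite length_chg; apply (G_length N p HG)|]. split; [|split].
  - intros n Hn. rewrite length_row_chg. apply (G_row_length N p HG); lia.
  - intros n i Hn Hi. rewrite !(entry_chg_G N p HG) by lia.
    assert (Ha := G_row N p HG n i Hn Hi).
    destruct (Nat.leb_spec k n) as [Hkn|Hkn], (Nat.leb_spec n e) as [Hne|Hne];
    destruct (Nat.eqb_spec (S i) j) as [Ej|Ej], (Nat.eqb_spec i j) as [Ej'|Ej'];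
      subst; simpl; try lia.
    assert (Hb := Hlt' n ltac:(lia) ltac:(lia)). replace (S i - 1)%nat with i in Hb by lia. lia.
  - intros m l Hm Hl. rewrite !(entry_chg_G N p HG) by lia.
    assert (Ha := G_below N p HG m l Hm Hl). assert (Hb := G_above N p HG m l Hm Hl).
    split.
    + destruct (Nat.eqb_spec (S l) j) as [Ej|Ej].
      * destruct (Nat.leb_spec k (S m)) as [Hkn|Hkn], (Nat.leb_spec (S m) e) as [Hne|Hne]; simpl.
        2-4: destruct (_ && _)%bool eqn:EE; subst; try lia;
             (apply andb_prop in EE; destruct EE as [_ EE]; apply Nat.eqb_eq in EE; lia).
        assert (Hc := Hlt' (S m) ltac:(lia) ltac:(lia)).
        replace (S m - 1)%nat with m in Hc by lia. replace (j - 1)%nat with l in Hc by lia.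
        assert (Hd : (entry p (S m) j < entry p m l)%Z).
        { destruct (proj1 Hc) as [Hx|Hx]; [|lia].
          specialize (Hlt ltac:(lia)). replace (k - 1)%nat with m in Hlt by lia.
          replace (j - 1)%nat with l in Hlt by lia. rewrite Hx. lia. }
        destruct (_ && _)%bool eqn:EE; [|subst; lia].
        apply andb_prop in EE; destruct EE as [_ EE]; apply Nat.eqb_eq in EE; lia.
      * rewrite Bool.andb_false_r.
        destruct (_ && _)%bool eqn:EE; [|lia].
        apply andb_prop in EE; destruct EE as [_ EE]; apply Nat.eqb_eq in EE. subst. lia.
    + destruct (Nat.eqb_spec l j) as [->|Ej]; [|rewrite !Bool.andb_false_r; lia].
      rewrite !Bool.andb_true_r.
      destruct (Nat.leb_spec k m) as [Hkn|Hkn], (Nat.leb_spec m e) as [Hne|Hne];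
        destruct (Nat.leb_spec k (S m)) as [Hkn'|Hkn'], (Nat.leb_spec (S m) e) as [Hne'|Hne'];
        simpl; try lia.
      replace m with e in * by lia. specialize (He ltac:(lia)). lia.
Qed.

Section Lowered.
Variables (N : nat) (lam : pattern) (j k e : nat).
Hypothesis HG : inG N lam.
Hypothesis He : (e <= N)%nat.
Hypothesis Hst : is_start lam j k e.
Hypothesis Hop : openb N lam j e = true.

Let Hj : (1 <= j <= k)%nat. Proof. apply Hst. Qed.
Let Hke : (k <= e)%nat. Proof. apply Hst. Qed.

Lemma start_eq (m : nat) : (k <= m <= e)%nat -> entry lam m j = entry lam e j.
Proof. apply Hst. Qed.

Lemma start_lt : (j < k)%nat -> (entry lam (k - 1) j < entry lam k j)%Z.
Proof. apply Hst. Qed.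

Lemma open_below : (e < N)%nat -> (entry lam (S e) (S j) < entry lam e j)%Z.
Proof.
  intros H. unfold openb in Hop. destruct (Nat.eqb_spec e N); [lia|]. apply Z.ltb_lt; auto.
Qed.

(** Column j + 1 does not decrease with the level, so the strict inequality at the last level of the
    string passes down to every level of it. *)
Lemma open_row (m : nat) : (k <= m <= e)%nat -> (j < m)%nat -> (entry lam m (S j) < entry lam m j)%Z.
Proof.
  intros Hm Hjm. rewrite (start_eq m) by auto.
  destruct (Nat.eq_dec e N) as [E|E].
  - assert (H := Hop). unfold openb in H. rewrite (proj2 (Nat.eqb_eq e N) E) in H.
    destruct (Nat.eqb_spec j N); [lia|]. simpl in H. apply Z.ltb_lt in H.
    assert (H1 : (entry lam m (S j) <= entry lam N (S j))%Z) by (apply (G_mono N lam HG); lia).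
    rewrite E. lia.
  - assert (H := open_below ltac:(lia)).
    assert (H1 : (entry lam m (S j) <= entry lam (S e) (S j))%Z) by (apply (G_mono N lam HG); lia).
    lia.
Qed.

Lemma entry_low (m i : nat) : (1 <= i)%nat ->
  entry (low j k e lam) m i =
  if (Nat.leb k m && Nat.leb m e && Nat.eqb i j)%bool then (entry lam m j - 1)%Z else entry lam m i.
Proof. intros Hi. unfold low. rewrite (entry_chg_G N lam HG) by lia. reflexivity. Qed.

Lemma low_inG : inG N (low j k e lam).
Proof.
  assert (H1 := start_lt). assert (H2 := open_below). assert (H3 := open_row).
  split; [unfold low; rewrite length_chg; apply (G_length N lam HG)|]. split; [|split].
  - intros n Hn. unfold low; rewrite length_row_chg. apply (G_row_length N lam HG); lia.
  - intros n i Hn Hi. rewrite !entry_low by lia.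
    assert (Ha := G_row N lam HG n i Hn Hi).
    destruct (Nat.leb_spec k n) as [Hkn|Hkn], (Nat.leb_spec n e) as [Hne|Hne];
    destruct (Nat.eqb_spec (S i) j) as [Ej|Ej], (Nat.eqb_spec i j) as [Ej'|Ej'];
      subst; simpl; try lia.
    specialize (H3 n ltac:(lia) ltac:(lia)). lia.
  - intros m l Hm Hl. rewrite !entry_low by lia.
    assert (Ha := G_below N lam HG m l Hm Hl). assert (Hb := G_above N lam HG m l Hm Hl).
    split.
    + destruct (Nat.eqb_spec l j) as [->|Ej].
      * destruct (Nat.eqb_spec (S j) j); [lia|]. rewrite Bool.andb_false_r, Bool.andb_true_r.
        destruct (Nat.leb_spec k m) as [Hkn|Hkn], (Nat.leb_spec m e) as [Hne|Hne]; simpl; try lia.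
        destruct (Nat.eq_dec m e) as [->|Hme]; [specialize (H2 ltac:(lia)); lia|].
        specialize (H3 (S m) ltac:(lia) ltac:(lia)).
        rewrite (start_eq (S m)) in H3 by lia. rewrite (start_eq m) by lia. lia.
      * rewrite (Bool.andb_false_r (_ && _)).
        destruct (_ && _)%bool eqn:EE; [|lia].
        apply andb_prop in EE; destruct EE as [_ EE]; apply Nat.eqb_eq in EE. subst. lia.
    + destruct (Nat.eqb_spec l j) as [->|Ej]; [|rewrite !Bool.andb_false_r; lia].
      rewrite !Bool.andb_true_r.
      destruct (Nat.leb_spec k m) as [Hkn|Hkn], (Nat.leb_spec m e) as [Hne|Hne];
        destruct (Nat.leb_spec k (S m)) as [Hkn'|Hkn'], (Nat.leb_spec (S m) e) as [Hne'|Hne'];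
        simpl; try lia.
      replace k with (S m) in * by lia. specialize (H1 ltac:(lia)).
      replace (S m - 1)%nat with m in H1 by lia. lia.
Qed.

(** After lowering, level e + 1 lies strictly above the string in column j, so raising at level k
    stops exactly at e and restores [lam]. *)
Lemma low_block : block (low j k e lam) N j k e.
Proof.
  repeat split; try lia.
  - intros m Hm. rewrite !entry_low by lia.
    destruct (Nat.leb_spec k m), (Nat.leb_spec m e), (Nat.leb_spec k k), (Nat.leb_spec k e);
      try lia. rewrite Nat.eqb_refl; simpl. rewrite (start_eq m), (start_eq k) by lia. reflexivity.
  - intros Hl. rewrite !entry_low by lia. rewrite Nat.eqb_refl.
    destruct (Nat.leb_spec k (S e)), (Nat.leb_spec (S e) e), (Nat.leb_spec k k), (Nat.leb_spec k e);
      try lia. simpl. rewrite (start_eq k) by lia.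
    assert (H3 := G_above N lam HG e j). lia.
Qed.

Lemma blk_end_low : blk_end N (low j k e lam) j k = e.
Proof.
  apply (block_unique (low j k e lam) N j k); [apply blk_end_spec; lia | apply low_block].
Qed.

Lemma plus_jk_low : plus_jk N (low j k e lam) j k = lam.
Proof.
  change (chg Z.succ j k (blk_end N (low j k e lam) j k) (low j k e lam) = lam).
  rewrite blk_end_low. apply chg_inv. intros; lia.
Qed.

End Lowered.

(** Predecessors of [lam] are thus parametrised by (j, e). The raised string starts at k because
    level k - 1 kept a value at most the old one, and it is open because the entry bounding it from
    below was already at most the old value. *)
Lemma plus_jk_preimage (N : nat) (mu lam : pattern) (j k : nat) :
  inG N mu -> inG N lam -> (1 <= j <= k)%nat -> (k <= N)%nat -> plus_jk N mu j k = lam ->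
  exists e, (k <= e <= N)%nat /\ is_start lam j k e /\ openb N lam j e = true /\ mu = low j k e lam.
Proof.
  intros Hm Hl Hj Hk E. change (plus_jk N mu j k) with (chg Z.succ j k (blk_end N mu j k) mu) in E.
  destruct (blk_end_spec mu N j k Hk) as [H1 [H2 H3]].
  set (e := blk_end N mu j k) in *. exists e.
  assert (Hent : forall m i, (1 <= i)%nat -> entry lam m i =
    if (Nat.leb k m && Nat.leb m e && Nat.eqb i j)%bool then Z.succ (entry mu m j) else entry mu m i).
  { intros m i Hi. rewrite <- E. apply (entry_chg_G N mu Hm); lia. }
  assert (Hin : forall m, (k <= m <= e)%nat -> entry lam m j = Z.succ (entry mu k j)).
  { intros m Hme. rewrite Hent by lia. rewrite <- (H2 m) by lia.
    destruct (Nat.leb_spec k m), (Nat.leb_spec m e); try lia. rewrite Nat.eqb_refl; reflexivity. }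
  split; [lia|]. split; [|split].
  - split; [lia|]. split; [lia|]. split.
    + intros m Hme. rewrite !Hin by lia. reflexivity.
    + intros Hjk. rewrite (Hin k) by lia. rewrite Hent by lia.
      destruct (Nat.leb_spec k (k - 1)); [lia|]. simpl.
      assert (Ha := G_above N mu Hm (k - 1) j ltac:(lia) ltac:(lia)).
      replace (S (k - 1)) with k in Ha by lia. lia.
  - unfold openb. destruct (Nat.eqb_spec e N) as [EN|EN].
    + destruct (Nat.eqb_spec j N) as [|HjN]; [reflexivity|]. simpl. apply Z.ltb_lt.
      rewrite (Hin N) by lia. rewrite Hent by lia.
      destruct (Nat.eqb_spec (S j) j); [lia|]. rewrite Bool.andb_false_r.
      assert (Ha := G_row N mu Hm N j ltac:(lia) ltac:(lia)). rewrite (H2 N) in Ha by lia. lia.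
    + apply Z.ltb_lt. rewrite (Hin e) by lia. rewrite Hent by lia.
      destruct (Nat.eqb_spec (S j) j); [lia|]. rewrite Bool.andb_false_r.
      assert (Ha := G_below N mu Hm e j ltac:(lia) ltac:(lia)). rewrite (H2 e) in Ha by lia. lia.
  - rewrite <- E. symmetry. apply chg_inv. intros; lia.
Qed.

(** * Weight change along a string *)

Definition skew_weight (q : R) (lam mu : list Z) : R :=
  Rprod (range 1 (length lam - 1))
    (fun i => qpoch_fin q q (lnth lam i - lnth lam (S i))%Z
              * inv_qq q (lnth lam i - lnth mu i)%Z * inv_qq q (lnth mu i - lnth lam (S i))%Z).

Definition level_weight (q : R) (a : list R) (p : pattern) (m : nat) : R :=
  powerRZ (nth (m - 1) a 0) (sumZ (row p m) - sumZ (row p (m - 1)))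
  * skew_weight q (row p m) (row p (m - 1)).

Definition pattern_weight (q : R) (N : nat) (a : list R) (p : pattern) : R :=
  Rprod (range 1 N) (level_weight q a p).

Definition entry_factor (q : R) (p : pattern) (m i : nat) : R :=
  qpoch_fin q q (entry p m i - entry p m (S i))
  * inv_qq q (entry p m i - entry p (m - 1) i) * inv_qq q (entry p (m - 1) i - entry p m (S i)).

Lemma skew_weight_entry (q : R) (p : pattern) (m : nat) : length (row p m) = m ->
  skew_weight q (row p m) (row p (m - 1)) = Rprod (seq 1 (m - 1)) (entry_factor q p m).
Proof. intros H. unfold skew_weight. rewrite H, range1. reflexivity. Qed.

Section Ratio.
Variables (q : R) (N : nat) (a : list R) (lam : pattern) (j k e : nat).
Hypothesis Hq : 0 < q < 1.
Hypothesis Ha : forall i, (1 <= i <= N)%nat -> 0 < nth (i - 1) a 0.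
Hypothesis HG : inG N lam.
Hypothesis He : (e <= N)%nat.
Hypothesis Hst : is_start lam j k e.
Hypothesis Hop : openb N lam j e = true.

Let mu := low j k e lam.
Let Hj : (1 <= j <= k)%nat. Proof. apply Hst. Qed.
Let Hke : (k <= e)%nat. Proof. apply Hst. Qed.

(* [phi m] accumulates the weight change of the levels [k, ..., m], up to the jump rate. *)
Definition phi (m : nat) : R :=
  if Nat.eqb j 1 then 1 else 1 - powerRZ q (entry lam m (j - 1) - entry lam m j + 1).

(** Weight ratio of lowering x_j under a fixed row y, where x and y are the rows of levels e and e +
    1, without the factor a_{e+1}. *)
Definition cut : R :=
  (1 - powerRZ q (entry lam e j - entry lam (S e) (S j)))
  / (1 - powerRZ q (entry lam (S e) j - entry lam e j + 1)).

(** Ratio of the level weights of [mu] and [lam], written as a quotient of consecutive values of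
    [phi] whose initial denominator is the jump rate. The product over the levels then
    telescopes. *)
Definition stepratio (m : nat) : R :=
  if Nat.ltb m k then 1
  else if Nat.eqb m k then phi k / rate q a mu j k
  else if Nat.leb m e then phi m / phi (m - 1)
  else if Nat.eqb m (S e) then nth e a 0 * cut
  else 1.

Lemma entry_mu (m i : nat) : (1 <= i)%nat ->
  entry mu m i =
  if (Nat.leb k m && Nat.leb m e && Nat.eqb i j)%bool then (entry lam m j - 1)%Z else entry lam m i.
Proof. intros Hi. apply (entry_low N lam j k e HG He Hst). auto. Qed.

Lemma phi_pos (m : nat) : (j <= m)%nat -> (1 <= m <= N)%nat -> 0 < phi m.
Proof.
  intros H1 H2. unfold phi. destruct (Nat.eqb_spec j 1); [lra|].
  apply (q_factor_pos q Hq). assert (H3 := G_row N lam HG m (j - 1)).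
  replace (S (j - 1)) with j in H3 by lia. lia.
Qed.

Lemma rate_mu : rate q a mu j k = nth (k - 1) a 0
  * (if Nat.eqb j 1 then 1 else 1 - powerRZ q (entry lam (k - 1) (j - 1) - entry lam k j + 1))
  * (if Nat.eqb j k then 1 else (1 - powerRZ q (entry lam k j - entry lam k (S j)))
                              / (1 - powerRZ q (entry lam k j - entry lam (k - 1) j))).
Proof.
  unfold rate. unfold Rdiv. rewrite !Rmult_assoc. f_equal. f_equal.
  - destruct (Nat.eqb_spec j 1); [reflexivity|]. rewrite !entry_mu by lia.
    destruct (Nat.leb_spec k (k - 1)), (Nat.leb_spec k k), (Nat.leb_spec k e); try lia.
    rewrite Nat.eqb_refl. simpl. do 2 f_equal. lia.
  - destruct (Nat.eqb_spec j k); [rewrite Rinv_1; lra|]. rewrite !entry_mu by lia.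
    destruct (Nat.leb_spec k (k - 1)), (Nat.leb_spec k k), (Nat.leb_spec k e); try lia.
    rewrite Nat.eqb_refl. destruct (Nat.eqb_spec (S j) j); [lia|]. simpl.
    f_equal; [|f_equal]; do 2 f_equal; lia.
Qed.

(** Legitimates the division by the rate in [stepratio]. Lowering itself created the gap that the
    jump back needs. *)
Lemma rate_mu_pos : 0 < rate q a mu j k.
Proof.
  rewrite rate_mu. apply Rmult_lt_0_compat; [apply Rmult_lt_0_compat|].
  - apply Ha; lia.
  - destruct (Nat.eqb_spec j 1); [lra|]. apply (q_factor_pos q Hq).
    assert (H := G_below N lam HG (k - 1) (j - 1) ltac:(lia) ltac:(lia)).
    replace (S (k - 1)) with k in H by lia. replace (S (j - 1)) with j in H by lia. lia.
  - destruct (Nat.eqb_spec j k); [lra|]. apply Rdiv_lt_0_compat; apply (q_factor_pos q Hq).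
    + assert (H := open_row N lam j k e HG He Hst Hop k ltac:(lia) ltac:(lia)). lia.
    + assert (H := start_lt lam j k e Hst ltac:(lia)). lia.
Qed.

Lemma sumZ_low_row (m : nat) : (m <= N)%nat ->
  sumZ (row mu m) = if (Nat.leb k m && Nat.leb m e)%bool then (sumZ (row lam m) - 1)%Z
                    else sumZ (row lam m).
Proof.
  intros Hm. unfold mu, low. rewrite row_chg.
  destruct (Nat.leb_spec k m), (Nat.leb_spec m e); simpl; auto.
  apply sumZ_pred_nth. rewrite (G_row_length N lam HG) by lia. lia.
Qed.

(** Change of the branching factor with index j. At level k only the upper row moves, at level e + 1
    only the lower row, and in between both rows move together and nothing changes. *)
Definition ratio_here (m : nat) : R :=
  if Nat.ltb m k then 1
  else if Nat.eqb m k then (1 - powerRZ q (entry lam k j - entry lam (k - 1) j))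
                         / (1 - powerRZ q (entry lam k j - entry lam k (S j)))
  else if Nat.leb m e then 1
  else if Nat.eqb m (S e) then cut else 1.

(** Change of the branching factor with index j - 1, which sees column j only through the upper
    row. *)
Definition ratio_left (m : nat) : R :=
  if (Nat.leb k m && Nat.leb m e)%bool
  then (1 - powerRZ q (entry lam m (j - 1) - entry lam m j + 1))
       / (1 - powerRZ q (entry lam (m - 1) (j - 1) - entry lam m j + 1))
  else 1.

Lemma entry_factor_low (m i : nat) : (1 <= m <= N)%nat -> (1 <= i <= m - 1)%nat ->
  entry_factor q mu m i = entry_factor q lam m i *
    ((if Nat.eqb i j then ratio_here m else 1) * (if Nat.eqb i (j - 1) then ratio_left m else 1)).
Proof.
  intros Hm Hi. unfold entry_factor. rewrite !entry_mu by lia.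
  assert (Hb := G_below N lam HG (m - 1) i ltac:(lia) ltac:(lia)).
  assert (Hc := G_above N lam HG (m - 1) i ltac:(lia) ltac:(lia)).
  replace (S (m - 1)) with m in * by lia.
  destruct (Nat.eqb_spec i j) as [Eij|Eij].
  - subst i. destruct (Nat.eqb_spec (S j) j); [lia|]. destruct (Nat.eqb_spec j (j - 1)); [lia|].
    rewrite !Bool.andb_false_r, !Bool.andb_true_r. unfold ratio_here.
    destruct (Nat.ltb_spec m k) as [L|L].
    { destruct (Nat.leb_spec k m), (Nat.leb_spec k (m - 1)); try lia. simpl. ring. }
    destruct (Nat.eqb_spec m k) as [->|Emk].
    { destruct (Nat.leb_spec k k), (Nat.leb_spec k (k - 1)), (Nat.leb_spec k e); try lia. simpl.
      assert (HH1 := start_lt lam j k e Hst ltac:(lia)).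
      assert (HH2 := open_row N lam j k e HG He Hst Hop k ltac:(lia) ltac:(lia)).
      replace (entry lam k j - 1 - entry lam k (S j))%Z with (entry lam k j - entry lam k (S j) - 1)%Z by lia.
      replace (entry lam k j - 1 - entry lam (k - 1) j)%Z
        with (entry lam k j - entry lam (k - 1) j - 1)%Z by lia.
      rewrite (qpoch_fin_down q Hq), inv_qq_rec by (auto; lia). unfold Rdiv. ring. }
    destruct (Nat.leb_spec m e) as [Lme|Lme].
    { destruct (Nat.leb_spec k m), (Nat.leb_spec k (m - 1)), (Nat.leb_spec (m - 1) e); try lia. simpl.
      assert (HH2 := open_row N lam j k e HG He Hst Hop m ltac:(lia) ltac:(lia)).
      (* Column j has the same value in both rows, so the q-factorial of the gap y_j - y_{j+1}
         cancels against the reciprocal one of x_j - y_{j+1}, before and after lowering. *)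
      rewrite (start_eq lam j k e Hst (m - 1)), (start_eq lam j k e Hst m) in * by lia.
      replace (entry lam e j - 1 - (entry lam e j - 1))%Z with (entry lam e j - entry lam e j)%Z by lia.
      rewrite !(inv_qq_inv q (_ - entry lam m (S j))) by lia.
      assert (P1 := qpoch_fin_pos q Hq (entry lam e j - 1 - entry lam m (S j)) ltac:(lia)).
      assert (P2 := qpoch_fin_pos q Hq (entry lam e j - entry lam m (S j)) ltac:(lia)).
      field. lra. }
    destruct (Nat.eqb_spec m (S e)) as [->|Eme].
    { replace (S e - 1)%nat with e in * by lia.
      destruct (Nat.leb_spec k e), (Nat.leb_spec e e); try lia.
      destruct (Nat.leb_spec k (S e)); simpl; try lia. unfold cut.
      replace (entry lam (S e) j - (entry lam e j - 1))%Z
        with (entry lam (S e) j - entry lam e j + 1)%Z by lia.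
      replace (entry lam e j - 1 - entry lam (S e) (S j))%Z
        with (entry lam e j - entry lam (S e) (S j) - 1)%Z by lia.
      rewrite (inv_qq_up q Hq), inv_qq_rec by (auto; lia). unfold Rdiv. ring. }
    destruct (Nat.leb_spec (m - 1) e); try lia. rewrite !Bool.andb_false_r. ring.
  - rewrite !(Bool.andb_false_r (_ && _)).
    destruct (Nat.eqb_spec i (j - 1)) as [Ei|Ei].
    + destruct (Nat.eqb_spec (S i) j); [|lia]. rewrite Bool.andb_true_r. unfold ratio_left.
      rewrite <- Ei. replace (S i) with j in * by lia.
      destruct (Nat.leb_spec k m), (Nat.leb_spec m e); simpl; try ring.
      replace (entry lam m i - (entry lam m j - 1))%Z with (entry lam m i - entry lam m j + 1)%Z by lia.
      replace (entry lam (m - 1) i - (entry lam m j - 1))%Z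
        with (entry lam (m - 1) i - entry lam m j + 1)%Z by lia.
      rewrite (inv_qq_up q Hq), (qpoch_fin_up q Hq) by lia. unfold Rdiv. ring.
    + destruct (Nat.eqb_spec (S i) j); [lia|]. rewrite (Bool.andb_false_r (_ && _)). ring.
Qed.

Lemma skew_weight_low (m : nat) : (1 <= m <= N)%nat ->
  skew_weight q (row mu m) (row mu (m - 1)) = skew_weight q (row lam m) (row lam (m - 1)) *
    ((if Nat.leb j (m - 1) then ratio_here m else 1) *
     (if (Nat.leb 2 j && Nat.leb j m)%bool then ratio_left m else 1)).
Proof.
  intros Hm. rewrite !skew_weight_entry.
  2:{ apply (G_row_length N lam HG). lia. }
  2:{ unfold mu, low. rewrite length_row_chg. apply (G_row_length N lam HG). lia. }
  rewrite (Rprod_perturb (m - 1) j (entry_factor q lam m) (entry_factor q mu m)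
             (ratio_here m) (ratio_left m)).
  - f_equal. f_equal.
    + destruct (Nat.leb_spec 1 j); [reflexivity | lia].
    + destruct (Nat.leb_spec 1 (j - 1)), (Nat.leb_spec (j - 1) (m - 1)), (Nat.leb_spec 2 j),
        (Nat.leb_spec j m); try lia; reflexivity.
  - intros i Hi. apply entry_factor_low; lia.
Qed.

Lemma level_weight_low (m : nat) : (1 <= m <= N)%nat ->
  level_weight q a mu m = level_weight q a lam m * stepratio m.
Proof.
  intros Hm. unfold level_weight. rewrite skew_weight_low, !sumZ_low_row by lia.
  set (x := nth (m - 1) a 0). assert (Hx : 0 < x) by (apply Ha; lia).
  set (s := sumZ (row lam m)). set (s' := sumZ (row lam (m - 1))).
  set (w := skew_weight _ _ _). unfold stepratio, ratio_here.
  destruct (Nat.ltb_spec m k) as [L|L].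
  { unfold ratio_left. destruct (Nat.leb_spec k m), (Nat.leb_spec k (m - 1)); try lia.
    simpl. destruct (Nat.leb j (m - 1)), (match j with O => false | _ => _ end && Nat.leb j m)%bool; ring. }
  destruct (Nat.eqb_spec m k) as [->|Emk].
  { destruct (Nat.leb_spec k k), (Nat.leb_spec k e), (Nat.leb_spec k (k - 1)),
      (Nat.leb_spec j k); try lia.
    rewrite Bool.andb_true_r. cbn [andb].
    (* Only the upper row drops at level k; the resulting factor 1/a_k is the reciprocal of the a_k
       in the rate. *)
    replace (s - 1 - s')%Z with (s - s' + -1)%Z by lia. rewrite powerRZ_add by lra. simpl (powerRZ x (-1)).
    assert (Hr := rate_mu_pos). rewrite rate_mu in Hr |- *. unfold ratio_left, phi. fold x in Hr |- *.
    destruct (Nat.leb_spec k k), (Nat.leb_spec k e); try lia. cbn [andb].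
    assert (HD : (j < k)%nat -> 0 < 1 - powerRZ q (entry lam k j - entry lam (k - 1) j) /\
                 0 < 1 - powerRZ q (entry lam k j - entry lam k (S j))).
    { intros Hjk. split; apply (q_factor_pos q Hq).
      - assert (H9 := start_lt lam j k e Hst ltac:(lia)). lia.
      - assert (H9 := open_row N lam j k e HG He Hst Hop k ltac:(lia) ltac:(lia)). lia. }
    assert (HC : (2 <= j)%nat ->
       0 < 1 - powerRZ q (entry lam (k - 1) (j - 1) - entry lam k j + 1)).
    { intros Hj2. apply (q_factor_pos q Hq).
      assert (H9 := G_below N lam HG (k - 1) (j - 1) ltac:(lia) ltac:(lia)).
      replace (S (k - 1)) with k in H9 by lia. replace (S (j - 1)) with j in H9 by lia. lia. }
    rewrite Rmult_1_r.
    destruct (Nat.leb_spec 2 j) as [J2|J2]; destruct (Nat.eqb_spec j 1) as [J1|J1]; try lia;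
      destruct (Nat.leb_spec j (k - 1)) as [Jk|Jk]; destruct (Nat.eqb_spec j k) as [Jk'|Jk']; try lia;
      cbn [andb].
    - specialize (HC J2). destruct (HD ltac:(lia)). field. lra.
    - specialize (HC J2). field. lra.
    - destruct (HD ltac:(lia)). field. lra.
    - field. lra. }
  destruct (Nat.leb_spec m e) as [Lme|Lme].
  { unfold ratio_left, phi.
    destruct (Nat.leb_spec k m), (Nat.leb_spec k (m - 1)), (Nat.leb_spec (m - 1) e),
      (Nat.leb_spec m e), (Nat.leb_spec j m), (Nat.leb_spec j (m - 1)); try lia.
    cbn [andb]. rewrite Bool.andb_true_r.
    replace (s - 1 - (s' - 1))%Z with (s - s')%Z by lia.
    destruct (Nat.leb_spec 2 j), (Nat.eqb_spec j 1); try lia.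
    (* Constancy of column j turns the denominator of [ratio_left m] into [phi (m - 1)]. *)
    - rewrite (start_eq lam j k e Hst (m - 1)), (start_eq lam j k e Hst m) by lia. ring.
    - field. }
  destruct (Nat.eqb_spec m (S e)) as [->|Eme].
  { unfold ratio_left.
    destruct (Nat.leb_spec k (S e)), (Nat.leb_spec (S e) e), (Nat.leb_spec k (S e - 1)),
      (Nat.leb_spec (S e - 1) e), (Nat.leb_spec j (S e - 1)); try lia.
    cbn [andb]. unfold x in *. replace (S e - 1)%nat with e in * by lia. fold x in Hx |- *.
    (* Only the lower row drops at level e + 1, which contributes a_{e+1}; lists count from 0, so
       this is [nth e a 0]. *)
    replace (s - (s' - 1))%Z with (s - s' + 1)%Z by lia. rewrite powerRZ_add by lra.
    change (powerRZ (nth e a 0) 1) with (nth e a 0 * 1).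
    destruct (Nat.leb 2 j && Nat.leb j (S e))%bool; ring. }
  unfold ratio_left.
  destruct (Nat.leb_spec m e), (Nat.leb_spec (m - 1) e); try lia. rewrite !Bool.andb_false_r.
  destruct (Nat.leb j (m - 1)), (Nat.leb 2 j && Nat.leb j m)%bool; ring.
Qed.

Lemma Rprod_stepratio (n : nat) : (n <= N)%nat -> Rprod (seq 1 n) stepratio =
  if Nat.ltb n k then 1
  else if Nat.leb n e then phi n / rate q a mu j k
  else phi e / rate q a mu j k * (nth e a 0 * cut).
Proof.
  assert (Hr := rate_mu_pos).
  induction n as [|n IH]; intros Hn.
  - destruct (Nat.ltb_spec 0 k); [reflexivity | lia].
  - rewrite Rprod_seq_S, IH by lia. change (1 + n)%nat with (S n). unfold stepratio.
    destruct (Nat.ltb_spec n k), (Nat.ltb_spec (S n) k); try lia; [ring| |].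
    + destruct (Nat.eqb_spec (S n) k) as [Ek|]; try lia.
      destruct (Nat.leb_spec (S n) e); try lia. rewrite Ek. ring.
    + destruct (Nat.eqb_spec (S n) k); try lia.
      destruct (Nat.leb_spec (S n) e), (Nat.leb_spec n e); try lia.
      * assert (Hp := phi_pos n ltac:(lia) ltac:(lia)).
        replace (S n - 1)%nat with n by lia. field. lra.
      * replace n with e in * by lia. destruct (Nat.eqb_spec (S e) (S e)); try lia. reflexivity.
      * destruct (Nat.eqb_spec (S n) (S e)); try lia. ring.
Qed.

Lemma pattern_weight_low :
  pattern_weight q N a mu * rate q a mu j k
  = pattern_weight q N a lam * phi e * (if Nat.eqb e N then 1 else nth e a 0 * cut).
Proof.
  assert (Hr := rate_mu_pos). unfold pattern_weight. rewrite range1.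
  rewrite (Rprod_ext _ _ (fun m => level_weight q a lam m * stepratio m)).
  2:{ intros m Hm. apply in_seq in Hm. apply level_weight_low; lia. }
  rewrite Rprod_mult, Rprod_stepratio by lia.
  destruct (Nat.ltb_spec N k), (Nat.leb_spec N e), (Nat.eqb_spec e N); try lia.
  - replace N with e by lia. field. lra.
  - field. lra.
Qed.

End Ratio.

(** * The generator and the balance of flows *)

Definition decb (P : Prop) : bool := if excluded_middle_informative P then true else false.

Lemma decb_true (P : Prop) : decb P = true <-> P.
Proof. unfold decb. destruct (excluded_middle_informative P); split; auto; discriminate. Qed.

Definition pattern_eq_dec : forall p p' : pattern, {p = p'} + {p <> p'} :=
  list_eq_dec (list_eq_dec Z.eq_dec).

Lemma Kdelta_eq (p : pattern) : Kdelta p p = 1.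
Proof. unfold Kdelta. destruct (list_eq_dec _ p p); [reflexivity | congruence]. Qed.

Lemma Kdelta_neq (p p' : pattern) : p <> p' -> Kdelta p p' = 0.
Proof. unfold Kdelta. destruct (list_eq_dec _ p p'); [congruence | reflexivity]. Qed.

Lemma Lgen_nonzero (q : R) (N : nat) (a : list R) (mu lam : pattern) : Lgen q N a mu lam <> 0 ->
  lam = mu \/ exists k j, (1 <= j <= k)%nat /\ (k <= N)%nat /\ lam = plus_jk N mu j k
                          /\ rate q a mu j k <> 0.
Proof.
  intros H. apply Rsum_nonzero in H. destruct H as [k [Hk H]].
  apply Rsum_nonzero in H. destruct H as [j [Hj H]]. rewrite range1 in Hk, Hj.
  apply in_seq in Hk. apply in_seq in Hj.
  destruct (pattern_eq_dec lam mu) as [E|E]; auto. right.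
  destruct (pattern_eq_dec lam (plus_jk N mu j k)) as [E'|E'].
  - exists k, j. repeat split; auto; try lia. intros E0. apply H. rewrite E0. lra.
  - exfalso. apply H. rewrite !Kdelta_neq by auto. lra.
Qed.

Definition G_list (N : nat) (l : list pattern) : list pattern :=
  nodup pattern_eq_dec (filter (fun p => decb (inG N p)) l).

Lemma G_list_NoDup N l : NoDup (G_list N l).
Proof. apply NoDup_nodup. Qed.

Lemma G_list_In N l p : In p (G_list N l) <-> In p l /\ inG N p.
Proof. unfold G_list. rewrite nodup_In, filter_In, decb_true. tauto. Qed.

Lemma G_list_Forall N l : Forall (inG N) (G_list N l).
Proof. apply Forall_forall. intros p Hp. apply G_list_In in Hp. apply Hp. Qed.

Definition level_pairs (N : nat) : list (nat * nat) := list_prod (seq 1 N) (seq 1 N).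

Lemma in_level_pairs N k j : In (k, j) (level_pairs N) <-> (1 <= k <= N)%nat /\ (1 <= j <= N)%nat.
Proof. unfold level_pairs. rewrite in_prod_iff, !in_seq. lia. Qed.

Definition sources (N : nat) (lam : pattern) : list pattern :=
  G_list N (lam :: map (fun ej => low (snd ej) (kst lam (snd ej) (fst ej)) (fst ej) lam) (level_pairs N)).

Definition targets (N : nat) (mu : pattern) : list pattern :=
  G_list N (mu :: map (fun kj => plus_jk N mu (snd kj) (fst kj)) (level_pairs N)).

Lemma sources_complete (q : R) (N : nat) (a : list R) (mu lam : pattern) : inG N lam -> inG N mu ->
  Lgen q N a mu lam <> 0 -> In mu (sources N lam).
Proof.
  intros Hl Hm H. apply G_list_In. split; auto. apply Lgen_nonzero in H.
  destruct H as [->|[k [j [Hj [Hk [E _]]]]]]; [left; auto | right].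
  destruct (plus_jk_preimage N mu lam j k Hm Hl Hj Hk (eq_sym E)) as [e [He [Hs [Ho Em]]]].
  apply in_map_iff. exists (e, j). split; [|apply in_level_pairs; lia]. simpl.
  rewrite (is_start_unique lam j (kst lam j e) k e); auto.
  apply (kst_spec N); auto; lia.
Qed.

Lemma targets_complete (q : R) (N : nat) (a : list R) (mu lam : pattern) : inG N lam ->
  Lgen q N a mu lam <> 0 -> In lam (targets N mu).
Proof.
  intros Hl H. apply G_list_In. split; auto. apply Lgen_nonzero in H.
  destruct H as [->|[k [j [Hj [Hk [E _]]]]]]; [left; auto | right].
  apply in_map_iff. exists (k, j). split; [|apply in_level_pairs; lia]. simpl. auto.
Qed.

Lemma rate_nonneg (q : R) (N : nat) (a : list R) (mu : pattern) (j k : nat) : 0 < q < 1 ->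
  (forall i, (1 <= i <= N)%nat -> 0 < nth (i - 1) a 0) -> inG N mu ->
  (1 <= j <= k)%nat -> (k <= N)%nat -> 0 <= rate q a mu j k.
Proof.
  intros Hq Ha HG Hj Hk. unfold rate.
  assert (H0 : 0 < nth (k - 1) a 0) by (apply Ha; lia).
  apply Rmult_le_pos; [apply Rmult_le_pos; [apply Rmult_le_pos|]|].
  - lra.
  - destruct (Nat.eqb_spec j 1); [lra|].
    assert (H := G_below N mu HG (k - 1) (j - 1) ltac:(lia) ltac:(lia)).
    replace (S (k - 1)) with k in H by lia. replace (S (j - 1)) with j in H by lia.
    assert (H' := qZ_le1 q Hq (entry mu (k - 1) (j - 1) - entry mu k j) ltac:(lia)). lra.
  - destruct (Nat.eqb_spec j k); [lra|]. assert (H := G_row N mu HG k j ltac:(lia) ltac:(lia)).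
    left; apply q_factor_pos; auto; lia.
  - left; apply Rinv_0_lt_compat.
    destruct (Nat.eqb_spec j k); [lra|]. apply q_factor_pos; auto.
    assert (H := G_above N mu HG (k - 1) j ltac:(lia) ltac:(lia)).
    replace (S (k - 1)) with k in H by lia. lia.
Qed.

(** A jump blocked by column j - 1 at level k - 1 has rate 0 through the factor 1 - q^0. *)
Lemma rate_nonzero_inG (q : R) (N : nat) (a : list R) (mu : pattern) (j k : nat) :
  inG N mu -> (1 <= j <= k)%nat -> (k <= N)%nat -> rate q a mu j k <> 0 ->
  inG N (plus_jk N mu j k).
Proof.
  intros HG Hj Hk Hr. apply plus_jk_inG; auto. intros Hj1.
  assert (H := G_below N mu HG (k - 1) (j - 1) ltac:(lia) ltac:(lia)).
  replace (S (k - 1)) with k in H by lia. replace (S (j - 1)) with j in H by lia.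
  destruct (Z.eq_dec (entry mu k j) (entry mu (k - 1) (j - 1))) as [E|E]; [|lia].
  exfalso. apply Hr. unfold rate. rewrite E, Z.sub_diag.
  destruct (Nat.eqb_spec j 1); [lia|]. simpl (powerRZ q 0). unfold Rdiv. ring.
Qed.

Lemma Lgen_offdiag_nonneg (q : R) (N : nat) (a : list R) (mu lam : pattern) : 0 < q < 1 ->
  (forall i, (1 <= i <= N)%nat -> 0 < nth (i - 1) a 0) -> inG N mu -> lam <> mu ->
  0 <= Lgen q N a mu lam.
Proof.
  intros Hq Ha HG Hne. unfold Lgen. apply Rsum_nonneg. intros k Hk. apply Rsum_nonneg. intros j Hj.
  rewrite range1 in Hk, Hj. apply in_seq in Hk. apply in_seq in Hj.
  rewrite (Kdelta_neq lam mu) by auto. apply Rmult_le_pos.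
  - apply (rate_nonneg q N); auto; lia.
  - unfold Kdelta. destruct (list_eq_dec _ _ _); lra.
Qed.

Lemma Rsum_Kdelta_l (S : list pattern) (f : pattern -> R) (p : pattern) : NoDup S -> In p S ->
  Rsum_list S (fun x => f x * Kdelta x p) = f p.
Proof.
  intros H1 H2. rewrite (Rsum_single S _ p); auto.
  - rewrite Kdelta_eq. lra.
  - intros x _ Hx. rewrite Kdelta_neq by auto. lra.
Qed.

Lemma Rsum_Kdelta_r (S : list pattern) (f : pattern -> R) (p : pattern) : NoDup S -> In p S ->
  Rsum_list S (fun x => f x * Kdelta p x) = f p.
Proof.
  intros H1 H2. rewrite (Rsum_single S _ p); auto.
  - rewrite Kdelta_eq. lra.
  - intros x _ Hx. rewrite Kdelta_neq by auto. lra.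
Qed.

Lemma Lgen_row_sum (q : R) (N : nat) (a : list R) (mu : pattern) (S : list pattern) :
  inG N mu -> NoDup S -> Forall (inG N) S ->
  (forall lam, inG N lam -> Lgen q N a mu lam <> 0 -> In lam S) ->
  Rsum_list S (fun lam => Lgen q N a mu lam) = 0.
Proof.
  intros HG HS HF HC. rewrite Forall_forall in HF.
  rewrite (Rsum_support S (targets N mu)); auto; try apply G_list_NoDup.
  2:{ intros lam Hl Hn. apply (targets_complete q N a); auto. }
  2:{ intros lam Hl Hn. apply HC; auto. apply G_list_In in Hl. apply Hl. }
  unfold Lgen. rewrite Rsum_swap. apply Rsum_zero. intros k Hk.
  rewrite Rsum_swap. apply Rsum_zero. intros j Hj.
  rewrite range1 in Hk, Hj. apply in_seq in Hk. apply in_seq in Hj.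
  (* With rate 0 the raised pattern may lie outside G_N and so outside the list; otherwise both
     deltas are met exactly once and cancel. *)
  destruct (Req_dec (rate q a mu j k) 0) as [E|E].
  { apply Rsum_zero. intros lam _. rewrite E. lra. }
  rewrite Rsum_scal, Rsum_minus.
  rewrite (Rsum_ext _ (fun x => Kdelta x (plus_jk N mu j k)) (fun x => 1 * Kdelta x (plus_jk N mu j k)))
    by (intros; lra).
  rewrite (Rsum_ext _ (fun x => Kdelta x mu) (fun x => 1 * Kdelta x mu)) by (intros; lra).
  rewrite !Rsum_Kdelta_l; auto; try apply G_list_NoDup; try lra.
  - apply G_list_In. split; auto. left; auto.
  - apply G_list_In. split; [right|].
    + apply in_map_iff. exists (k, j). split; [reflexivity | apply in_level_pairs; lia].
    + apply (rate_nonzero_inG q N a); auto; lia.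
Qed.

(* With [x], [y] the rows of levels [k - 1], [k] and [E_j = q^(x_j - y_{j+1})], the [j]-th term of the
   left side exceeds the [j]-th term of the right side by [E_j - E_{j-1}]. *)
Lemma total_rate (q : R) (N : nat) (a : list R) (lam : pattern) (n : nat) : 0 < q < 1 ->
  inG N lam -> (S n <= N)%nat ->
  Rsum_list (seq 1 (S n)) (fun j => rate q a lam j (S n))
  = nth n a 0 * (1 + Rsum_list (seq 1 n) (fun j => phi q lam j n * cut q lam j n)).
Proof.
  intros Hq HG Hn.
  (* The value 0 at j = 0 encodes x_0 = +infinity. *)
  set (E := fun j => if Nat.eqb j 0 then 0 else powerRZ q (entry lam n j - entry lam (S n) (S j))).
  assert (HE : forall j, (1 <= j <= n)%nat -> rate q a lam j (S n) =
    nth n a 0 * (phi q lam j n * cut q lam j n + (E j - E (j - 1)%nat))).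
  { intros j Hj. unfold rate, phi, cut, E. replace (S n - 1)%nat with n by lia.
    assert (Ha := G_above N lam HG n j ltac:(lia) ltac:(lia)).
    assert (HD := q_factor_pos q Hq (entry lam (S n) j - entry lam n j + 1) ltac:(lia)).
    destruct (Nat.eqb_spec j (S n)), (Nat.eqb_spec j 0); try lia.
    (* With D = q^(y_j - x_j + 1), F = E_j and G = E_{j-1}, the claim becomes (1 - G)(1 - D F) - (1
       - G D)(1 - F) = (1 - D)(F - G). *)
    replace (entry lam (S n) j - entry lam (S n) (S j) + 1)%Z
      with ((entry lam (S n) j - entry lam n j + 1) + (entry lam n j - entry lam (S n) (S j)))%Z by lia.
    rewrite (qZ_add q Hq (_ + 1) (entry lam n j - _)).
    set (D := powerRZ q (entry lam (S n) j - entry lam n j + 1)) in *.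
    set (F := powerRZ q (entry lam n j - entry lam (S n) (S j))).
    destruct (Nat.eqb_spec j 1), (Nat.eqb_spec (j - 1) 0); try lia.
    - field. lra.
    - replace (S (j - 1)) with j by lia.
      replace (entry lam n (j - 1) - entry lam n j + 1)%Z
        with ((entry lam n (j - 1) - entry lam (S n) j) + (entry lam (S n) j - entry lam n j + 1))%Z by lia.
      rewrite (qZ_add q Hq). fold D. field. lra. }
  rewrite Rsum_seq_S.
  rewrite (Rsum_ext (seq 1 n) (fun j => rate q a lam j (S n))
    (fun j => nth n a 0 * (phi q lam j n * cut q lam j n + (E j - E (j - 1)%nat)))).
  2:{ intros j Hj. apply in_seq in Hj. apply HE; lia. }
  rewrite Rsum_scal, Rsum_plus, Rsum_telescope. change (1 + n)%nat with (S n).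
  (* The last rate, at j = n + 1, is a_{n+1} (1 - E_n); it absorbs the end point E_n of the
     telescoped sum and leaves the summand 1. *)
  unfold rate, E. rewrite (Nat.eqb_refl (S n)). replace (S n - 1)%nat with n by lia.
  destruct (Nat.eqb_spec (S n) 1), (Nat.eqb_spec n 0); try lia; simpl (Nat.eqb 0 0); cbv iota.
  - field.
  - field.
Qed.

Section Balance.
Variables (q : R) (N : nat) (a : list R) (lam : pattern) (V : list Z -> R).
Hypothesis Hq : 0 < q < 1.
Hypothesis Ha : forall i, (1 <= i <= N)%nat -> 0 < nth (i - 1) a 0.
Hypothesis HG : inG N lam.

Let W := pattern_weight q N a.

(** The sum over predecessors and jumps (mu, (k, j)) is reindexed by the pairs (e, j) of an open
    string's last level and column. For e = N the move also changes the argument of [V]. *)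
Lemma inflow :
  Rsum_list (sources N lam) (fun mu => Rsum_list (seq 1 N) (fun k => Rsum_list (seq 1 k) (fun j =>
    W mu * V (row mu N) * rate q a mu j k * Kdelta lam (plus_jk N mu j k))))
  = Rsum_list (seq 1 N) (fun e => Rsum_list (seq 1 e) (fun j =>
      if openb N lam j e then
        W lam * phi q lam j e *
        (if Nat.eqb e N then V (upd_nth (j - 1) Z.pred (row lam N))
         else nth e a 0 * cut q lam j e * V (row lam N))
      else 0)).
Proof.
  set (h := fun t : pattern * (nat * nat) => let (mu, kj) := t in let (k, j) := kj in
    if Nat.leb j k then W mu * V (row mu N) * rate q a mu j k * Kdelta lam (plus_jk N mu j k) else 0).
  set (ok := fun ej : nat * nat => let (e, j) := ej in (Nat.leb j e && openb N lam j e)%bool).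
  set (src := fun ej : nat * nat => let (e, j) := ej in
    (low j (kst lam j e) e lam, (kst lam j e, j))).
  transitivity (Rsum_list (list_prod (sources N lam) (level_pairs N)) h).
  { rewrite Rsum_list_prod. apply Rsum_ext. intros mu _.
    unfold level_pairs. rewrite Rsum_list_prod. apply Rsum_ext. intros k Hk. apply in_seq in Hk.
    rewrite (Rsum_seq_extend k N) by lia. reflexivity. }
  transitivity (Rsum_list (map src (filter ok (level_pairs N))) h).
  { assert (NDL : NoDup (level_pairs N)) by (apply NoDup_list_prod; apply seq_NoDup).
    apply Rsum_support.
    - apply NoDup_list_prod; auto. apply G_list_NoDup.
    - apply NoDup_map_inj; [|apply NoDup_filter; auto].
      intros [e j] [e' j'] H1 H2 E. apply filter_In in H1. apply filter_In in H2.
      destruct H1 as [I1 O1], H2 as [I2 O2]. apply in_level_pairs in I1. apply in_level_pairs in I2.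
      unfold ok in O1, O2. apply andb_prop in O1. apply andb_prop in O2.
      destruct O1 as [L1 O1], O2 as [L2 O2]. apply Nat.leb_le in L1. apply Nat.leb_le in L2.
      unfold src in E. injection E as E1 E2 E3. subst j'. f_equal.
      (* Injectivity of [src]: the last level e is recovered from the lowered pattern as the end of
         its block. *)
      rewrite <- (blk_end_low N lam j (kst lam j e) e); auto; try lia.
      2:{ apply (kst_spec N); auto; lia. }
      rewrite E1, E2. apply blk_end_low; auto; try lia. apply (kst_spec N); auto; lia.
    - intros [mu [k j]] Hin Hh. apply in_prod_iff in Hin. destruct Hin as [Hmu Hkj].
      apply in_level_pairs in Hkj. apply G_list_In in Hmu. destruct Hmu as [_ Hmu].
      unfold h in Hh. destruct (Nat.leb_spec j k) as [Hjk|]; [|lra].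
      destruct (pattern_eq_dec lam (plus_jk N mu j k)) as [E|E].
      2:{ rewrite Kdelta_neq in Hh by auto. lra. }
      destruct (plus_jk_preimage N mu lam j k Hmu HG ltac:(lia) ltac:(lia) (eq_sym E))
        as [e [He [Hs [Ho Em]]]].
      assert (Ek : kst lam j e = k).
      { apply (is_start_unique lam j _ _ e); auto. apply (kst_spec N); auto; lia. }
      apply in_map_iff. exists (e, j). split.
      + unfold src. rewrite Ek, Em. reflexivity.
      + apply filter_In. split; [apply in_level_pairs; lia|]. unfold ok. rewrite Ho.
        destruct (Nat.leb_spec j e); auto; lia.
    - intros x Hin _. apply in_map_iff in Hin. destruct Hin as [[e j] [E Hin]].
      apply filter_In in Hin. destruct Hin as [I1 O1]. assert (I0 := I1). apply in_level_pairs in I1.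
      unfold ok in O1. apply andb_prop in O1. destruct O1 as [L1 O1]. apply Nat.leb_le in L1.
      assert (Hs := kst_spec N lam j e HG ltac:(lia) ltac:(lia)).
      rewrite <- E. unfold src. apply in_prod_iff. split.
      + apply G_list_In. split.
        * right. apply in_map_iff. exists (e, j). split; auto.
        * apply low_inG; auto; lia.
      + apply in_level_pairs. destruct Hs as [Hs1 [Hs2 _]]. lia. }
  rewrite Rsum_map.
  transitivity (Rsum_list (level_pairs N) (fun ej => if ok ej then h (src ej) else 0)).
  { generalize (level_pairs N). intros l. induction l as [|x l IH]; simpl; [reflexivity|].
    destruct (ok x); simpl; rewrite IH; lra. }
  unfold level_pairs. rewrite Rsum_list_prod. apply Rsum_ext. intros e He. apply in_seq in He.
  rewrite (Rsum_seq_extend e N) by lia. apply Rsum_ext. intros j Hj. apply in_seq in Hj.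
  unfold ok. destruct (Nat.leb_spec j e) as [L|L]; [|reflexivity]. cbn [andb].
  destruct (openb N lam j e) eqn:Ho; [|reflexivity].
  assert (Hs := kst_spec N lam j e HG ltac:(lia) ltac:(lia)).
  unfold src, h. set (k := kst lam j e) in *.
  assert (Hs' := Hs). destruct Hs' as [Hs1 [Hs2 _]].
  destruct (Nat.leb_spec j k) as [_|]; [|lia].
  rewrite (plus_jk_low N lam j k e), Kdelta_eq; auto; try lia.
  assert (Hw := pattern_weight_low q N a lam j k e Hq Ha HG ltac:(lia) Hs Ho). fold W in Hw.
  assert (Hrow : row (low j k e lam) N =
    if Nat.eqb e N then upd_nth (j - 1) Z.pred (row lam N) else row lam N).
  { unfold low. rewrite row_chg.
    destruct (Nat.leb_spec k N), (Nat.leb_spec N e), (Nat.eqb_spec e N); try lia; reflexivity. }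
  rewrite Hrow.
  replace (W (low j k e lam) * V (if (e =? N)%nat then upd_nth (j - 1) Z.pred (row lam N) else row lam N)
           * rate q a (low j k e lam) j k * 1)
    with (W (low j k e lam) * rate q a (low j k e lam) j k
          * V (if (e =? N)%nat then upd_nth (j - 1) Z.pred (row lam N) else row lam N)) by ring.
  rewrite Hw. destruct (Nat.eqb e N); ring.
Qed.

(** Whatever [V] is, the flow through levels below N cancels, and only the strings reaching the top
    row and the constant rate a_1 + ... + a_N survive. The right side has exactly the shape of the
    time derivative of the normalized Q. *)
Lemma master_balance (S : list pattern) : NoDup S -> Forall (inG N) S ->
  (forall mu, inG N mu -> Lgen q N a mu lam <> 0 -> In mu S) ->
  Rsum_list S (fun mu => W mu * V (row mu N) * Lgen q N a mu lam)
  = W lam * (Rsum_list (seq 1 N) (fun j =>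
               if openb N lam j N then phi q lam j N * V (upd_nth (j - 1) Z.pred (row lam N)) else 0)
             - Rsum_list (seq 1 N) (fun k => nth (k - 1) a 0) * V (row lam N)).
Proof.
  intros HS HF HC. rewrite Forall_forall in HF.
  rewrite (Rsum_support S (sources N lam)); auto; try apply G_list_NoDup.
  2:{ intros mu Hm Hn. apply (sources_complete q N a); auto.
      intros E. apply Hn. rewrite E. lra. }
  2:{ intros mu Hm Hn. apply HC; [apply G_list_In in Hm; apply Hm|].
      intros E. apply Hn. rewrite E. lra. }
  rewrite (Rsum_ext _ _ (fun mu =>
    Rsum_list (seq 1 N) (fun k => Rsum_list (seq 1 k) (fun j =>
      W mu * V (row mu N) * rate q a mu j k * Kdelta lam (plus_jk N mu j k)))
    - (W mu * V (row mu N) * Rsum_list (seq 1 N) (fun k => Rsum_list (seq 1 k) (fun j => rate q a mu j k)))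
      * Kdelta lam mu)).
  2:{ intros mu _. unfold Lgen. rewrite range1. set (c := W mu * V (row mu N)).
      set (d := Kdelta lam mu). set (T := Rsum_list _ (fun k => Rsum_list _ (fun j => rate _ _ _ _ _))).
      replace (c * T * d) with ((c * d) * T) by ring. unfold T.
      rewrite <- (Rsum_scal _ _ c), <- (Rsum_scal _ _ (c * d)), <- Rsum_minus.
      apply Rsum_ext. intros k _.
      rewrite range1, <- (Rsum_scal _ _ c), <- (Rsum_scal _ _ (c * d)), <- Rsum_minus.
      apply Rsum_ext. intros j _. ring. }
  rewrite Rsum_minus, inflow, Rsum_Kdelta_r; auto; try apply G_list_NoDup.
  2:{ apply G_list_In. split; auto. left; auto. }
  destruct N as [|n] eqn:EN; [simpl; ring|].
  rewrite (Rsum_seq_S 1 n (fun e => Rsum_list (seq 1 e) _)). change (1 + n)%nat with (Datatypes.S n).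
  rewrite Nat.eqb_refl.
  rewrite (Rsum_ext (seq 1 n) _ (fun e => (W lam * V (row lam (Datatypes.S n))) *
    (nth e a 0 * Rsum_list (seq 1 e) (fun j => phi q lam j e * cut q lam j e)))).
  2:{ intros e He. apply in_seq in He. rewrite <- !Rsum_scal. apply Rsum_ext. intros j Hj.
      apply in_seq in Hj. destruct (Nat.eqb_spec e (Datatypes.S n)); [lia|].
      destruct (openb (Datatypes.S n) lam j e) eqn:Ho; [ring|].
      assert (E0 : cut q lam j e = 0).
      { unfold openb in Ho. destruct (Nat.eqb_spec e (Datatypes.S n)); [lia|].
        apply Z.ltb_ge in Ho. assert (Hb := G_below (Datatypes.S n) lam HG e j ltac:(lia) ltac:(lia)).
        unfold cut. replace (entry lam e j - entry lam (Datatypes.S e) (Datatypes.S j))%Z with 0%Z by lia.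
        simpl (powerRZ q 0). unfold Rdiv. ring. }
      rewrite E0. ring. }
  rewrite Rsum_scal.
  rewrite (Rsum_ext _ (fun k => Rsum_list (seq 1 k) (fun j => rate q a lam j k))
    (fun k => nth (k - 1) a 0 + nth (k - 1) a 0 *
       Rsum_list (seq 1 (k - 1)) (fun j => phi q lam j (k - 1) * cut q lam j (k - 1)))).
  2:{ intros k Hk. apply in_seq in Hk. 
      assert (Ht := total_rate q (Datatypes.S n) a lam (k - 1) Hq HG ltac:(lia)).
      replace (Datatypes.S (k - 1)) with k in Ht by lia. rewrite Ht. ring. }
  rewrite Rsum_plus.
  (* The outflow at level k = e + 1 is a_k plus a sum that cancels the inflow by strings ending at
     level e; for k = 1 that sum is empty. *)
  change (seq 1 (Datatypes.S n)) with (1%nat :: seq 2 n) at 3.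
  rewrite <- (seq_shift n 1). simpl (Rsum_list (_ :: _) _). rewrite Rsum_map.
  rewrite (Rsum_ext (seq 1 n) (fun x => nth (Datatypes.S x - 1) a 0 * _)
    (fun e => nth e a 0 * Rsum_list (seq 1 e) (fun j => phi q lam j e * cut q lam j e))).
  2:{ intros e _. replace (Datatypes.S e - 1)%nat with e by lia. reflexivity. }
  rewrite (Rsum_ext _ (fun j => if openb _ _ _ _ then W lam * _ * _ else 0)
    (fun j => W lam * (if openb (Datatypes.S n) lam j (Datatypes.S n)
        then phi q lam j (Datatypes.S n) * V (upd_nth (j - 1) Z.pred (row lam (Datatypes.S n))) else 0))).
  2:{ intros j _. destruct (openb _ _ _ _); ring. }
  rewrite Rsum_scal. ring.
Qed.

End Balance.

(** * The Pieri rule *)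

Lemma in_zrange (lo hi k : Z) : In k (zrange lo hi) <-> (lo <= k <= hi)%Z.
Proof.
  unfold zrange. rewrite in_map_iff. split.
  - intros [i [E Hi]]. apply in_seq in Hi. lia.
  - intros H. exists (Z.to_nat (k - lo)). split; [lia|]. apply in_seq. lia.
Qed.

Lemma NoDup_zrange (lo hi : Z) : NoDup (zrange lo hi).
Proof.
  unfold zrange. apply FinFun.Injective_map_NoDup; [|apply seq_NoDup].
  intros i j E. lia.
Qed.

Definition interlace (lam mu : list Z) : Prop :=
  forall i, (1 <= i <= length mu)%nat -> (lnth lam (S i) <= lnth mu i <= lnth lam i)%Z.

Definition signature (lam : list Z) : Prop :=
  forall i, (1 <= i < length lam)%nat -> (lnth lam (S i) <= lnth lam i)%Z.

Lemma in_interl_below (lam mu : list Z) : lam <> [] ->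
  (In mu (interl_below lam) <-> S (length mu) = length lam /\ interlace lam mu).
Proof.
  revert mu. induction lam as [|l1 lam IH]; intros mu Hne; [congruence|].
  destruct lam as [|l2 lam].
  - simpl. split.
    + intros [<-|[]]. split; auto. intros i Hi; simpl in Hi; lia.
    + intros [H _]. left. destruct mu; auto. simpl in H. lia.
  - cbn [interl_below]. rewrite in_flat_map. split.
    + intros [m [Hm Hin]]. apply in_map_iff in Hin. destruct Hin as [mu' [<- Hin]].
      apply IH in Hin; [|discriminate]. destruct Hin as [H1 H2]. apply in_zrange in Hm.
      split; [simpl in *; lia|]. intros i Hi. destruct i as [|[|i]]; [lia| |].
      * unfold lnth; simpl. lia.
      * assert (H3 := H2 (S i)). unfold lnth in *. simpl in *. rewrite Nat.sub_0_r in *. apply H3. lia.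
    + intros [H1 H2]. destruct mu as [|m mu]; [simpl in H1; lia|]. exists m. split.
      * apply in_zrange. assert (H3 := H2 1%nat). unfold lnth in H3; simpl in H3. apply H3. lia.
      * apply in_map. apply IH; [discriminate|]. split; [simpl in *; lia|].
        intros i Hi. destruct i as [|i]; [lia|]. assert (H3 := H2 (S (S i))). unfold lnth in *.
        simpl in *. rewrite Nat.sub_0_r. apply H3. lia.
Qed.

Lemma NoDup_interl_below (lam : list Z) : NoDup (interl_below lam).
Proof.
  induction lam as [|l1 lam IH]; [constructor|].
  destruct lam as [|l2 lam]; [repeat constructor; simpl; tauto|]. cbn [interl_below].
  set (L := interl_below (l2 :: lam)) in *.
  assert (E : forall Z0 : list Z, flat_map (fun m => map (cons m) L) Z0
    = map (fun p => fst p :: snd p) (list_prod Z0 L)).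
  { induction Z0 as [|z Z0 IHZ]; simpl; [reflexivity|].
    rewrite map_app, map_map, IHZ. reflexivity. }
  rewrite E. apply NoDup_map_inj.
  - intros [x y] [x' y'] _ _ H. simpl in H. congruence.
  - apply NoDup_list_prod; auto. apply NoDup_zrange.
Qed.

Lemma Csum_fst {A : Type} (l : list A) (f : A -> C) :
  fst (Csum_list l f) = Rsum_list l (fun x => fst (f x)).
Proof. induction l as [|x l IH]; simpl; [reflexivity | rewrite IH; reflexivity]. Qed.

Lemma Csum_snd {A : Type} (l : list A) (f : A -> C) :
  snd (Csum_list l f) = Rsum_list l (fun x => snd (f x)).
Proof. induction l as [|x l IH]; simpl; [reflexivity | rewrite IH; reflexivity]. Qed.

Lemma Csum_ext {A : Type} (l : list A) (f g : A -> C) :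
  (forall x, In x l -> f x = g x) -> Csum_list l f = Csum_list l g.
Proof.
  induction l as [|x l IH]; simpl; intros H; [reflexivity|].
  rewrite H by auto. rewrite IH; auto.
Qed.

Lemma Csum_app {A : Type} (l l' : list A) (f : A -> C) :
  Csum_list (l ++ l') f = Cadd (Csum_list l f) (Csum_list l' f).
Proof. induction l as [|x l IH]; simpl; [ring | rewrite IH; ring]. Qed.

Lemma Csum_scal {A : Type} (l : list A) (f : A -> C) (c : C) :
  Csum_list l (fun x => Cmul c (f x)) = Cmul c (Csum_list l f).
Proof. induction l as [|x l IH]; simpl; [ring | rewrite IH; ring]. Qed.

Lemma Csum_map {A B : Type} (h : A -> B) (l : list A) (f : B -> C) :
  Csum_list (map h l) f = Csum_list l (fun x => f (h x)).
Proof. induction l as [|x l IH]; simpl; [reflexivity | rewrite IH; reflexivity]. Qed.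

Lemma Csum_flat_map {A B : Type} (h : A -> list B) (l : list A) (f : B -> C) :
  Csum_list (flat_map h l) f = Csum_list l (fun x => Csum_list (h x) f).
Proof. induction l as [|x l IH]; simpl; [reflexivity | rewrite Csum_app, IH; reflexivity]. Qed.

Lemma pats_row (n : nat) (lam : list Z) (p : pattern) : length lam = n -> In p (pats n lam) ->
  length p = n /\ row p n = lam.
Proof.
  revert lam p. induction n as [|n IH]; intros lam p Hl Hp.
  - simpl in Hp. destruct Hp as [<-|[]]. destruct lam; [auto | discriminate].
  - cbn [pats] in Hp. apply in_flat_map in Hp. destruct Hp as [mu [Hmu Hp]].
    apply in_map_iff in Hp. destruct Hp as [p' [<- Hp']].
    assert (Hne : lam <> []) by (destruct lam; discriminate || congruence).
    apply in_interl_below in Hmu; auto. destruct (IH mu p') as [H1 H2]; auto; [lia|].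
    rewrite length_app. simpl length. split; [lia|]. simpl. rewrite app_nth2 by lia.
    rewrite H1, Nat.sub_diag. reflexivity.
Qed.

Lemma row_app (p : pattern) (lam : list Z) (j : nat) : (j <= length p)%nat ->
  row (p ++ [lam]) j = row p j.
Proof. intros H. destruct j; [reflexivity|]. simpl. apply app_nth1. lia. Qed.

(** Branching rule: the last variable enters only through the last two rows, which lets the Pieri
    induction peel it off. *)
Lemma Psym_rec (q : R) (n : nat) (lam : list Z) (x : list C) : length lam = S n ->
  Psym q lam x = Csum_list (interl_below lam) (fun mu =>
    Cmul (Psym q mu x) (Pskew q lam mu (nth n x C0))).
Proof.
  intros Hl. unfold Psym at 1. rewrite Hl. cbn [pats]. rewrite Csum_flat_map.
  assert (Hne : lam <> []) by (destruct lam; discriminate || congruence).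
  apply Csum_ext. intros mu Hmu. apply in_interl_below in Hmu; auto. destruct Hmu as [Hm _].
  unfold Psym. replace (length mu) with n by lia.
  rewrite Csum_map. set (c := Pskew _ _ _ _).
  match goal with |- _ = ?r => replace r with (Cmul c (Csum_list (pats n mu) (fun p =>
    Cprod (range 1 n) (fun j => Pskew q (row p j) (row p (j - 1)) (nth (j - 1) x C0))))) by ring end.
  rewrite <- Csum_scal. apply Csum_ext. intros p Hp.
  destruct (pats_row n mu p) as [H1 H2]; auto; [lia|].
  rewrite !range1, Cprod_seq_S. change (1 + n)%nat with (S n).
  replace (S n - 1)%nat with n by lia.
  rewrite (row_app p lam n) by lia. rewrite H2.
  replace (row (p ++ [lam]) (S n)) with lam.
  2:{ simpl. rewrite app_nth2, H1, Nat.sub_diag by lia. reflexivity. }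
  fold c. rewrite (Cprod_ext _ _ (fun j => Pskew q (row p j) (row p (j - 1)) (nth (j - 1) x C0))).
  - ring.
  - intros j Hj. apply in_seq in Hj. rewrite !row_app by lia. reflexivity.
Qed.

(** The value 1 at i = n encodes lam_{n+1} = -infinity. For a signature the coefficient vanishes
    exactly when lam - e_i is not a signature. *)
Definition pieri_coef (q : R) (n : nat) (lam : list Z) (i : nat) : R :=
  if Nat.eqb i n then 1 else 1 - powerRZ q (lnth lam i - lnth lam (S i)).

Definition skew_factor (q : R) (lam mu : list Z) (i : nat) : R :=
  qpoch_fin q q (lnth lam i - lnth lam (S i)) * inv_qq q (lnth lam i - lnth mu i)
  * inv_qq q (lnth mu i - lnth lam (S i)).

Lemma skew_weight_factor (q : R) (n : nat) (lam mu : list Z) : length lam = S n ->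
  skew_weight q lam mu = Rprod (seq 1 n) (skew_factor q lam mu).
Proof.
  intros H. unfold skew_weight. rewrite H, range1. replace (S n - 1)%nat with n by lia. reflexivity.
Qed.

Lemma Rprod_zero (l : list nat) (f : nat -> R) (i : nat) : In i l -> f i = 0 -> Rprod l f = 0.
Proof.
  unfold Rprod. induction l as [|x l IH]; simpl; intros Hi Hf; [tauto|].
  destruct Hi as [->|Hi]; [rewrite Hf; lra | rewrite IH; auto; lra].
Qed.

(** The convention 1/(q;q)_n = 0 for n < 0 enforces interlacing by itself, so sums over interlacing
    rows can be enlarged freely before they are reindexed. *)
Lemma skew_weight_support (q : R) (lam mu : list Z) : S (length mu) = length lam ->
  skew_weight q lam mu <> 0 -> In mu (interl_below lam).
Proof.
  intros Hl Hw. apply in_interl_below; [destruct lam; simpl in Hl; congruence|]. split; auto.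
  intros i Hi. rewrite (skew_weight_factor q (length mu)) in Hw by auto.
  assert (Hi' : In i (seq 1 (length mu))) by (apply in_seq; lia). split.
  - destruct (Z_lt_le_dec (lnth mu i) (lnth lam (S i))) as [H|H]; auto. exfalso. apply Hw.
    apply (Rprod_zero _ _ i Hi'). unfold skew_factor. rewrite (inv_qq_neg q (lnth mu i - _)) by lia. ring.
  - destruct (Z_lt_le_dec (lnth lam i) (lnth mu i)) as [H|H]; auto. exfalso. apply Hw.
    apply (Rprod_zero _ _ i Hi'). unfold skew_factor. rewrite (inv_qq_neg q (lnth lam i - _)) by lia. ring.
Qed.

Section Pieri.
Variable q : R.
Hypothesis Hq : 0 < q < 1.

Lemma skew_factor_lower_here (m s t : Z) : (m = s + t)%Z -> (0 <= m)%Z ->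
  (1 - powerRZ q m) * (qpoch_fin q q (m - 1) * inv_qq q (s - 1) * inv_qq q t)
  = qpoch_fin q q m * inv_qq q s * inv_qq q t * (1 - powerRZ q s).
Proof.
  intros E Hm. destruct (Z.eq_dec m 0) as [E0|E0].
  - rewrite E0. replace t with (- s)%Z by lia.
    transitivity (qpoch_fin q q 0 * (((1 - powerRZ q s) * inv_qq q s) * inv_qq q (- s))); [|ring].
    rewrite <- (inv_qq_rec q Hq). simpl (powerRZ q 0).
    destruct (Z_le_gt_dec s 0); [rewrite (inv_qq_neg q (s - 1)) by lia
                                | rewrite (inv_qq_neg q (- s)) by lia]; ring.
  - rewrite (qpoch_fin_rec q Hq m) by lia. rewrite (inv_qq_rec q Hq s). ring.
Qed.

(** * The two-row identity behind the Pieri rule *)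

Section TwoRows.
Variables (n : nat) (lam nu : list Z).
Hypothesis Hlam : length lam = S n.
Hypothesis Hnu : length nu = n.
Hypothesis Hsig : signature lam.

(** The telescoping quantity; its value 0 beyond n encodes nu_{n+1} = -infinity. *)
Let u (i : nat) : R := if Nat.leb i n then powerRZ q (lnth lam i - lnth nu i) else 0.
Let w := skew_weight q.
Let f := skew_factor q lam nu.
Let others (i : nat) : R := Rprod (seq 1 n) (fun l => if Nat.eqb l i then 1 else f l).

Lemma weight_split (i : nat) : (1 <= i <= n)%nat -> w lam nu = others i * f i.
Proof.
  intros Hi. unfold w. rewrite (skew_weight_factor q n) by auto. fold f.
  rewrite (Rprod_ext _ f (fun l => (if Nat.eqb l i then 1 else f l) * (if Nat.eqb l i then f i else 1))).
  - rewrite Rprod_mult, Rprod_indicator.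
    destruct (Nat.leb_spec 1 i), (Nat.leb_spec i n); try lia. reflexivity.
  - intros l _. destruct (Nat.eqb_spec l i) as [->|]; ring.
Qed.

Lemma weight_raise_lower (i : nat) : (1 <= i <= n)%nat ->
  w lam (upd_nth (i - 1) Z.succ nu) = others i *
  (qpoch_fin q q (lnth lam i - lnth lam (S i)) * inv_qq q (lnth lam i - lnth nu i - 1)
   * inv_qq q (lnth nu i - lnth lam (S i) + 1)).
Proof.
  intros Hi. unfold w. rewrite (skew_weight_factor q n) by auto.
  set (g := qpoch_fin q q _ * _ * _).
  rewrite (Rprod_ext _ _ (fun l => (if Nat.eqb l i then 1 else f l) * (if Nat.eqb l i then g else 1))).
  - rewrite Rprod_mult, Rprod_indicator.
    destruct (Nat.leb_spec 1 i), (Nat.leb_spec i n); try lia. reflexivity.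
  - intros l Hl. apply in_seq in Hl. unfold skew_factor. rewrite lnth_upd_nth by lia.
    destruct (Nat.eqb_spec l i) as [->|].
    + unfold g.
      replace (lnth lam i - Z.succ (lnth nu i))%Z with (lnth lam i - lnth nu i - 1)%Z by lia.
      replace (Z.succ (lnth nu i) - lnth lam (S i))%Z with (lnth nu i - lnth lam (S i) + 1)%Z by lia.
      ring.
    + unfold f, skew_factor. ring.
Qed.

(** Lowering lam_{i+1} changes the factors i and i + 1, and the Pieri coefficient combines with
    factor i + 1 into 1 - u_{i+1}. For i = n there is no such factor, in agreement with coefficient
    1 and u_{n+1} = 0. *)
Lemma weight_lower_upper (i : nat) : (1 <= i <= n)%nat ->
  pieri_coef q (S n) lam (S i) * w (upd_nth i Z.pred lam) nu = others i *
  (qpoch_fin q q (lnth lam i - lnth lam (S i) + 1) * inv_qq q (lnth lam i - lnth nu i)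
   * inv_qq q (lnth nu i - lnth lam (S i) + 1)) * (1 - u (S i)).
Proof.
  intros Hi. unfold w. rewrite (skew_weight_factor q n) by (rewrite length_upd_nth; auto).
  set (g := qpoch_fin q q _ * _ * _). set (c := pieri_coef q (S n) lam (S i)).
  assert (Hup : forall l, (1 <= l)%nat -> lnth (upd_nth i Z.pred lam) l =
     if Nat.eqb l (S i) then (lnth lam (S i) - 1)%Z else lnth lam l).
  { intros l Hl. replace i with (S i - 1)%nat at 1 by lia. rewrite lnth_upd_nth by lia. reflexivity. }
  assert (Hc : c = if Nat.leb (S i) n then c else 1).
  { destruct (Nat.leb_spec (S i) n); auto. unfold c, pieri_coef.
    destruct (Nat.eqb_spec (S i) (S n)); [reflexivity | lia]. }
  transitivity (Rprod (seq 1 n) (fun l => (if Nat.eqb l (S i) then c else 1)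
      * skew_factor q (upd_nth i Z.pred lam) nu l)).
  { rewrite Rprod_mult, Rprod_indicator. simpl (Nat.leb 1 (S i)). cbn [andb]. rewrite <- Hc. ring. }
  rewrite (Rprod_ext _ _ (fun l => (if Nat.eqb l i then 1 else f l) *
     ((if Nat.eqb l i then g else 1) * (if Nat.eqb l (S i) then 1 - u (S i) else 1)))).
  - rewrite !Rprod_mult, !Rprod_indicator. simpl (Nat.leb 1 (S i)).
    destruct (Nat.leb_spec 1 i), (Nat.leb_spec i n); try lia. cbn [andb].
    destruct (Nat.leb_spec (S i) n) as [L|L].
    + unfold others. ring.
    + unfold u. destruct (Nat.leb_spec (S i) n); try lia. unfold others. ring.
  - intros l Hl. apply in_seq in Hl. unfold skew_factor. rewrite !Hup by lia.
    destruct (Nat.eqb_spec l i) as [->|Eli].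
    + destruct (Nat.eqb_spec i (S i)), (Nat.eqb_spec (S i) (S i)); try lia. unfold g.
      replace (lnth lam i - (lnth lam (S i) - 1))%Z with (lnth lam i - lnth lam (S i) + 1)%Z by lia.
      replace (lnth nu i - (lnth lam (S i) - 1))%Z with (lnth nu i - lnth lam (S i) + 1)%Z by lia.
      ring.
    + destruct (Nat.eqb_spec (S l) (S i)); try lia.
      destruct (Nat.eqb_spec l (S i)) as [->|Els].
      * unfold c, pieri_coef, u, f, skew_factor.
        destruct (Nat.eqb_spec (S i) (S n)), (Nat.leb_spec (S i) n); try lia.
        replace (lnth lam (S i) - 1 - lnth lam (S (S i)))%Z
          with (lnth lam (S i) - lnth lam (S (S i)) - 1)%Z by lia.
        replace (lnth lam (S i) - 1 - lnth nu (S i))%Z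
          with (lnth lam (S i) - lnth nu (S i) - 1)%Z by lia.
        assert (Hs := Hsig (S i) ltac:(lia)).
        rewrite (skew_factor_lower_here (lnth lam (S i) - lnth lam (S (S i)))
          (lnth lam (S i) - lnth nu (S i)) (lnth nu (S i) - lnth lam (S (S i)))) by lia. ring.
      * unfold f, skew_factor. ring.
Qed.

Lemma weight_lower_first :
  w lam nu - pieri_coef q (S n) lam 1 * w (upd_nth 0 Z.pred lam) nu = w lam nu * u 1.
Proof.
  assert (Hup : forall l, (1 <= l)%nat -> lnth (upd_nth 0 Z.pred lam) l =
     if Nat.eqb l 1 then (lnth lam 1 - 1)%Z else lnth lam l).
  { intros l Hl. change 0%nat with (1 - 1)%nat. rewrite lnth_upd_nth by lia. reflexivity. }
  assert (E : pieri_coef q (S n) lam 1 * w (upd_nth 0 Z.pred lam) nu = w lam nu * (1 - u 1)).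
  2:{ rewrite E. ring. }
  unfold w. rewrite !(skew_weight_factor q n) by (rewrite ?length_upd_nth; auto).
  set (c := pieri_coef q (S n) lam 1).
  assert (Hc : c = if Nat.leb 1 n then c else 1).
  { destruct (Nat.leb_spec 1 n); auto. unfold c, pieri_coef.
    destruct (Nat.eqb_spec 1 (S n)); [reflexivity | lia]. }
  transitivity (Rprod (seq 1 n) (fun l => (if Nat.eqb l 1 then c else 1)
      * skew_factor q (upd_nth 0 Z.pred lam) nu l)).
  { rewrite Rprod_mult, Rprod_indicator. simpl (Nat.leb 1 1). cbn [andb]. rewrite <- Hc. ring. }
  rewrite (Rprod_ext _ _ (fun l => skew_factor q lam nu l * (if Nat.eqb l 1 then 1 - u 1 else 1))).
  - rewrite !Rprod_mult, !Rprod_indicator. simpl (Nat.leb 1 1). cbn [andb].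
    destruct (Nat.leb_spec 1 n) as [L|L]; [ring|].
    unfold u. destruct (Nat.leb_spec 1 n); try lia. ring.
  - intros l Hl. apply in_seq in Hl. unfold skew_factor. rewrite !Hup by lia.
    destruct (Nat.eqb_spec (S l) 1); [lia|].
    destruct (Nat.eqb_spec l 1) as [->|Els]; [|ring].
    unfold c, pieri_coef, u.
    destruct (Nat.eqb_spec 1 (S n)), (Nat.leb_spec 1 n); try lia.
    replace (lnth lam 1 - 1 - lnth lam 2)%Z with (lnth lam 1 - lnth lam 2 - 1)%Z by lia.
    replace (lnth lam 1 - 1 - lnth nu 1)%Z with (lnth lam 1 - lnth nu 1 - 1)%Z by lia.
    assert (Hs := Hsig 1%nat ltac:(lia)).
    rewrite (skew_factor_lower_here (lnth lam 1 - lnth lam 2)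
      (lnth lam 1 - lnth nu 1) (lnth nu 1 - lnth lam 2)) by lia. ring.
Qed.

(** Let A = lam_i - nu_i, B = nu_i - lam_{i+1} + 1 and U = u_{i+1}. After the common factors are
    removed the claim is (1 - q^B U)(1 - q^A) - (1 - q^(A+B))(1 - U) = (1 - q^B)(U - q^A). *)
Lemma two_row_term (i : nat) : (1 <= i <= n)%nat ->
  pieri_coef q n (upd_nth (i - 1) Z.succ nu) i * w lam (upd_nth (i - 1) Z.succ nu)
  - pieri_coef q (S n) lam (S i) * w (upd_nth i Z.pred lam) nu
  = w lam nu * (u (S i) - u i).
Proof.
  intros Hi. rewrite weight_raise_lower, weight_lower_upper, (weight_split i) by auto.
  unfold f, skew_factor.
  assert (Hs := Hsig i ltac:(lia)).
  rewrite (inv_qq_rec q Hq (lnth lam i - lnth nu i)).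
  replace (lnth nu i - lnth lam (S i))%Z with (lnth nu i - lnth lam (S i) + 1 - 1)%Z at 3 by lia.
  rewrite (inv_qq_rec q Hq (lnth nu i - lnth lam (S i) + 1)).
  rewrite (qpoch_fin_up q Hq) by lia.
  replace (lnth lam i - lnth lam (S i) + 1)%Z
    with ((lnth lam i - lnth nu i) + (lnth nu i - lnth lam (S i) + 1))%Z by lia.
  rewrite (qZ_add q Hq).
  assert (Hc : pieri_coef q n (upd_nth (i - 1) Z.succ nu) i
    = 1 - powerRZ q (lnth nu i - lnth lam (S i) + 1) * u (S i)).
  { unfold pieri_coef, u. destruct (Nat.eqb_spec i n), (Nat.leb_spec (S i) n); try lia; [ring|].
    rewrite !lnth_upd_nth by lia. rewrite Nat.eqb_refl.
    destruct (Nat.eqb_spec (S i) i); [lia|]. rewrite <- (qZ_add q Hq). do 2 f_equal. lia. }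
  assert (Hu : u i = powerRZ q (lnth lam i - lnth nu i)).
  { unfold u. destruct (Nat.leb_spec i n); [reflexivity | lia]. }
  rewrite Hc, Hu. ring.
Qed.

(** The term raising nu_i is paired with the term lowering lam_{i+1}. The differences telescope to -
    w u_1, which the unpaired term lowering lam_1 compensates by [weight_lower_first]. *)
Lemma two_row_identity :
  Rsum_list (seq 1 n) (fun i => pieri_coef q n (upd_nth (i - 1) Z.succ nu) i
                                * w lam (upd_nth (i - 1) Z.succ nu)) + w lam nu
  = Rsum_list (seq 1 (S n)) (fun i => pieri_coef q (S n) lam i * w (upd_nth (i - 1) Z.pred lam) nu).
Proof.
  change (seq 1 (S n)) with (1%nat :: seq 2 n). rewrite <- (seq_shift n 1).
  rewrite Rsum_cons, Rsum_map.
  rewrite (Rsum_ext (seq 1 n) (fun x => pieri_coef q (S n) lam (S x) * _)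
    (fun i => pieri_coef q (S n) lam (S i) * w (upd_nth i Z.pred lam) nu)).
  2:{ intros i _. replace (S i - 1)%nat with i by lia. reflexivity. }
  rewrite (Rsum_ext (seq 1 n) (fun i => pieri_coef q n _ i * _)
    (fun i => pieri_coef q (S n) lam (S i) * w (upd_nth i Z.pred lam) nu
              + w lam nu * (u (S i) - u (S (i - 1))))).
  2:{ intros i Hi. apply in_seq in Hi. replace (S (i - 1)) with i by lia.
      assert (H := two_row_term i ltac:(lia)). lra. }
  rewrite Rsum_plus, Rsum_scal, (Rsum_telescope (fun i => u (S i))).
  assert (H1 := weight_lower_first).
  assert (H2 : u (S n) = 0) by (unfold u; destruct (Nat.leb_spec (S n) n); [lia | reflexivity]).
  rewrite H2. change (1 - 1)%nat with 0%nat. lra.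
Qed.

End TwoRows.

(** Summation by parts: substituting mu = nu + e_i on the left collects everything at a common
    argument of the arbitrary function f, where the two-row identity compares the coefficients. *)
Lemma skew_pieri (n : nat) (lam : list Z) (f : list Z -> R) : length lam = S n -> signature lam ->
  Rsum_list (interl_below lam) (fun mu => skew_weight q lam mu *
    (Rsum_list (seq 1 n) (fun i => pieri_coef q n mu i * f (upd_nth (i - 1) Z.pred mu)) + f mu))
  = Rsum_list (seq 1 (S n)) (fun i => pieri_coef q (S n) lam i *
      Rsum_list (interl_below (upd_nth (i - 1) Z.pred lam)) (fun mu =>
        skew_weight q (upd_nth (i - 1) Z.pred lam) mu * f mu)).
Proof.
  intros Hl Hsig.
  assert (Hne : forall l : list Z, length l = S n -> l <> []) by (intros [|? ?]; discriminate || congruence).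
  assert (Hin : forall l mu, length l = S n -> In mu (interl_below l) -> length mu = n).
  { intros l mu Hll Hmu. apply in_interl_below in Hmu; auto. lia. }
  (* A common list of all rows at which f is evaluated on either side; the added points carry weight
     0. *)
  set (B0 := interl_below lam
    ++ flat_map (fun i => map (upd_nth (i - 1) Z.pred) (interl_below lam)) (seq 1 n)
    ++ flat_map (fun i => interl_below (upd_nth (i - 1) Z.pred lam)) (seq 1 (S n))).
  set (B := nodup (list_eq_dec Z.eq_dec) B0).
  assert (HB : NoDup B) by apply NoDup_nodup.
  assert (HBi : forall mu, In mu B <-> In mu B0) by (intros; apply nodup_In).
  assert (HBl : forall mu, In mu B -> length mu = n).
  { intros mu Hmu. apply HBi in Hmu. unfold B0 in Hmu. rewrite !in_app_iff, !in_flat_map in Hmu.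
    destruct Hmu as [Hmu|[[i [Hi Hmu]]|[i [Hi Hmu]]]].
    - apply (Hin lam); auto.
    - apply in_map_iff in Hmu. destruct Hmu as [mu' [<- Hmu]]. rewrite length_upd_nth.
      apply (Hin lam); auto.
    - apply (Hin (upd_nth (i - 1) Z.pred lam)); auto. rewrite length_upd_nth; auto. }
  transitivity (Rsum_list B (fun nu => f nu *
    (Rsum_list (seq 1 n) (fun i => pieri_coef q n (upd_nth (i - 1) Z.succ nu) i
       * skew_weight q lam (upd_nth (i - 1) Z.succ nu)) + skew_weight q lam nu))).
  - rewrite (Rsum_ext (interl_below lam) _ (fun mu =>
      Rsum_list (seq 1 n) (fun i => skew_weight q lam mu * pieri_coef q n mu i
         * f (upd_nth (i - 1) Z.pred mu)) + f mu * skew_weight q lam mu)).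
    2:{ intros mu _. rewrite Rmult_plus_distr_l, <- Rsum_scal. f_equal; [|ring].
        apply Rsum_ext. intros i _. ring. }
    rewrite (Rsum_ext B _ (fun nu =>
      Rsum_list (seq 1 n) (fun i => f nu * (pieri_coef q n (upd_nth (i - 1) Z.succ nu) i
         * skew_weight q lam (upd_nth (i - 1) Z.succ nu))) + f nu * skew_weight q lam nu)).
    2:{ intros mu _. rewrite Rmult_plus_distr_l, <- Rsum_scal. reflexivity. }
    rewrite !Rsum_plus. f_equal.
    + rewrite !(Rsum_swap _ (seq 1 n)). apply Rsum_ext. intros i Hi. apply in_seq in Hi.
      set (g := fun nu => f nu * (pieri_coef q n (upd_nth (i - 1) Z.succ nu) i
         * skew_weight q lam (upd_nth (i - 1) Z.succ nu))).
      transitivity (Rsum_list (map (upd_nth (i - 1) Z.pred) (interl_below lam)) g).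
      * rewrite Rsum_map. apply Rsum_ext. intros mu _. unfold g.
        rewrite (upd_nth_inv Z.succ Z.pred) by (intros; lia). ring.
      * apply Rsum_support; auto.
        -- apply NoDup_map_inj; [|apply NoDup_interl_below]. intros x y _ _ E.
           rewrite <- (upd_nth_inv Z.succ Z.pred (i - 1) x), E by (intros; lia).
           apply upd_nth_inv. intros; lia.
        -- intros nu Hnu _. apply HBi. unfold B0. rewrite !in_app_iff, !in_flat_map.
           right; left. exists i. split; auto. apply in_seq; lia.
        -- intros nu Hnu Hg. apply in_map_iff. exists (upd_nth (i - 1) Z.succ nu).
           split; [apply upd_nth_inv; intros; lia|]. apply (skew_weight_support q).
           ++ rewrite length_upd_nth, (HBl nu) by auto. lia.
           ++ intros E. apply Hg. unfold g. rewrite E. ring.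
    + apply Rsum_support; auto using NoDup_interl_below.
      * intros nu Hnu _. apply HBi. unfold B0. rewrite in_app_iff. auto.
      * intros nu Hnu Hg. apply (skew_weight_support q); [rewrite (HBl nu) by auto; lia|].
        intros E. apply Hg. rewrite E. ring.
  - rewrite (Rsum_ext B _ (fun nu => Rsum_list (seq 1 (S n)) (fun i =>
      pieri_coef q (S n) lam i * (skew_weight q (upd_nth (i - 1) Z.pred lam) nu * f nu)))).
    2:{ intros nu Hnu. rewrite (two_row_identity n lam nu) by auto. rewrite <- Rsum_scal.
        apply Rsum_ext. intros i _. ring. }
    rewrite Rsum_swap. apply Rsum_ext. intros i Hi. apply in_seq in Hi. rewrite Rsum_scal.
    destruct (Req_dec (pieri_coef q (S n) lam i) 0) as [E|E]; [rewrite E; ring|]. f_equal.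
    apply Rsum_support; auto using NoDup_interl_below.
    + intros nu Hnu Hg. apply (skew_weight_support q).
      * rewrite length_upd_nth, (HBl nu) by auto. lia.
      * intros E'. apply Hg. rewrite E'. ring.
    + intros nu Hnu _. apply HBi. unfold B0. rewrite !in_app_iff, !in_flat_map.
      right; right. exists i. split; auto. apply in_seq; lia.
Qed.

Lemma Cpowz_pred (z : C) (k : Z) : z <> C0 -> Cmul (Cinv z) (Cpowz z k) = Cpowz z (k - 1).
Proof.
  intros Hz.
  assert (Hnn : forall n : nat, Cpowz z (Z.of_nat n) = Cpow z n).
  { intros [|n]; [reflexivity|]. simpl Z.of_nat. cbn [Cpowz].
    rewrite SuccNat2Pos.id_succ. reflexivity. }
  assert (Hneg : forall n : nat, Cpowz z (- Z.of_nat n) = Cinv (Cpow z n)).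
  { intros [|n]; [simpl; apply Cinv_unique; ring|]. simpl Z.of_nat. cbn [Cpowz Z.opp].
    rewrite SuccNat2Pos.id_succ. reflexivity. }
  destruct (Z_le_gt_dec k 0) as [H|H].
  - replace k with (- Z.of_nat (Z.to_nat (- k)))%Z by lia.
    replace (- Z.of_nat (Z.to_nat (- k)) - 1)%Z with (- Z.of_nat (S (Z.to_nat (- k))))%Z by lia.
    rewrite !Hneg. simpl Cpow. rewrite Cinv_mul. reflexivity.
  - replace k with (Z.of_nat (S (Z.to_nat (k - 1)))) by lia.
    replace (Z.of_nat (S (Z.to_nat (k - 1))) - 1)%Z with (Z.of_nat (Z.to_nat (k - 1))) by lia.
    rewrite !Hnn. simpl Cpow.
    transitivity (Cmul (Cmul (Cinv z) z) (Cpow z (Z.to_nat (k - 1)))); [ring|].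
    rewrite Cinv_l by auto. ring.
Qed.

Lemma interl_signature (lam mu : list Z) : S (length mu) = length lam -> interlace lam mu -> signature mu.
Proof.
  intros Hl H i Hi. assert (H1 := H i ltac:(lia)). assert (H2 := H (S i) ltac:(lia)). lia.
Qed.

Lemma skew_pieri_C (n : nat) (lam : list Z) (F : list Z -> C) : length lam = S n -> signature lam ->
  Csum_list (interl_below lam) (fun mu => Cmul (RtoC (skew_weight q lam mu))
    (Cadd (Csum_list (seq 1 n) (fun i => Cmul (RtoC (pieri_coef q n mu i)) (F (upd_nth (i - 1) Z.pred mu))))
          (F mu)))
  = Csum_list (seq 1 (S n)) (fun i => Cmul (RtoC (pieri_coef q (S n) lam i))
      (Csum_list (interl_below (upd_nth (i - 1) Z.pred lam)) (fun mu =>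
        Cmul (RtoC (skew_weight q (upd_nth (i - 1) Z.pred lam) mu)) (F mu)))).
Proof.
  intros Hl Hsig.
  assert (Ef : forall (r : R) (z : C), fst (Cmul (RtoC r) z) = r * fst z) by (intros; simpl; ring).
  assert (Es : forall (r : R) (z : C), snd (Cmul (RtoC r) z) = r * snd z) by (intros; simpl; ring).
  assert (Af : forall z w : C, fst (Cadd z w) = fst z + fst w) by reflexivity.
  assert (As : forall z w : C, snd (Cadd z w) = snd z + snd w) by reflexivity.
  apply C_ext; rewrite ?Csum_fst, ?Csum_snd.
  - assert (H := skew_pieri n lam (fun mu => fst (F mu)) Hl Hsig).
    etransitivity; [|etransitivity; [exact H|]]; apply Rsum_ext; intros x _.
    + rewrite Ef, Af, Csum_fst. do 2 f_equal. apply Rsum_ext. intros; apply Ef.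
    + rewrite Ef, Csum_fst. f_equal. apply Rsum_ext. intros; symmetry; apply Ef.
  - assert (H := skew_pieri n lam (fun mu => snd (F mu)) Hl Hsig).
    etransitivity; [|etransitivity; [exact H|]]; apply Rsum_ext; intros x _.
    + rewrite Es, As, Csum_snd. do 2 f_equal. apply Rsum_ext. intros; apply Es.
    + rewrite Es, Csum_snd. f_equal. apply Rsum_ext. intros; symmetry; apply Es.
Qed.

Lemma pieri (n : nat) (lam : list Z) (x : list C) : length lam = n -> signature lam ->
  (forall i, (i < n)%nat -> nth i x C0 <> C0) ->
  Cmul (Csum_list (seq 1 n) (fun j => Cinv (nth (j - 1) x C0))) (Psym q lam x)
  = Csum_list (seq 1 n) (fun i => Cmul (RtoC (pieri_coef q n lam i))
                                      (Psym q (upd_nth (i - 1) Z.pred lam) x)).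
Proof.
  revert lam. induction n as [|n IH]; intros lam Hl Hsig Hx; [simpl; ring|].
  assert (Hne : lam <> []) by (destruct lam; discriminate || congruence).
  set (z := nth n x C0). assert (Hz : z <> C0) by (apply Hx; lia).
  (* One exponent serves both kinds of terms: multiplying z^(|lam| - |mu|) by 1/z gives |lam| - 1 -
     |mu|, and lowering a part of mu turns this back into |lam| - |mu|. *)
  set (F := fun mu => Cmul (Psym q mu x) (Cpowz z (sumZ lam - 1 - sumZ mu))).
  transitivity (Csum_list (interl_below lam) (fun mu => Cmul (RtoC (skew_weight q lam mu))
    (Cadd (Csum_list (seq 1 n) (fun i => Cmul (RtoC (pieri_coef q n mu i)) (F (upd_nth (i - 1) Z.pred mu))))
          (F mu)))).
  - rewrite (Psym_rec q n) by auto. rewrite <- Csum_scal. apply Csum_ext. intros mu Hmu.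
    apply in_interl_below in Hmu; auto. destruct Hmu as [Hm Hi].
    rewrite seq_S, Csum_app. simpl (Csum_list [(1 + n)%nat] _). rewrite Nat.sub_0_r. fold z.
    change (Pskew q lam mu z)
      with (Cmul (Cpowz z (sumZ lam - sumZ mu)) (RtoC (skew_weight q lam mu))).
    set (s := Csum_list (seq 1 n) (fun j => Cinv _)).
    transitivity (Cmul (RtoC (skew_weight q lam mu))
      (Cadd (Cmul (Cmul s (Psym q mu x)) (Cpowz z (sumZ lam - sumZ mu)))
            (Cmul (Psym q mu x) (Cmul (Cinv z) (Cpowz z (sumZ lam - sumZ mu)))))); [ring|].
    f_equal. unfold s. rewrite IH; auto; [|lia|apply (interl_signature lam); auto].
    rewrite Cpowz_pred by auto. f_equal.
    + match goal with |- Cmul ?A ?b = _ => replace (Cmul A b) with (Cmul b A) by ring end.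
      rewrite <- Csum_scal. apply Csum_ext. intros i Hii. apply in_seq in Hii. unfold F.
      rewrite sumZ_pred_nth by lia.
      replace (sumZ lam - 1 - (sumZ mu - 1))%Z with (sumZ lam - sumZ mu)%Z by lia. ring.
    + unfold F. replace (sumZ lam - 1 - sumZ mu)%Z with (sumZ lam - sumZ mu - 1)%Z by lia. reflexivity.
  - rewrite skew_pieri_C by auto. apply Csum_ext. intros i Hi. apply in_seq in Hi. f_equal.
    rewrite (Psym_rec q n) by (rewrite length_upd_nth; auto). apply Csum_ext. intros mu _.
    unfold F. fold z.
    change (Pskew q (upd_nth (i - 1) Z.pred lam) mu z)
      with (Cmul (Cpowz z (sumZ (upd_nth (i - 1) Z.pred lam) - sumZ mu))
                 (RtoC (skew_weight q (upd_nth (i - 1) Z.pred lam) mu))).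
    rewrite sumZ_pred_nth by lia. ring.
Qed.

End Pieri.

(** * Iterated integrals of bounded Lipschitz functions *)

Fixpoint ldist (l l' : list R) : R :=
  match l, l' with
  | x :: r, y :: r' => Rabs (x - y) + ldist r r'
  | _, _ => 0
  end.

Lemma ldist_pos (l l' : list R) : 0 <= ldist l l'.
Proof.
  revert l'. induction l as [|x l IH]; intros [|y l']; simpl; try lra.
  assert (H := IH l'). assert (H' := Rabs_pos (x - y)). lra.
Qed.

Lemma ldist_refl (l : list R) : ldist l l = 0.
Proof.
  induction l as [|x l IH]; simpl; [reflexivity|]. rewrite Rminus_diag, Rabs_R0, IH. lra.
Qed.

Lemma nth_ldist (l l' : list R) (i : nat) : length l = length l' ->
  Rabs (nth i l 0 - nth i l' 0) <= ldist l l'.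
Proof.
  revert l' i. induction l as [|x l IH]; intros [|y l'] i H; try discriminate H.
  - destruct i; simpl; rewrite Rminus_diag, Rabs_R0; lra.
  - simpl in H. destruct i; simpl.
    + assert (H' := ldist_pos l l'). lra.
    + assert (H' := IH l' i ltac:(lia)). assert (H'' := Rabs_pos (x - y)). lra.
Qed.

(* Bounded Lipschitz functions of [n] real variables form an algebra that is stable under
   integration of one variable, and iterated Riemann integrals of such functions exist. *)
Definition BL (n : nat) (F : list R -> C) : Prop :=
  exists K, 0 <= K /\ (forall l, length l = n -> Cmod (F l) <= K) /\
    (forall l l', length l = n -> length l' = n -> Cmod (Csub (F l) (F l')) <= K * ldist l l').

Lemma BL_ext (n : nat) (F G : list R -> C) :
  (forall l, length l = n -> F l = G l) -> BL n F -> BL n G.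
Proof.
  intros E [K [H0 [H1 H2]]]. exists K. split; auto. split.
  - intros l Hl. rewrite <- E by auto. auto.
  - intros l l' Hl Hl'. rewrite <- !E by auto. auto.
Qed.

Lemma BL_const (n : nat) (c : C) : BL n (fun _ => c).
Proof.
  exists (Cmod c). split; [apply Cmod_ge0|]. split; [intros; lra|]. intros l l' _ _.
  replace (Csub c c) with C0 by ring. rewrite Cmod_C0.
  apply Rmult_le_pos; [apply Cmod_ge0 | apply ldist_pos].
Qed.

Lemma BL_add (n : nat) (F G : list R -> C) : BL n F -> BL n G -> BL n (fun l => Cadd (F l) (G l)).
Proof.
  intros [K [H0 [H1 H2]]] [K' [H0' [H1' H2']]]. exists (K + K'). split; [lra|]. split.
  - intros l Hl. eapply Rle_trans; [apply Cmod_add|]. specialize (H1 l Hl). specialize (H1' l Hl). lra.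
  - intros l l' Hl Hl'.
    replace (Csub (Cadd (F l) (G l)) (Cadd (F l') (G l')))
      with (Cadd (Csub (F l) (F l')) (Csub (G l) (G l'))) by ring.
    eapply Rle_trans; [apply Cmod_add|]. specialize (H2 l l' Hl Hl'). specialize (H2' l l' Hl Hl'). lra.
Qed.

Lemma BL_mul (n : nat) (F G : list R -> C) : BL n F -> BL n G -> BL n (fun l => Cmul (F l) (G l)).
Proof.
  intros [K [H0 [H1 H2]]] [K' [H0' [H1' H2']]].
  assert (HKK : 0 <= K * K') by (apply Rmult_le_pos; auto).
  exists (2 * (K * K')). split; [lra|]. split.
  - intros l Hl. rewrite Cmod_mul. specialize (H1 l Hl). specialize (H1' l Hl).
    assert (P := Cmod_ge0 (F l)). assert (P' := Cmod_ge0 (G l)).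
    assert (Cmod (F l) * Cmod (G l) <= K * K') by (apply Rmult_le_compat; auto). lra.
  - intros l l' Hl Hl'.
    replace (Csub (Cmul (F l) (G l)) (Cmul (F l') (G l')))
      with (Cadd (Cmul (F l) (Csub (G l) (G l'))) (Cmul (Csub (F l) (F l')) (G l'))) by ring.
    eapply Rle_trans; [apply Cmod_add|]. rewrite !Cmod_mul.
    specialize (H2 l l' Hl Hl'). specialize (H2' l l' Hl Hl').
    assert (Cmod (F l) * Cmod (Csub (G l) (G l')) <= K * (K' * ldist l l'))
      by (apply Rmult_le_compat; auto using Cmod_ge0).
    assert (Cmod (Csub (F l) (F l')) * Cmod (G l') <= K * ldist l l' * K')
      by (apply Rmult_le_compat; auto using Cmod_ge0).
    lra.
Qed.

(** Restricting h to a set D containing the values is essential: inversion, exponential and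
    (x;q)_inf are used with bounds valid only on such a set. *)
Lemma BL_comp (n : nat) (F : list R -> C) (h : C -> C) (D : C -> Prop) (K : R) : 0 <= K ->
  (forall z, D z -> Cmod (h z) <= K) ->
  (forall z w, D z -> D w -> Cmod (Csub (h z) (h w)) <= K * Cmod (Csub z w)) ->
  (forall l, length l = n -> D (F l)) -> BL n F -> BL n (fun l => h (F l)).
Proof.
  intros HK Hb Hh HD [K' [H0 [H1 H2]]]. exists (K * K' + K).
  assert (HKK : 0 <= K * K') by (apply Rmult_le_pos; auto).
  split; [lra|]. split.
  - intros l Hl. specialize (Hb (F l) (HD l Hl)). lra.
  - intros l l' Hl Hl'. eapply Rle_trans; [apply Hh; auto|].
    assert (P := ldist_pos l l').
    assert (K * Cmod (Csub (F l) (F l')) <= K * (K' * ldist l l'))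
      by (apply Rmult_le_compat_l; auto).
    assert (0 <= K * ldist l l') by (apply Rmult_le_pos; auto). lra.
Qed.

Lemma BL_Csum {A : Type} (n : nat) (s : list A) (F : A -> list R -> C) :
  (forall x, In x s -> BL n (F x)) -> BL n (fun l => Csum_list s (fun x => F x l)).
Proof.
  induction s as [|x s IH]; intros H; simpl; [apply BL_const|].
  apply BL_add; [apply H; left; auto | apply IH; intros; apply H; right; auto].
Qed.

Lemma BL_Cprod (n : nat) (s : list nat) (F : nat -> list R -> C) :
  (forall x, In x s -> BL n (F x)) -> BL n (fun l => Cprod s (fun x => F x l)).
Proof.
  unfold Cprod. induction s as [|x s IH]; intros H; simpl; [apply BL_const|].
  apply BL_mul; [apply H; left; auto | apply IH; intros; apply H; right; auto].
Qed.

Lemma BL_Cinv (n : nat) (F : list R -> C) (c : R) : 0 < c ->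
  (forall l, length l = n -> c <= Cmod (F l)) -> BL n F -> BL n (fun l => Cinv (F l)).
Proof.
  intros Hc Hl HF.
  assert (Hne : forall z, c <= Cmod z -> z <> C0) by (intros z Hz ->; rewrite Cmod_C0 in Hz; lra).
  assert (Hi : forall z, c <= Cmod z -> Cmod (Cinv z) <= / c).
  { intros z Hz. rewrite Cmod_inv by auto. apply Rinv_le_contravar; auto. }
  assert (Hc' : 0 < / c) by (apply Rinv_0_lt_compat; auto).
  apply (BL_comp n F Cinv (fun z => c <= Cmod z) (/ c + / c * / c)); auto.
  - nra.
  - intros z Hz. specialize (Hi z Hz). nra.
  - intros z w Hz Hw.
    assert (Hz0 := Hne z Hz). assert (Hw0 := Hne w Hw).
    replace (Csub (Cinv z) (Cinv w)) with (Cmul (Cmul (Cinv z) (Cinv w)) (Csub w z)).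
    + rewrite !Cmod_mul, (Cmod_sub_sym w z). apply Rmult_le_compat_r; [apply Cmod_ge0|].
      assert (Cmod (Cinv z) * Cmod (Cinv w) <= / c * / c)
        by (apply Rmult_le_compat; auto using Cmod_ge0). lra.
    + transitivity (Csub (Cmul (Cinv z) (Cmul (Cinv w) w)) (Cmul (Cinv w) (Cmul (Cinv z) z))); [ring|].
      rewrite !Cinv_l by auto. ring.
Qed.

Lemma BL_cons (n : nat) (F : list R -> C) (x : R) : BL (S n) F -> BL n (fun l => F (x :: l)).
Proof.
  intros [K [H0 [H1 H2]]]. exists K. split; auto. split.
  - intros l Hl. apply H1. simpl; auto.
  - intros l l' Hl Hl'. eapply Rle_trans; [apply H2; simpl; auto|].
    simpl. rewrite Rminus_diag, Rabs_R0, Rplus_0_l. lra.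
Qed.

Lemma mvt_bound (f f' : R -> R) (x y M : R) : (forall z, is_derive f z (f' z)) ->
  (forall z, Rmin x y <= z <= Rmax x y -> Rabs (f' z) <= M) -> Rabs (f y - f x) <= M * Rabs (y - x).
Proof.
  intros Hd Hb. destruct (MVT_gen f x y f') as [c [Hc E]].
  - intros z _. apply Hd.
  - intros z _. apply derivable_continuous_pt. exists (f' z). apply is_derive_Reals, Hd.
  - rewrite E, Rabs_mult. apply Rmult_le_compat_r; [apply Rabs_pos | auto].
Qed.

Lemma is_derive_cos' (x : R) : is_derive cos x (- sin x).
Proof. apply is_derive_Reals, derivable_pt_lim_cos. Qed.

Lemma is_derive_sin' (x : R) : is_derive sin x (cos x).
Proof. apply is_derive_Reals, derivable_pt_lim_sin. Qed.

Lemma cos_lipschitz (x y : R) : Rabs (cos y - cos x) <= Rabs (y - x).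
Proof.
  rewrite <- (Rmult_1_l (Rabs (y - x))). apply mvt_bound with (f' := fun z => - sin z).
  - apply is_derive_cos'.
  - intros z _. rewrite Rabs_Ropp. apply Rabs_le. apply SIN_bound.
Qed.

Lemma sin_lipschitz (x y : R) : Rabs (sin y - sin x) <= Rabs (y - x).
Proof.
  rewrite <- (Rmult_1_l (Rabs (y - x))). apply mvt_bound with (f' := cos).
  - apply is_derive_sin'.
  - intros z _. apply Rabs_le. apply COS_bound.
Qed.

Lemma Cmod_eith (x : R) : Cmod (eith x) = 1.
Proof.
  assert (H := Cmod_sqr (eith x)). assert (H' := Cmod_ge0 (eith x)).
  assert (H'' := sin2_cos2 x). unfold eith, Rsqr in *. simpl in *. nra.
Qed.

Lemma nth_eith (l : list R) (i : nat) : (i < length l)%nat ->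
  nth i (map eith l) C0 = eith (nth i l 0).
Proof.
  intros Hl. rewrite (nth_indep _ C0 (eith 0)) by (rewrite length_map; auto). apply map_nth.
Qed.

Lemma BL_coord (n i : nat) : BL n (fun l => nth i (map eith l) C0).
Proof.
  destruct (Nat.lt_ge_cases i n) as [Hi|Hi].
  - exists 2. split; [lra|]. split.
    + intros l Hl. rewrite nth_eith, Cmod_eith by lia. lra.
    + intros l l' Hl Hl'. rewrite !nth_eith by lia. eapply Rle_trans; [apply Cmod_le_abs|]. unfold eith; simpl.
      assert (H1 := cos_lipschitz (nth i l' 0) (nth i l 0)).
      assert (H2 := sin_lipschitz (nth i l' 0) (nth i l 0)).
      assert (H3 := nth_ldist l l' i ltac:(lia)). lra.
  - apply (BL_ext n (fun _ => C0)); [|apply BL_const].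
    intros l Hl. rewrite nth_overflow; auto. rewrite length_map. lia.
Qed.

Definition Lip (f : R -> C) : Prop := exists K, forall x y, Cmod (Csub (f x) (f y)) <= K * Rabs (x - y).

Lemma lipschitz_ex_RInt (f : R -> R) (K a b : R) :
  (forall x y, Rabs (f x - f y) <= K * Rabs (x - y)) -> ex_RInt f a b.
Proof.
  intros H. apply (@ex_RInt_continuous R_CompleteNormedModule). intros z _.
  apply continuity_pt_filterlim. intros eps He.
  assert (HK : 0 < Rabs K + 1) by (assert (HK := Rabs_pos K); lra).
  exists (eps / (Rabs K + 1)). split; [apply Rdiv_lt_0_compat; auto|].
  intros y [_ Hy]. simpl in *. unfold R_dist, Rdist in *.
  eapply Rle_lt_trans; [apply H|].
  apply Rle_lt_trans with ((Rabs K + 1) * Rabs (y - z)).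
  - apply Rmult_le_compat_r; [apply Rabs_pos|]. assert (H' := Rle_abs K). lra.
  - apply Rlt_le_trans with ((Rabs K + 1) * (eps / (Rabs K + 1))).
    + apply Rmult_lt_compat_l; auto.
    + right. field. lra.
Qed.

Lemma Lip_fst (f : R -> C) (a b : R) : Lip f -> ex_RInt (fun x => fst (f x)) a b.
Proof.
  intros [K H]. apply (lipschitz_ex_RInt _ K). intros x y.
  eapply Rle_trans; [|apply H]. apply (fst_le_Cmod (Csub (f x) (f y))).
Qed.

Lemma Lip_snd (f : R -> C) (a b : R) : Lip f -> ex_RInt (fun x => snd (f x)) a b.
Proof.
  intros [K H]. apply (lipschitz_ex_RInt _ K). intros x y.
  eapply Rle_trans; [|apply H]. apply (snd_le_Cmod (Csub (f x) (f y))).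
Qed.

(** Identifies the [epsilon]-defined integral with the actual one as soon as the function is
    integrable. *)
Lemma RInt_is_RInt (f : R -> R) (a b : R) : ex_RInt f a b -> is_RInt f a b (Defs.RInt f a b).
Proof.
  intros H. assert (pr := ex_RInt_Reals_0 f a b H).
  assert (E : exists pr : Riemann_integrable f a b, RiemannInt pr = Defs.RInt f a b).
  { unfold Defs.RInt. apply epsilon_spec. exists (RiemannInt pr), pr. reflexivity. }
  destruct E as [pr' E]. rewrite <- E. apply ex_RInt_Reals_aux_1.
Qed.

Lemma RInt_eq (f : R -> R) (a b v : R) : is_RInt f a b v -> Defs.RInt f a b = v.
Proof.
  intros H. assert (H' := RInt_is_RInt f a b (ex_intro _ v H)).
  rewrite <- (is_RInt_unique (V := R_CompleteNormedModule) _ _ _ _ H).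
  symmetry. apply (is_RInt_unique (V := R_CompleteNormedModule)); auto.
Qed.

Lemma CInt_linear (f g : R -> C) (c : C) (a b : R) : Lip f -> Lip g ->
  CInt (fun x => Cadd (f x) (Cmul c (g x))) a b = Cadd (CInt f a b) (Cmul c (CInt g a b)).
Proof.
  intros Hf Hg. unfold CInt.
  assert (F1 := RInt_is_RInt _ _ _ (Lip_fst f a b Hf)). assert (F2 := RInt_is_RInt _ _ _ (Lip_snd f a b Hf)).
  assert (G1 := RInt_is_RInt _ _ _ (Lip_fst g a b Hg)). assert (G2 := RInt_is_RInt _ _ _ (Lip_snd g a b Hg)).
  apply C_ext; simpl; apply RInt_eq.
  - apply (is_RInt_plus (V := R_NormedModule)); auto.
    apply (is_RInt_minus (V := R_NormedModule)); apply (is_RInt_scal (V := R_NormedModule)); auto.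
  - apply (is_RInt_plus (V := R_NormedModule)); auto.
    apply (is_RInt_plus (V := R_NormedModule)); apply (is_RInt_scal (V := R_NormedModule)); auto.
Qed.

Lemma RInt_bound (f : R -> R) (a b M : R) : a <= b -> ex_RInt f a b ->
  (forall x, Rabs (f x) <= M) -> Rabs (Defs.RInt f a b) <= (b - a) * M.
Proof.
  intros Hab Hf HM.
  apply (norm_RInt_le_const (V := R_NormedModule) f a b _ M); auto.
  apply RInt_is_RInt; auto.
Qed.

(** The constant is 4 pi and not 2 pi because the real and the imaginary part are bounded
    separately; only its finiteness matters. *)
Lemma CInt_bound (f : R -> C) (M : R) : Lip f -> (forall x, Cmod (f x) <= M) ->
  Cmod (CInt f 0 (2 * PI)) <= (4 * PI) * M.
Proof.
  intros Hf HM. assert (Hpi := PI_RGT_0).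
  assert (H1 := RInt_bound (fun x => fst (f x)) 0 (2 * PI) M ltac:(lra) (Lip_fst f _ _ Hf)
    (fun x => Rle_trans _ _ _ (fst_le_Cmod (f x)) (HM x))).
  assert (H2 := RInt_bound (fun x => snd (f x)) 0 (2 * PI) M ltac:(lra) (Lip_snd f _ _ Hf)
    (fun x => Rle_trans _ _ _ (snd_le_Cmod (f x)) (HM x))).
  eapply Rle_trans; [apply Cmod_le_abs|]. unfold CInt; simpl. lra.
Qed.

Lemma torus_int_ext (n : nat) (F G : list R -> C) : (forall l, length l = n -> F l = G l) ->
  torus_int n F = torus_int n G.
Proof.
  revert F G. induction n as [|n IH]; intros F G H; simpl; [apply H; auto|].
  f_equal. apply functional_extensionality. intros x. apply IH. intros l Hl. apply H. simpl; auto.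
Qed.

(** Both claims go through one induction: the outer integral exists because the inner one is
    Lipschitz in the outer variable, and this uses linearity (to integrate a difference) together
    with the bound in dimension n. *)
Lemma torus_int_props (n : nat) :
  (forall F G c, BL n F -> BL n G ->
     torus_int n (fun l => Cadd (F l) (Cmul c (G l)))
     = Cadd (torus_int n F) (Cmul c (torus_int n G))) /\
  (forall F M, BL n F -> (forall l, length l = n -> Cmod (F l) <= M) ->
     Cmod (torus_int n F) <= (4 * PI) ^ n * M).
Proof.
  assert (Hpi := PI_RGT_0).
  induction n as [|n [IH1 IH2]].
  - split; [reflexivity|]. intros F M _ H. simpl. rewrite Rmult_1_l. apply H; auto.
  - assert (HL : forall F, BL (S n) F -> Lip (fun x => torus_int n (fun l => F (x :: l)))).
    { intros F HF. assert (HF' := HF). destruct HF' as [K [H0 [H1 H2]]]. exists ((4 * PI) ^ n * K). intros x y.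
      assert (E : Csub (torus_int n (fun l => F (x :: l))) (torus_int n (fun l => F (y :: l)))
        = torus_int n (fun l => Cadd (F (x :: l)) (Cmul (Csub C0 C1) (F (y :: l))))).
      { rewrite (IH1 (fun l => F (x :: l)) (fun l => F (y :: l))) by (apply BL_cons; auto). ring. }
      rewrite E. rewrite Rmult_assoc. apply IH2.
      - apply BL_add; [apply BL_cons; auto|].
        apply (BL_mul n (fun _ => Csub C0 C1)); [apply BL_const | apply BL_cons; auto].
      - intros l Hl.
        replace (Cadd (F (x :: l)) (Cmul (Csub C0 C1) (F (y :: l))))
          with (Csub (F (x :: l)) (F (y :: l))) by ring.
        eapply Rle_trans; [apply H2; simpl; auto|]. simpl. rewrite ldist_refl. lra. }
    split.
    + intros F G c HF HG. simpl. rewrite <- CInt_linear by auto. f_equal.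
      apply functional_extensionality. intros x.
      apply (IH1 (fun l => F (x :: l)) (fun l => G (x :: l))); apply BL_cons; auto.
    + intros F M HF HM. simpl.
      replace (4 * PI * (4 * PI) ^ n * M) with (4 * PI * ((4 * PI) ^ n * M)) by ring.
      apply CInt_bound; auto. intros x. apply IH2; [apply BL_cons; auto|].
      intros l Hl. apply HM. simpl; auto.
Qed.

Lemma torus_int_linear (n : nat) (F G : list R -> C) (c : C) : BL n F -> BL n G ->
  torus_int n (fun l => Cadd (F l) (Cmul c (G l))) = Cadd (torus_int n F) (Cmul c (torus_int n G)).
Proof. apply torus_int_props. Qed.

Lemma torus_int_bound (n : nat) (F : list R -> C) (M : R) : BL n F ->
  (forall l, length l = n -> Cmod (F l) <= M) -> Cmod (torus_int n F) <= (4 * PI) ^ n * M.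
Proof. apply torus_int_props. Qed.

Lemma torus_int_C0 (n : nat) : torus_int n (fun _ => C0) = C0.
Proof.
  assert (H := torus_int_linear n (fun _ => C0) (fun _ => C0) (Csub C0 C1) (BL_const n C0) (BL_const n C0)).
  cbv beta in H.
  rewrite (torus_int_ext n (fun _ => Cadd C0 (Cmul (Csub C0 C1) C0)) (fun _ => C0)) in H.
  - rewrite H. ring.
  - intros; ring.
Qed.

Lemma torus_int_sum {A : Type} (n : nat) (s : list A) (c : A -> C) (F : A -> list R -> C) :
  (forall x, In x s -> BL n (F x)) ->
  torus_int n (fun l => Csum_list s (fun x => Cmul (c x) (F x l)))
  = Csum_list s (fun x => Cmul (c x) (torus_int n (F x))).
Proof.
  induction s as [|x s IH]; intros H; simpl; [apply torus_int_C0|].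
  rewrite (torus_int_ext n _ (fun l => Cadd (Csum_list s (fun x => Cmul (c x) (F x l))) (Cmul (c x) (F x l)))).
  - rewrite (torus_int_linear n (fun l => Csum_list s (fun x => Cmul (c x) (F x l)))).
    + rewrite IH; [|intros; apply H; right; auto]. ring.
    + apply BL_Csum. intros y Hy. apply BL_mul; [apply BL_const | apply H; right; auto].
    + apply H; left; auto.
  - intros l _. ring.
Qed.

(** * Taylor estimates for the complex exponential and differentiation under the integral *)

Lemma Cexp_add (z w : C) : Cexp (Cadd z w) = Cmul (Cexp z) (Cexp w).
Proof.
  apply C_ext; unfold Cexp, Cadd, Cmul; simpl; rewrite exp_plus, ?cos_plus, ?sin_plus; ring.
Qed.

Lemma Cexp_C0 : Cexp C0 = C1.
Proof. unfold Cexp, C0, C1; simpl. rewrite exp_0, cos_0, sin_0. f_equal; ring. Qed.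

Lemma Cmod_Cexp (z : C) : Cmod (Cexp z) = exp (fst z).
Proof.
  assert (H := Cmod_sqr (Cexp z)). assert (H' := Cmod_ge0 (Cexp z)).
  assert (H'' := sin2_cos2 (snd z)). assert (He := exp_pos (fst z)).
  unfold Cexp, Rsqr in *. simpl in *.
  set (E := exp (fst z)) in *. set (c := cos (snd z)) in *. set (s := sin (snd z)) in *.
  assert (E2 : E * c * (E * c) + E * s * (E * s) = E * E * (s * s + c * c)) by ring.
  rewrite E2, H'' in H. nra.
Qed.

Lemma exp_le (x y : R) : x <= y -> exp x <= exp y.
Proof. intros [H| ->]; [left; apply exp_increasing; auto | lra]. Qed.

Lemma Cmod_Cexp_le (z : C) : Cmod (Cexp z) <= exp (Cmod z).
Proof.
  rewrite Cmod_Cexp. apply exp_le. eapply Rle_trans; [apply Rle_abs | apply fst_le_Cmod].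
Qed.

Lemma exp_sub_1_bounds (x B : R) : Rabs x <= B ->
  Rabs (exp x - 1) <= Rabs x * exp B /\ Rabs (exp x - 1 - x) <= x * x * exp B.
Proof.
  intros Hx. assert (H1 := exp_ge_1 x). assert (H2 := exp_ge_1 (- x)). assert (H3 := exp_pos x).
  assert (H4 : exp x * exp (- x) = 1) by (rewrite <- exp_plus, Rplus_opp_r; apply exp_0).
  assert (H5 : exp x - 1 <= x * exp x) by nra.
  assert (HB : 1 <= exp B).
  { rewrite <- exp_0. apply exp_le. assert (H := Rabs_pos x). lra. }
  assert (HxB : exp x <= exp B).
  { apply exp_le. assert (H := Rle_abs x). lra. }
  destruct (Rle_dec 0 x) as [H0|H0].
  - rewrite (Rabs_pos_eq x) by auto. rewrite !Rabs_pos_eq by lra. split; nra.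
  - rewrite (Rabs_left x) by lra. rewrite (Rabs_pos_eq (exp x - 1 - x)) by lra.
    assert (H6 : exp x <= 1) by (rewrite <- exp_0; apply exp_le; lra).
    split; [rewrite Rabs_left1 by lra; nra|].
    assert (exp x - 1 - x <= x * x) by nra. nra.
Qed.

Lemma cos_sub_1_bound (y : R) : Rabs (cos y - 1) <= y * y / 2.
Proof.
  replace y with (2 * (y / 2)) at 1 by field. rewrite cos_2a_sin.
  assert (H := sin_lipschitz 0 (y / 2)). rewrite sin_0, !Rminus_0_r in H.
  assert (H' : sin (y / 2) * sin (y / 2) <= y / 2 * (y / 2)) by (apply Rsqr_le_abs_1; auto).
  assert (H2 : 0 <= sin (y / 2) * sin (y / 2)) by nra.
  rewrite Rabs_left1 by lra. lra.
Qed.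

Lemma sin_sub_id_bound (y : R) : Rabs (sin y - y) <= y * y.
Proof.
  assert (H : Rabs ((sin y - y) - (sin 0 - 0)) <= Rabs y * Rabs (y - 0)).
  { apply (mvt_bound (fun z => sin z - z) (fun z => cos z - 1)).
    - intros z. apply is_derive_Reals. apply (derivable_pt_lim_minus sin id).
      + apply derivable_pt_lim_sin.
      + apply derivable_pt_lim_id.
    - intros z Hz. assert (Hc := cos_lipschitz 0 z). rewrite cos_0, Rminus_0_r in Hc.
      eapply Rle_trans; [exact Hc|]. unfold Rmin, Rmax in Hz.
      destruct (Rle_dec 0 y); [rewrite !Rabs_pos_eq | rewrite !Rabs_left1]; lra. }
  rewrite sin_0, !Rminus_0_r in H. rewrite <- Rabs_mult in H. rewrite (Rabs_pos_eq (y * y)) in H by nra.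
  exact H.
Qed.

(** Taylor remainder of order two, uniform on discs. It yields both the Lipschitz bound for the
    exponential and the derivative of the torus integral. *)
Lemma Cexp_second_order (v : C) (B : R) : Cmod v <= B ->
  Cmod (Csub (Csub (Cexp v) C1) v) <= 2 * exp B * (Cmod v * Cmod v).
Proof.
  intros Hv. rewrite Cmod_sqr. destruct v as [x y].
  assert (Hx : Rabs x <= B) by (eapply Rle_trans; [apply (fst_le_Cmod (x, y)) | auto]).
  eapply Rle_trans; [apply Cmod_le_abs|]. unfold Csub, Cexp, C1; simpl.
  destruct (exp_sub_1_bounds x B Hx) as [E1 E2].
  assert (C1' := cos_sub_1_bound y). assert (S1 := sin_sub_id_bound y).
  assert (Sy := sin_lipschitz 0 y). rewrite sin_0, !Rminus_0_r in Sy.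
  assert (HB1 : 1 + B <= exp B) by apply exp_ge_1.
  assert (Hx0 := Rabs_pos x). assert (Hy0 := Rabs_pos y).
  assert (HxB : Rabs (1 + x) <= exp B).
  { eapply Rle_trans; [apply Rabs_triang|]. rewrite Rabs_R1. lra. }
  assert (T1 : Rabs (exp x * cos y - 1 - x) <= x * x * exp B + exp B * (y * y / 2)).
  { replace (exp x * cos y - 1 - x) with ((exp x - 1 - x) * cos y + (1 + x) * (cos y - 1)) by ring.
    eapply Rle_trans; [apply Rabs_triang|]. rewrite !Rabs_mult. apply Rplus_le_compat.
    - rewrite <- (Rmult_1_r (x * x * exp B)). apply Rmult_le_compat; auto using Rabs_pos.
      apply Rabs_le, COS_bound.
    - apply Rmult_le_compat; auto using Rabs_pos. }
  assert (T2 : Rabs (exp x * sin y - 0 - y) <= Rabs x * exp B * Rabs y + y * y).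
  { replace (exp x * sin y - 0 - y) with ((exp x - 1) * sin y + (sin y - y)) by ring.
    eapply Rle_trans; [apply Rabs_triang|]. rewrite Rabs_mult. apply Rplus_le_compat; auto.
    apply Rmult_le_compat; auto using Rabs_pos. }
  eapply Rle_trans; [apply Rplus_le_compat; [exact T1 | exact T2]|].
  assert (Hxx : x * x = Rabs x * Rabs x) by (rewrite <- Rabs_mult, Rabs_pos_eq; nra).
  assert (Hyy : y * y = Rabs y * Rabs y) by (rewrite <- Rabs_mult, Rabs_pos_eq; nra).
  assert (HB : 1 <= exp B) by lra.
  rewrite Hxx, Hyy. set (X := Rabs x) in *. set (Y := Rabs y) in *. set (E := exp B) in *.
  assert (0 <= (E - 1) * (Y * Y)) by (apply Rmult_le_pos; [lra | apply Rle_0_sqr]).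
  assert (0 <= E * ((X - Y) * (X - Y))) by (apply Rmult_le_pos; [lra | apply Rle_0_sqr]).
  assert (0 <= E * (X * X)) by (apply Rmult_le_pos; [lra | apply Rle_0_sqr]).
  nra.
Qed.

Lemma BL_Cexp (n : nat) (F : list R -> C) : BL n F -> BL n (fun l => Cexp (F l)).
Proof.
  intros HF. assert (HF' := HF). destruct HF' as [B [HB [Hb _]]].
  (* From exp z - exp w = exp w (exp v - 1) with v = z - w and |v| <= 2 B, by the second-order
     estimate. *)
  set (K := exp B * (1 + 2 * exp (2 * B) * (2 * B))).
  assert (P1 := exp_pos B). assert (P2 := exp_pos (2 * B)).
  assert (P3 : 0 <= 2 * exp (2 * B) * (2 * B)) by (apply Rmult_le_pos; lra).
  apply (BL_comp n F Cexp (fun z => Cmod z <= B) K); auto.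
  - unfold K. apply Rmult_le_pos; lra.
  - intros z Hz. eapply Rle_trans; [apply Cmod_Cexp_le|].
    eapply Rle_trans; [apply exp_le, Hz|]. unfold K. nra.
  - intros z w Hz Hw. set (v := Csub z w).
    assert (Hv : Cmod v <= 2 * B) by (eapply Rle_trans; [apply Cmod_sub | lra]).
    replace (Csub (Cexp z) (Cexp w)) with (Cmul (Cexp w) (Cadd (Csub (Csub (Cexp v) C1) v) v)).
    + rewrite Cmod_mul. unfold K. rewrite Rmult_assoc.
      apply Rmult_le_compat; auto using Cmod_ge0.
      * eapply Rle_trans; [apply Cmod_Cexp_le | apply exp_le; auto].
      * eapply Rle_trans; [apply Cmod_add|].
        assert (H := Cexp_second_order v (2 * B) Hv). assert (H' := Cmod_ge0 v).
        assert (2 * exp (2 * B) * (Cmod v * Cmod v) <= 2 * exp (2 * B) * (2 * B * Cmod v)).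
        { apply Rmult_le_compat_l; [lra|]. apply Rmult_le_compat_r; auto. }
        lra.
    + replace z with (Cadd w v) by (unfold v; ring). rewrite Cexp_add. ring.
Qed.

Definition Cderiv (f : R -> C) (t : R) (l : C) : Prop :=
  derivable_pt_lim (fun s => fst (f s)) t (fst l) /\ derivable_pt_lim (fun s => snd (f s)) t (snd l).

Lemma derivable_second_order (f : R -> R) (t l M : R) : 0 <= M ->
  (forall h, Rabs h <= 1 -> Rabs (f (t + h) - f t - h * l) <= M * (h * h)) -> derivable_pt_lim f t l.
Proof.
  intros HM H eps He.
  (* M + 1 instead of M because M may be 0. *)
  assert (Hd : 0 < Rmin 1 (eps / (M + 1))).
  { apply Rmin_glb_lt; [lra|]. apply Rdiv_lt_0_compat; lra. }
  exists (mkposreal _ Hd). intros h Hh Hhd. simpl in Hhd.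
  assert (H1 : Rabs h < 1) by (eapply Rlt_le_trans; [exact Hhd | apply Rmin_l]).
  assert (H2 : Rabs h < eps / (M + 1)) by (eapply Rlt_le_trans; [exact Hhd | apply Rmin_r]).
  specialize (H h ltac:(lra)).
  replace ((f (t + h) - f t) / h - l) with ((f (t + h) - f t - h * l) / h) by (field; auto).
  unfold Rdiv. rewrite Rabs_mult, Rabs_inv.
  assert (Hh0 : 0 < Rabs h) by (apply Rabs_pos_lt; auto).
  assert (Ehh : h * h = Rabs h * Rabs h) by (rewrite <- Rabs_mult, Rabs_pos_eq; nra).
  rewrite Ehh in H.
  apply Rle_lt_trans with (M * Rabs h).
  - apply (Rmult_le_reg_r (Rabs h)); auto. rewrite Rmult_assoc, Rinv_l, Rmult_1_r by lra. lra.
  - apply Rle_lt_trans with ((M + 1) * Rabs h); [nra|].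
    apply Rlt_le_trans with ((M + 1) * (eps / (M + 1))).
    + apply Rmult_lt_compat_l; lra.
    + right. field. lra.
Qed.

(** By linearity the error of the first-order expansion is the integral of G e^(wt) (e^(wh) - 1 -
    wh), which is O(h^2) uniformly in the angles. *)
Lemma torus_int_deriv (n : nat) (G w : list R -> C) (t : R) : BL n G -> BL n w ->
  Cderiv (fun s => torus_int n (fun l => Cmul (G l) (Cexp (Cmul (w l) (RtoC s))))) t
    (torus_int n (fun l => Cmul (Cmul (w l) (G l)) (Cexp (Cmul (w l) (RtoC t))))).
Proof.
  intros HG Hw. set (I := fun s => torus_int n _). set (I' := torus_int n _).
  assert (HE : forall s, BL n (fun l => Cexp (Cmul (w l) (RtoC s)))).
  { intros s. apply BL_Cexp. apply BL_mul; [auto | apply BL_const]. }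
  assert (HGE : forall s, BL n (fun l => Cmul (G l) (Cexp (Cmul (w l) (RtoC s))))).
  { intros s. apply BL_mul; auto. }
  assert (HwGE : BL n (fun l => Cmul (Cmul (w l) (G l)) (Cexp (Cmul (w l) (RtoC t))))).
  { apply BL_mul; auto. apply BL_mul; auto. }
  destruct (HGE t) as [A [HA [HA1 _]]]. assert (Hw' := Hw). destruct Hw' as [B [HB [HB1 _]]].
  (* A bounds G e^(wt) and B bounds w, so |wh| <= B for |h| <= 1; the power of 4 pi comes from
     [torus_int_bound]. *)
  set (M := (4 * PI) ^ n * (A * (2 * exp B * (B * B)))).
  assert (Hpi := PI_RGT_0).
  assert (HM : 0 <= M).
  { unfold M. apply Rmult_le_pos; [apply pow_le; lra|]. apply Rmult_le_pos; auto.
    assert (P := exp_pos B). apply Rmult_le_pos; nra. }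
  assert (Hmain : forall h, Rabs h <= 1 ->
    Cmod (Csub (Csub (I (t + h)) (I t)) (Cmul (RtoC h) I')) <= M * (h * h)).
  { intros h Hh.
    assert (E : Csub (Csub (I (t + h)) (I t)) (Cmul (RtoC h) I')
      = torus_int n (fun l => Cadd (Cadd (Cmul (G l) (Cexp (Cmul (w l) (RtoC (t + h)))))
           (Cmul (Csub C0 C1) (Cmul (G l) (Cexp (Cmul (w l) (RtoC t))))))
           (Cmul (Csub C0 (RtoC h)) (Cmul (Cmul (w l) (G l)) (Cexp (Cmul (w l) (RtoC t))))))).
    { rewrite (torus_int_linear n (fun l => Cadd (Cmul (G l) (Cexp (Cmul (w l) (RtoC (t + h)))))
           (Cmul (Csub C0 C1) (Cmul (G l) (Cexp (Cmul (w l) (RtoC t))))))); auto.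
      - rewrite (torus_int_linear n (fun l => Cmul (G l) (Cexp (Cmul (w l) (RtoC (t + h)))))); auto.
        unfold I, I'. ring.
      - apply BL_add; auto. apply BL_mul; auto. apply BL_const. }
    rewrite E. unfold M. rewrite Rmult_assoc. apply torus_int_bound.
    - repeat apply BL_add; auto; apply BL_mul; auto; apply BL_const.
    - intros l Hl. set (v := Cmul (w l) (RtoC h)).
      rewrite RtoC_add.
      replace (Cmul (w l) (Cadd (RtoC t) (RtoC h))) with (Cadd (Cmul (w l) (RtoC t)) v)
        by (unfold v; ring).
      rewrite Cexp_add. set (e := Cexp (Cmul (w l) (RtoC t))).
      replace (Cadd (Cadd (Cmul (G l) (Cmul e (Cexp v))) (Cmul (Csub C0 C1) (Cmul (G l) e)))
                    (Cmul (Csub C0 (RtoC h)) (Cmul (Cmul (w l) (G l)) e)))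
        with (Cmul (Cmul (G l) e) (Csub (Csub (Cexp v) C1) v)) by (unfold v; ring).
      assert (Hv : Cmod v = Cmod (w l) * Rabs h) by (unfold v; rewrite Cmod_mul, Cmod_RtoC; reflexivity).
      assert (Hwl := HB1 l Hl). assert (Hwp := Cmod_ge0 (w l)). assert (Hhp := Rabs_pos h).
      assert (Hvb : Cmod v <= B) by (rewrite Hv; nra).
      rewrite Cmod_mul. rewrite (Rmult_assoc A). apply Rmult_le_compat; auto using Cmod_ge0.
      eapply Rle_trans; [apply (Cexp_second_order v B Hvb)|].
      assert (P := exp_pos B).
      replace (2 * exp B * (B * B) * (h * h)) with (2 * exp B * (B * B * (h * h))) by ring.
      apply Rmult_le_compat_l; [lra|].
      assert (Ehh : h * h = Rabs h * Rabs h) by (rewrite <- Rabs_mult, Rabs_pos_eq; nra).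
      rewrite Ehh, Hv.
      replace (Cmod (w l) * Rabs h * (Cmod (w l) * Rabs h))
        with (Cmod (w l) * Cmod (w l) * (Rabs h * Rabs h)) by ring.
      apply Rmult_le_compat_r; nra. }
  split; apply (derivable_second_order _ _ _ M HM); intros h Hh;
    (eapply Rle_trans; [|apply (Hmain h Hh)]).
  - eapply Rle_trans; [|apply fst_le_Cmod]. right. f_equal. simpl. ring.
  - eapply Rle_trans; [|apply snd_le_Cmod]. right. f_equal. simpl. ring.
Qed.

(** * The q-Whittaker process *)

Lemma Cprod_Cexp (s : list nat) (f : nat -> C) (t : R) :
  Cprod s (fun j => Cexp (Cmul (f j) (RtoC t))) = Cexp (Cmul (Csum_list s f) (RtoC t)).
Proof.
  unfold Cprod, Csum_list. induction s as [|x s IH]; simpl.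
  - replace (Cmul C0 (RtoC t)) with C0 by ring. rewrite Cexp_C0. reflexivity.
  - rewrite IH, <- Cexp_add. f_equal. ring.
Qed.

(** The factor of Pi that does not depend on t. *)
Definition Pi_alpha (q : R) (N : nat) (alpha : list R) (z : list C) : C :=
  fold_right (fun ai acc =>
    Cmul (Cprod (range 1 N) (fun j => Cinv (qpoch_inf q (Cdiv (RtoC ai) (nth (j - 1) z C0))))) acc)
    C1 alpha.

Lemma PiC_split (q : R) (N : nat) (alpha : list R) (z : list C) (t : R) : length z = N ->
  PiC q z alpha t = Cmul (Pi_alpha q N alpha z)
    (Cexp (Cmul (Csum_list (seq 1 N) (fun j => nth (j - 1) z C0)) (RtoC t))).
Proof.
  intros Hz. unfold PiC. rewrite Hz. unfold Pi_alpha. f_equal. rewrite range1. apply Cprod_Cexp.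
Qed.

Lemma Cmod_coord (l : list R) (i : nat) : (i < length l)%nat -> Cmod (nth i (map eith l) C0) = 1.
Proof. intros Hl. rewrite nth_eith by auto. apply Cmod_eith. Qed.

Lemma Cmod1_neq_C0 (z : C) : Cmod z = 1 -> z <> C0.
Proof. intros H ->. rewrite Cmod_C0 in H. lra. Qed.

Lemma Cmod_Cpow1 (z : C) (n : nat) : Cmod z = 1 -> Cmod (Cpow z n) = 1.
Proof.
  intros H. induction n as [|n IH]; simpl; [apply Cmod_C1|]. rewrite Cmod_mul, H, IH. lra.
Qed.

Lemma Cmod_Cinv1 (z : C) : Cmod z = 1 -> Cmod (Cinv z) = 1.
Proof. intros H. rewrite Cmod_inv, H by (apply Cmod1_neq_C0; auto). apply Rinv_1. Qed.

Lemma BL_Cinv1 (n : nat) (F : list R -> C) : (forall l, length l = n -> Cmod (F l) = 1) ->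
  BL n F -> BL n (fun l => Cinv (F l)).
Proof.
  intros H HF. apply (BL_Cinv n F 1); auto; [lra|]. intros l Hl. rewrite H by auto. lra.
Qed.

Lemma BL_Cpowz (n : nat) (F : list R -> C) (k : Z) : (forall l, length l = n -> Cmod (F l) = 1) ->
  BL n F -> BL n (fun l => Cpowz (F l) k).
Proof.
  intros H HF.
  assert (Hp : forall m, BL n (fun l => Cpow (F l) m)).
  { induction m as [|m IH]; simpl; [apply BL_const | apply BL_mul; auto]. }
  destruct k as [|p|p]; simpl; auto using BL_const.
  apply (BL_Cinv1 n (fun l => Cpow (F l) (Pos.to_nat p))); auto.
  intros l Hl. apply Cmod_Cpow1; auto.
Qed.

Lemma nth_map_Cinv (z : list C) (i : nat) : nth i (map Cinv z) C0 = Cinv (nth i z C0).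
Proof. rewrite <- Cinv_C0 at 1. apply map_nth. Qed.

(** * Regularity of the integrand of Q and its time derivative *)

Section Integrand.
Variables (q : R) (N : nat) (alpha : list R).
Hypothesis Hq : 0 < q < 1.
Hypothesis Halpha : forall ai, In ai alpha -> forall j, (1 <= j <= N)%nat -> 0 <= ai < 1.

Lemma BL_Psym (lam : list Z) : length lam = N -> BL N (fun l => Psym q lam (map Cinv (map eith l))).
Proof.
  intros Hl. unfold Psym. rewrite Hl.
  apply (BL_Csum N (pats N lam) (fun p l => Cprod (range 1 N) (fun j =>
    Pskew q (row p j) (row p (j - 1)) (nth (j - 1) (map Cinv (map eith l)) C0)))).
  intros p _.
  apply (BL_Cprod N (range 1 N) (fun j l =>
    Pskew q (row p j) (row p (j - 1)) (nth (j - 1) (map Cinv (map eith l)) C0))).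
  intros j Hj. rewrite range1 in Hj. apply in_seq in Hj. unfold Pskew. apply BL_mul; [|apply BL_const].
  apply (BL_Cpowz N (fun l => nth (j - 1) (map Cinv (map eith l)) C0)).
  - intros l Hll. rewrite nth_map_Cinv. apply Cmod_Cinv1, Cmod_coord. lia.
  - apply (BL_ext N (fun l => Cinv (nth (j - 1) (map eith l) C0))).
    + intros l _. symmetry. apply nth_map_Cinv.
    + apply BL_Cinv1; [|apply BL_coord]. intros l Hll. apply Cmod_coord. lia.
Qed.

Lemma BL_qpoch_inf (F : list R -> C) : (forall l, length l = N -> Cmod (F l) <= 1) ->
  BL N F -> BL N (fun l => qpoch_inf q (F l)).
Proof.
  intros H HF. assert (P := exp_pos (/ (1 - q))).
  assert (P2 : 0 < exp (/ (1 - q)) * exp (/ (1 - q))) by (apply Rmult_lt_0_compat; auto).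
  apply (BL_comp N F (qpoch_inf q) (fun z => Cmod z <= 1)
           (exp (/ (1 - q)) + exp (/ (1 - q)) * exp (/ (1 - q)))); auto.
  - lra.
  - intros z Hz. assert (B := Cmod_qpoch_inf_le q Hq 1 z Hz).
    replace (1 / (1 - q)) with (/ (1 - q)) in B by (field; lra). lra.
  - intros z w Hz Hw. eapply Rle_trans; [apply (qpoch_inf_lipschitz q Hq); auto|].
    apply Rmult_le_compat_r; [apply Cmod_ge0 | lra].
Qed.

(** On the torus all quotients z_i/z_j have modulus 1, and (x;q)_inf is bounded and Lipschitz on the
    closed unit disc. *)
Lemma BL_mq_core : BL N (fun l => mq_core q N (map eith l)).
Proof.
  unfold mq_core. apply BL_mul; [apply BL_const|].
  set (z := fun i (l : list R) => nth (i - 1) (map eith l) C0).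
  assert (Hz : forall i j, (1 <= i <= N)%nat -> (1 <= j <= N)%nat ->
    BL N (fun l => qpoch_inf q (Cdiv (z i l) (z j l)))).
  { intros i j Hi Hj. apply (BL_qpoch_inf (fun l => Cdiv (z i l) (z j l))).
    - intros l Hl. unfold Cdiv. rewrite Cmod_mul, Cmod_Cinv1; unfold z; rewrite !Cmod_coord by lia; lra.
    - unfold Cdiv. apply BL_mul; [apply BL_coord|]. apply BL_Cinv1; [|apply BL_coord].
      intros l Hl. unfold z. apply Cmod_coord. lia. }
  apply (BL_Cprod N (range 1 N) (fun i l => Cprod (range (S i) N) (fun j =>
    Cmul (qpoch_inf q (Cdiv (z i l) (z j l))) (qpoch_inf q (Cdiv (z j l) (z i l)))))).
  intros i Hi. rewrite range1 in Hi. apply in_seq in Hi.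
  apply (BL_Cprod N (range (S i) N) (fun j l =>
    Cmul (qpoch_inf q (Cdiv (z i l) (z j l))) (qpoch_inf q (Cdiv (z j l) (z i l))))).
  intros j Hj. unfold range in Hj. apply in_seq in Hj. apply BL_mul; apply Hz; lia.
Qed.

(** On the torus |alpha_i/z_j| = alpha_i < 1, so each inverted product is bounded below by
    [qpoch_lower q alpha_i]. *)
Lemma BL_Pi_alpha : BL N (fun l => Pi_alpha q N alpha (map eith l)).
Proof.
  unfold Pi_alpha. induction alpha as [|ai al IH]; simpl; [apply BL_const|].
  apply BL_mul; [|apply IH; intros; eapply Halpha; eauto; right; auto].
  apply (BL_Cprod N (range 1 N) (fun j l =>
    Cinv (qpoch_inf q (Cdiv (RtoC ai) (nth (j - 1) (map eith l) C0))))).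
  intros j Hj. rewrite range1 in Hj. apply in_seq in Hj.
  assert (Hai := Halpha ai (or_introl eq_refl) j ltac:(lia)).
  assert (Hm : forall l, length l = N -> Cmod (Cdiv (RtoC ai) (nth (j - 1) (map eith l) C0)) = ai).
  { intros l Hl. unfold Cdiv. rewrite Cmod_mul, Cmod_Cinv1 by (apply Cmod_coord; lia).
    rewrite Cmod_RtoC, Rabs_pos_eq; lra. }
  apply (BL_Cinv N (fun l => qpoch_inf q (Cdiv (RtoC ai) (nth (j - 1) (map eith l) C0)))
           (qpoch_lower q ai)).
  - apply qpoch_lower_pos.
  - intros l Hl. apply (Cmod_qpoch_inf_ge q Hq); [rewrite Hm by auto|]; lra.
  - apply BL_qpoch_inf.
    + intros l Hl. rewrite Hm by auto. lra.
    + unfold Cdiv. apply BL_mul; [apply BL_const|]. apply BL_Cinv1; [|apply BL_coord].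
      intros l Hl. apply Cmod_coord. lia.
Qed.

Definition static_part (lam : list Z) (l : list R) : C :=
  Cmul (Psym q lam (map Cinv (map eith l)))
       (Cmul (Pi_alpha q N alpha (map eith l)) (mq_core q N (map eith l))).

Definition torus_sum (l : list R) : C := Csum_list (seq 1 N) (fun j => nth (j - 1) (map eith l) C0).

Definition Q_integral (lam : list Z) (t : R) : C :=
  torus_int N (fun l => Cmul (static_part lam l) (Cexp (Cmul (torus_sum l) (RtoC t)))).

Lemma BL_static_part (lam : list Z) : length lam = N -> BL N (static_part lam).
Proof.
  intros Hl. unfold static_part. apply BL_mul; [apply BL_Psym; auto|].
  apply BL_mul; [apply BL_Pi_alpha | apply BL_mq_core].
Qed.

Lemma BL_torus_sum : BL N torus_sum.
Proof.
  unfold torus_sum. apply (BL_Csum N (seq 1 N) (fun j l => nth (j - 1) (map eith l) C0)).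
  intros j _. apply BL_coord.
Qed.

Definition Q_prefactor (lam : list Z) : R :=
  Rprod (range 1 (length lam - 1)) (fun i => qpoch_inf_R q (powerRZ q (lnth lam i - lnth lam (S i) + 1))).

Lemma Qfun_eq (lam : list Z) (t : R) : length lam = N ->
  Qfun q lam alpha t = Cmul (RtoC (Q_prefactor lam * / (2 * PI) ^ N)) (Q_integral lam t).
Proof.
  intros Hl. unfold Qfun, torus_contour. fold (Q_prefactor lam). rewrite Hl, RtoC_mul.
  set (A := RtoC (Q_prefactor lam)). set (B := RtoC (/ (2 * PI) ^ N)).
  transitivity (Cmul A (Cmul B (Q_integral lam t))); [|ring]. do 2 f_equal.
  unfold Q_integral. apply torus_int_ext. intros l Hll.
  rewrite (PiC_split q N) by (rewrite length_map; auto). unfold static_part, torus_sum. ring.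
Qed.

(** Differentiating the exponential brings down the sum of the z_j. At x = 1/z this is the sum of
    the 1/x_j, so the Pieri rule applies inside the integral. *)
Lemma Q_integral_deriv (lam : list Z) (t : R) : length lam = N -> signature lam ->
  Cderiv (Q_integral lam) t (Csum_list (seq 1 N) (fun i =>
    Cmul (RtoC (pieri_coef q N lam i)) (Q_integral (upd_nth (i - 1) Z.pred lam) t))).
Proof.
  intros Hl Hsig. unfold Q_integral.
  rewrite <- (torus_int_sum N (seq 1 N) (fun i => RtoC (pieri_coef q N lam i))
    (fun i l => Cmul (static_part (upd_nth (i - 1) Z.pred lam) l) (Cexp (Cmul (torus_sum l) (RtoC t))))).
  - rewrite (torus_int_ext N _ (fun l => Cmul (Cmul (torus_sum l) (static_part lam l))
                                              (Cexp (Cmul (torus_sum l) (RtoC t))))).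
    + apply torus_int_deriv; [apply BL_static_part; auto | apply BL_torus_sum].
    + intros l Hll.
      assert (HP := pieri q Hq N lam (map Cinv (map eith l)) Hl Hsig).
      assert (Hs : Csum_list (seq 1 N) (fun j => Cinv (nth (j - 1) (map Cinv (map eith l)) C0))
        = torus_sum l).
      { apply Csum_ext. intros j _. rewrite nth_map_Cinv, Cinv_involutive. reflexivity. }
      rewrite Hs in HP. unfold static_part.
      set (E := Cexp _). set (R0 := Cmul (Pi_alpha _ _ _ _) _).
      transitivity (Cmul (Cmul (torus_sum l) (Psym q lam (map Cinv (map eith l)))) (Cmul R0 E)); [|ring].
      rewrite HP.
      * match goal with |- _ = Cmul ?A ?b => replace (Cmul A b) with (Cmul b A) by ring end.
        rewrite <- Csum_scal. apply Csum_ext. intros i _. ring.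
      * intros i Hi. rewrite nth_map_Cinv. apply Cinv_neq_C0, Cmod1_neq_C0, Cmod_coord. lia.
  - intros i _. apply BL_mul; [apply BL_static_part; rewrite length_upd_nth; auto|].
    apply BL_Cexp, BL_mul; [apply BL_torus_sum | apply BL_const].
Qed.

End Integrand.

(** Converts the Pieri coefficient into the top-level factor [phi] of the balance. Lowering part i
    multiplies the prefactor by 1 - q^(lam_i - lam_{i+1}) through factor i and divides it by 1 -
    q^(lam_{i-1} - lam_i + 1) through factor i - 1. If the string is closed, both sides are 0. *)
Lemma Q_prefactor_lower (q : R) (N : nat) (lam : pattern) (i : nat) : 0 < q < 1 -> inG N lam ->
  (1 <= i <= N)%nat ->
  Q_prefactor q (row lam N) * pieri_coef q N (row lam N) i
  = (if openb N lam i N then phi q lam i N else 0) * Q_prefactor q (upd_nth (i - 1) Z.pred (row lam N)).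
Proof.
  intros Hq HG Hi.
  assert (Hlen := G_row_length N lam HG N ltac:(lia)).
  assert (Hrow : forall l, (1 <= l < N)%nat -> (lnth (row lam N) (S l) <= lnth (row lam N) l)%Z).
  { intros l Hl. apply (G_row N lam HG N l); lia. }
  unfold openb, phi. rewrite Nat.eqb_refl.
  change (entry lam N) with (lnth (row lam N)).
  set (r := row lam N) in *. unfold Q_prefactor. rewrite length_upd_nth, Hlen, range1.
  set (c := pieri_coef q N r i). set (d := 1 - powerRZ q (lnth r (i - 1) - lnth r i + 1)).
  destruct (Nat.eqb i N || Z.ltb (lnth r (S i)) (lnth r i))%bool eqn:Hop.
  - assert (Hd : (1 < i)%nat -> 0 < d).
    { intros H1. apply (q_factor_pos q Hq). assert (H := Hrow (i - 1)%nat ltac:(lia)).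
      replace (S (i - 1)) with i in H by lia. lia. }
    rewrite (Rprod_perturb (N - 1) i
      (fun l => qpoch_inf_R q (powerRZ q (lnth r l - lnth r (S l) + 1)))
      (fun l => qpoch_inf_R q (powerRZ q (lnth (upd_nth (i - 1) Z.pred r) l
                                 - lnth (upd_nth (i - 1) Z.pred r) (S l) + 1))) c (/ d)).
    + set (X := Rprod _ _).
      destruct (Nat.leb_spec 1 i), (Nat.leb_spec i (N - 1)), (Nat.leb_spec 1 (i - 1)),
        (Nat.leb_spec (i - 1) (N - 1)), (Nat.eqb_spec i 1); try lia; cbn [andb].
      * specialize (Hd ltac:(lia)). field. lra.
      * ring.
      * specialize (Hd ltac:(lia)). unfold c, pieri_coef.
        destruct (Nat.eqb_spec i N); [|lia]. field. lra.
      * unfold c, pieri_coef. destruct (Nat.eqb_spec i N); [|lia]. ring.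
    + intros l Hl. rewrite !lnth_upd_nth by lia.
      destruct (Nat.eqb_spec l i) as [->|Eli].
      * destruct (Nat.eqb_spec (S i) i), (Nat.eqb_spec i (i - 1)); try lia.
        replace (Z.pred (lnth r i) - lnth r (S i) + 1)%Z with (lnth r i - lnth r (S i))%Z by lia.
        rewrite (qpoch_inf_qZ_rec q Hq (lnth r i - lnth r (S i))). unfold c, pieri_coef.
        destruct (Nat.eqb_spec i N); [lia|]. ring.
      * destruct (Nat.eqb_spec (S l) i) as [Esl|Esl], (Nat.eqb_spec l (i - 1)) as [Elm|Elm]; try lia.
        -- replace (lnth r l - Z.pred (lnth r i) + 1)%Z with (lnth r l - lnth r (S l) + 1 + 1)%Z
             by (rewrite Esl; lia).
           rewrite (qpoch_inf_qZ_rec q Hq (lnth r l - lnth r (S l) + 1)).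
           assert (Ed : d = 1 - powerRZ q (lnth r l - lnth r (S l) + 1)).
           { unfold d. rewrite Esl, Elm. reflexivity. }
           rewrite <- Ed. specialize (Hd ltac:(lia)). field. lra.
        -- ring.
  - apply Bool.orb_false_elim in Hop. destruct Hop as [H1 H2].
    apply Nat.eqb_neq in H1. apply Z.ltb_ge in H2. assert (H := Hrow i ltac:(lia)).
    unfold c, pieri_coef. destruct (Nat.eqb_spec i N); [lia|].
    replace (lnth r i - lnth r (S i))%Z with 0%Z by lia. simpl (powerRZ q 0). ring.
Qed.

Lemma Cderiv_ext (f g : R -> C) (t : R) (l : C) : (forall s, f s = g s) -> Cderiv f t l -> Cderiv g t l.
Proof.
  intros H. replace g with f; auto. apply functional_extensionality, H.
Qed.

Lemma Cderiv_scal (f : R -> C) (t : R) (c l : C) : Cderiv f t l -> Cderiv (fun s => Cmul c (f s)) t (Cmul c l).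
Proof.
  intros [H1 H2]. split; simpl.
  - exact (derivable_pt_lim_minus _ _ _ _ _ (derivable_pt_lim_scal _ (fst c) _ _ H1)
                                            (derivable_pt_lim_scal _ (snd c) _ _ H2)).
  - exact (derivable_pt_lim_plus _ _ _ _ _ (derivable_pt_lim_scal _ (fst c) _ _ H2)
                                           (derivable_pt_lim_scal _ (snd c) _ _ H1)).
Qed.

Lemma Cderiv_real_mul (r : R -> R) (f : R -> C) (t r' : R) (l : C) : derivable_pt_lim r t r' ->
  Cderiv f t l ->
  Cderiv (fun s => Cmul (RtoC (r s)) (f s)) t (Cadd (Cmul (RtoC r') (f t)) (Cmul (RtoC (r t)) l)).
Proof.
  intros H [H1 H2].
  assert (E : forall s, Cmul (RtoC (r s)) (f s) = (r s * fst (f s), r s * snd (f s))).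
  { intros s. apply C_ext; simpl; ring. }
  apply (Cderiv_ext (fun s => (r s * fst (f s), r s * snd (f s)))); [intros; symmetry; apply E|].
  split; simpl.
  - replace (r' * fst (f t) - 0 * snd (f t) + (r t * fst l - 0 * snd l))
      with (r' * fst (f t) + r t * fst l) by ring.
    exact (derivable_pt_lim_mult r (fun s => fst (f s)) t _ _ H H1).
  - replace (r' * snd (f t) + 0 * fst (f t) + (r t * snd l + 0 * fst l))
      with (r' * snd (f t) + r t * snd l) by ring.
    exact (derivable_pt_lim_mult r (fun s => snd (f s)) t _ _ H H2).
Qed.

Lemma Cpowz_RtoC (x : R) (k : Z) : Cpowz (RtoC x) k = RtoC (powerRZ x k).
Proof.
  assert (H : forall n, Cpow (RtoC x) n = RtoC (x ^ n)).
  { induction n as [|n IH]; simpl; [reflexivity|]. rewrite IH, <- RtoC_mul. reflexivity. }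
  destruct k; simpl; rewrite ?H, ?Cinv_RtoC; reflexivity.
Qed.

(** * Time derivative of the process *)

Section Process.
Variables (q : R) (N : nat) (a alpha : list R).
Hypothesis Hq : 0 < q < 1.
Hypothesis Hlen : length a = N.
Hypothesis Ha : forall i, (1 <= i <= N)%nat -> 0 < nth (i - 1) a 0.
Hypothesis Halpha : forall ai, In ai alpha -> forall j, (1 <= j <= N)%nat -> 0 <= ai < 1.

Let total : R := Rsum_list (seq 1 N) (fun k => nth (k - 1) a 0).

(** The part Q/Pi of the measure, which depends on the top row only; its real and imaginary parts
    are the [V] of [master_balance]. *)
Definition Q_normalized (lam : list Z) (s : R) : C :=
  Cmul (Cinv (Pi_alpha q N alpha (map RtoC a))) (Cmul (RtoC (exp (- total * s))) (Qfun q lam alpha s)).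

Lemma Pt_eq (s : R) (p : pattern) :
  Pt q N a alpha s p = Cmul (RtoC (pattern_weight q N a p)) (Q_normalized (row p N) s).
Proof.
  unfold Pt, Q_normalized, Cdiv.
  assert (E1 : Cprod (range 1 N) (fun j => Pskew q (row p j) (row p (j - 1)) (RtoC (nth (j - 1) a 0)))
    = RtoC (pattern_weight q N a p)).
  { unfold pattern_weight. rewrite <- Cprod_RtoC. apply Cprod_ext. intros j _.
    unfold level_weight. rewrite RtoC_mul, <- Cpowz_RtoC. reflexivity. }
  rewrite E1, (PiC_split q N) by (rewrite length_map; auto).
  assert (E2 : Csum_list (seq 1 N) (fun j => nth (j - 1) (map RtoC a) C0) = RtoC total).
  { unfold total. generalize (seq 1 N). intros l. induction l as [|k l IH]; simpl; [reflexivity|].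
    rewrite IH, RtoC_add. f_equal. change C0 with (RtoC 0). apply map_nth. }
  rewrite E2, Cinv_mul.
  assert (E3 : Cinv (Cexp (Cmul (RtoC total) (RtoC s))) = RtoC (exp (- total * s))).
  { symmetry. apply Cinv_unique. rewrite <- RtoC_mul.
    assert (E4 : forall x, Cexp (RtoC x) = RtoC (exp x)).
    { intros x. unfold Cexp, RtoC; simpl. rewrite cos_0, sin_0. f_equal; ring. }
    rewrite E4, <- RtoC_mul, <- exp_plus. replace (total * s + - total * s) with 0 by ring.
    rewrite exp_0. reflexivity. }
  rewrite E3. ring.
Qed.

Lemma Qfun_deriv (lam : pattern) (t : R) : inG N lam ->
  Cderiv (Qfun q (row lam N) alpha) t (Csum_list (seq 1 N) (fun j =>
    Cmul (RtoC (if openb N lam j N then phi q lam j N else 0))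
         (Qfun q (upd_nth (j - 1) Z.pred (row lam N)) alpha t))).
Proof.
  intros HG. assert (Hl := G_row_length N lam HG N (Nat.le_refl N)).
  assert (Hsig : signature (row lam N)).
  { intros i Hi. rewrite Hl in Hi. apply (G_row N lam HG N i); lia. }
  apply (Cderiv_ext (fun s => Cmul (RtoC (Q_prefactor q (row lam N) * / (2 * PI) ^ N))
                                   (Q_integral q N alpha (row lam N) s))).
  { intros s. symmetry. apply Qfun_eq; auto. }
  replace (Csum_list _ _) with (Cmul (RtoC (Q_prefactor q (row lam N) * / (2 * PI) ^ N))
    (Csum_list (seq 1 N) (fun i => Cmul (RtoC (pieri_coef q N (row lam N) i))
                 (Q_integral q N alpha (upd_nth (i - 1) Z.pred (row lam N)) t)))).
  { apply Cderiv_scal. apply Q_integral_deriv; auto. }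
  rewrite <- Csum_scal. apply Csum_ext. intros i Hi. apply in_seq in Hi.
  rewrite (Qfun_eq q N) by (rewrite length_upd_nth; auto).
  set (J := Q_integral _ _ _ _ _). assert (HP := Q_prefactor_lower q N lam i Hq HG ltac:(lia)).
  transitivity (Cmul (RtoC (Q_prefactor q (row lam N) * pieri_coef q N (row lam N) i))
                     (Cmul (RtoC (/ (2 * PI) ^ N)) J)).
  - rewrite !RtoC_mul. ring.
  - rewrite HP, !RtoC_mul. ring.
Qed.

Lemma Q_normalized_deriv (lam : pattern) (t : R) : inG N lam ->
  Cderiv (Q_normalized (row lam N)) t
    (Csub (Csum_list (seq 1 N) (fun j =>
             Cmul (RtoC (if openb N lam j N then phi q lam j N else 0))
                  (Q_normalized (upd_nth (j - 1) Z.pred (row lam N)) t)))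
          (Cmul (RtoC total) (Q_normalized (row lam N) t))).
Proof.
  intros HG.
  assert (Hexp : derivable_pt_lim (fun s => exp (- total * s)) t (- total * exp (- total * t))).
  { replace (- total * exp (- total * t)) with (exp (- total * t) * (- total * 1)) by ring.
    apply (derivable_pt_lim_comp (fun s => - total * s) exp).
    - apply (derivable_pt_lim_scal (fun s => s)). apply derivable_pt_lim_id.
    - apply derivable_pt_lim_exp. }
  assert (H := Cderiv_scal _ t (Cinv (Pi_alpha q N alpha (map RtoC a))) _
                 (Cderiv_real_mul _ _ t _ _ Hexp (Qfun_deriv lam t HG))).
  eapply eq_ind; [exact H|]. unfold Q_normalized.
  set (K := Cinv _). set (e := exp (- total * t)).
  set (S0 := Csum_list (seq 1 N) (fun j => Cmul _ (Qfun _ _ _ _))).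
  replace (Csum_list (seq 1 N) _) with (Cmul (Cmul K (RtoC e)) S0).
  - replace (RtoC (- total * e)) with (Csub C0 (Cmul (RtoC total) (RtoC e))); [ring|].
    apply C_ext; simpl; ring.
  - unfold S0. rewrite <- Csum_scal. apply Csum_ext. intros j _. ring.
Qed.

(** The derivative of the top-row factor and the right side of [master_balance] are the same
    expression, so the two computations meet here, once for each component. *)
Lemma Pt_deriv (lam : pattern) (t : R) (S : list pattern) : inG N lam ->
  NoDup S -> Forall (inG N) S ->
  (forall mu, inG N mu -> Lgen q N a mu lam <> 0 -> In mu S) ->
  derivable_pt_lim (fun s => fst (Pt q N a alpha s lam)) t
    (Rsum_list S (fun mu => fst (Pt q N a alpha t mu) * Lgen q N a mu lam)) /\
  derivable_pt_lim (fun s => snd (Pt q N a alpha s lam)) t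
    (Rsum_list S (fun mu => snd (Pt q N a alpha t mu) * Lgen q N a mu lam)).
Proof.
  intros HG HS HF HC.
  assert (H : Cderiv (fun s => Pt q N a alpha s lam) t
    (Cmul (RtoC (pattern_weight q N a lam))
      (Csub (Csum_list (seq 1 N) (fun j =>
             Cmul (RtoC (if openb N lam j N then phi q lam j N else 0))
                  (Q_normalized (upd_nth (j - 1) Z.pred (row lam N)) t)))
          (Cmul (RtoC total) (Q_normalized (row lam N) t))))).
  { apply (Cderiv_ext (fun s => Cmul (RtoC (pattern_weight q N a lam)) (Q_normalized (row lam N) s))).
    - intros s. symmetry. apply Pt_eq.
    - apply Cderiv_scal, Q_normalized_deriv; auto. }
  assert (Ef : forall (r : R) (z : C), fst (Cmul (RtoC r) z) = r * fst z) by (intros; simpl; ring).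
  assert (Es : forall (r : R) (z : C), snd (Cmul (RtoC r) z) = r * snd z) by (intros; simpl; ring).
  destruct H as [H1 H2]. split; [clear H2 | clear H1].
  - eapply eq_ind; [exact H1|]. symmetry.
    rewrite (Rsum_ext S _ (fun mu => pattern_weight q N a mu * fst (Q_normalized (row mu N) t)
                                     * Lgen q N a mu lam)).
    2:{ intros mu _. rewrite Pt_eq, Ef. reflexivity. }
    rewrite (master_balance q N a lam (fun r => fst (Q_normalized r t))) by auto.
    rewrite Ef. f_equal. unfold Csub. cbn [fst]. rewrite Csum_fst, Ef. f_equal.
    apply Rsum_ext. intros j _. rewrite Ef. destruct (openb N lam j N); ring.
  - eapply eq_ind; [exact H2|]. symmetry.
    rewrite (Rsum_ext S _ (fun mu => pattern_weight q N a mu * snd (Q_normalized (row mu N) t)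
                                     * Lgen q N a mu lam)).
    2:{ intros mu _. rewrite Pt_eq, Es. reflexivity. }
    rewrite (master_balance q N a lam (fun r => snd (Q_normalized r t))) by auto.
    rewrite Es. f_equal. unfold Csub. cbn [snd]. rewrite Csum_snd, Es. f_equal.
    apply Rsum_ext. intros j _. rewrite Es. destruct (openb N lam j N); ring.
Qed.

End Process.

Theorem mainTheorem7 (q : R) (N : nat) (a alpha : list R) :
  0 < q < 1 ->
  length a = N ->
  (forall j, (1 <= j <= N)%nat -> 0 < nth (j - 1) a 0 <= 1) ->
  (forall ai, In ai alpha -> 0 <= ai /\ forall j, (1 <= j <= N)%nat -> ai < nth (j - 1) a 0) ->
  (forall lam : pattern, inG N lam -> forall t, 0 < t ->
     (exists S : list pattern, NoDup S /\ Forall (inG N) S /\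
        forall mu, inG N mu -> Lgen q N a mu lam <> 0 -> In mu S) /\
     (forall S : list pattern, NoDup S -> Forall (inG N) S ->
        (forall mu, inG N mu -> Lgen q N a mu lam <> 0 -> In mu S) ->
        derivable_pt_lim (fun s => fst (Pt q N a alpha s lam)) t
          (Rsum_list S (fun mu => fst (Pt q N a alpha t mu) * Lgen q N a mu lam)) /\
        derivable_pt_lim (fun s => snd (Pt q N a alpha s lam)) t
          (Rsum_list S (fun mu => snd (Pt q N a alpha t mu) * Lgen q N a mu lam)))) /\
  (forall mu : pattern, inG N mu ->
     (forall lam, inG N lam -> lam <> mu -> 0 <= Lgen q N a mu lam) /\
     (exists S : list pattern, NoDup S /\ Forall (inG N) S /\
        forall lam, inG N lam -> Lgen q N a mu lam <> 0 -> In lam S) /\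
     (forall S : list pattern, NoDup S -> Forall (inG N) S ->
        (forall lam, inG N lam -> Lgen q N a mu lam <> 0 -> In lam S) ->
        Rsum_list S (fun lam => Lgen q N a mu lam) = 0)).
Proof.
  intros Hq Hlen Ha1 Hal.
  assert (Ha : forall i, (1 <= i <= N)%nat -> 0 < nth (i - 1) a 0) by (intros i Hi; apply Ha1; auto).
  (* The bound alpha_i < 1 comes from some a_j <= 1, hence the guard by an index j: for N = 0 no a_j
     is available. *)
  assert (Halpha : forall ai, In ai alpha -> forall j, (1 <= j <= N)%nat -> 0 <= ai < 1).
  { intros ai Hin j Hj. destruct (Hal ai Hin) as [H1 H2]. specialize (H2 j Hj).
    specialize (Ha1 j Hj). lra. }
  split.
  - intros lam HG t _. split.
    + exists (sources N lam). split; [apply G_list_NoDup|]. split; [apply G_list_Forall|].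
      intros mu Hm Hn. apply (sources_complete q N a); auto.
    + intros S HS HF HC. apply Pt_deriv; auto.
  - intros mu HG. split; [|split].
    + intros lam _ Hne. apply Lgen_offdiag_nonneg; auto.
    + exists (targets N mu). split; [apply G_list_NoDup|]. split; [apply G_list_Forall|].
      intros lam Hl Hn. apply (targets_complete q N a); auto.
    + intros S HS HF HC. apply Lgen_row_sum; auto.
Qed.
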